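(* Let $G$ be a finite group with homomorphisms $s,h:G\to\mathbb Z_2$, let $\omega$ be a normalized $U(1)$-valued 2-cocycle on $G$ (coefficients twisted by $s$), and let $A=\mathbb C[G,\omega,s]$ with $\mathbb Z_2$-grading $h$. Let $(V,\rho_V)$ be an orthogonal real representation of $G$ of dimension $d$ and let $V'$ be the representation on the same space with $\rho_{V'}(g)=(-1)^{s(g)}\rho_V(g)$. Then there is an isomorphism of $\mathbb Z_2$-graded algebras $$A^{V\oplus V'}\;\cong\; Cl^{d,0}\,\hat\otimes\, Cl^{0,d}\,\hat\otimes\, A ,$$ and there is a $G$-homotopy equivalence of classifying spaces $$K(A^{V\oplus V'})\;\simeq\; K(A).$$
   Context: Symmetry algebra. $G$ acts on $U(1)$ by ${}^g a=a$ if $s(g)=0$ and ${}^g a=\bar a$ if $s(g)=1$; $\omega$ is a 2-cocycle for this action with $\omega(1,g)=\omega(g,1)=1$. $\mathbb C[G,\omega,s]$ is the real associative algebra that is a left $\mathbb C$-vector space with basis $G$, with $g\cdot g'=\omega(g,g')\,gg'$ and $g z={}^g z\, g$ for $z\in\mathbb C$ (where ${}^g z=z$ if $s(g)=0$ and ${}^g z=\bar z$ if $s(g)=1$). It is $\mathbb Z_2$-graded: $\mathbb C$ has degree $0$, $g$ has degree $h(g)$. Algebra $A^W$ for an orthogonal real representation $(W,\rho_W)$ of $G$ with orthonormal basis $\tilde e_1,\dots,\tilde e_q$: the real algebra generated by $A$ and $\tilde e_1,\dots,\tilde e_q$ with relations $\tilde e_i^2=1$, $\tilde e_i\tilde e_j=-\tilde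 e_j\tilde e_i$ ($i\neq j$), $\tilde e_iz=z\tilde e_i$ for $z\in\mathbb C\subset A$, and $(-1)^{h(g)}g\,\tilde e_i\,(g)^{-1}=\rho_W(g)(\tilde e_i)$, where $(g)^{-1}$ is the inverse in the algebra. The $\tilde e_i$ have degree $1$. For $W=0$, $A^W=A$. Clifford algebras and super tensor product. $Cl^{p,q}$ is the real algebra with mutually anticommuting generators $e_1,\dots,e_p$ (squaring to $-1$) and $\tilde e_1,\dots,\tilde e_q$ (squaring to $+1$), all of degree 1. $\hat\otimes$ is the super tensor product over $\mathbb R$: $a\hat\otimes1$ and $1\hat\otimes b$ anticommute if both have degree 1 and commute if one has degree 0. Classifying spaces. Let $(W,\rho_W)$ be an orthogonal real representation of $G$ with orthonormal basis $\tilde e_1,\dots,\tilde e_q$ (possibly $W=0$), and let $B=Cl^{0,1}\hat\otimes A^W$. The universe $\mathcal U=\bigoplus_{n\ge1}W_n$ is a countable direct sum of finite-dimensional irreducible $B$-modules in which each isomorphism class of irreducible $B$-module occurs infinitely often; $\rho$ is its representation, $M_0=\rho(\tilde e_1\hat\otimes1)$ with $\tilde e_1\in Cl^{0,1}$, and $U_n=\bigoplus_{j\le n}W_j$. $K(A^W)$ is the space of $\mathbb C$-linear maps $M$ on $\mathcal U$ (complex structure $\rho(i)$) with $M^2=1$, anticommuting with $\rho(\tilde e_i)$ for all basis vectors $\tilde e_i$ of $W$, such that for some $n$, $M$ preserves $U_n$ and equals $M_0$ on $\bigoplus_{j>n}W_j$; it has the direct limit topology over $n$. $G$ acts on $K(A^W)$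 by $g\cdot M=(-1)^{h(g)}\rho(g)M\rho(g)^{-1}$. *)

(* Defs.v *)
From HB Require Import structures.
From mathcomp Require Import all_boot all_order all_algebra fingroup.
From mathcomp Require Import generic_quotient mxrepresentation complex.
From mathcomp Require Import all_classical all_reals all_analysis.
Import Order.TTheory GRing.Theory Num.Theory.
Import numFieldNormedType.Exports.

Set Implicit Arguments.
Unset Strict Implicit.
Unset Printing Implicit Defensive.

Local Open Scope ring_scope.

(* Unital associative R-algebras, as rings with a central image of R. MathComp's
   algType also requires 1 != 0, which is not available a priori for an algebra
   given by generators and relations. *)
HB.mixin Record isRAlgebra (R : pzRingType) A of GRing.PzRing A := {
  scal : R -> A;
  scal_zmod : zmod_morphism scal;
  scal_monoid : monoid_morphism scal;
  scalC : forall (r : R) (x : A), scal r * x = x * scal r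
}.

#[short(type="ralgType")]
HB.structure Definition RAlgebra (R : pzRingType) :=
  {A of GRing.PzRing A & isRAlgebra R A}.

(* Z_2-graded algebras; [homog false] and [homog true] are the subspaces of
   elements of degree 0 and 1. *)
HB.mixin Record isSuperAlgebra (R : pzRingType) A of RAlgebra R A := {
  homog : bool -> A -> Prop;
  homog0 : forall b, homog b 0;
  homogP : forall b (r : R) (x y : A),
    homog b x -> homog b y -> homog b (scal r * x + y);
  homog1 : homog false 1;
  homogM : forall b c x y, homog b x -> homog c y -> homog (b (+) c) (x * y);
  homog_sum : forall x, exists x0 x1,
    [/\ homog false x0, homog true x1 & x = x0 + x1];
  homog_cap : forall x, homog false x -> homog true x -> x = 0
}.

#[short(type="superAlgType")]
HB.structure Definition SuperAlgebra (R : pzRingType) :=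
  {A of RAlgebra R A & isSuperAlgebra R A}.

Definition super_isomorphic (R : pzRingType) (A B : superAlgType R) : Prop :=
  exists f : {rmorphism A -> B},
    [/\ forall r : R, f (scal r) = scal r,
        bijective f &
        forall b x, homog b x <-> homog b (f x)].

Section AlgTheory.
Variables (R : pzRingType) (A : ralgType R).

HB.instance Definition _ := GRing.isZmodMorphism.Build R A scal scal_zmod.
HB.instance Definition _ := GRing.isMonoidMorphism.Build R A scal scal_monoid.

Lemma scal0 : scal 0 = 0 :> A. Proof. exact: rmorph0. Qed.
Lemma scal1 : scal 1 = 1 :> A. Proof. exact: rmorph1. Qed.
Lemma scalD r s : scal (r + s) = scal r + scal s :> A.
Proof. exact: rmorphD. Qed.
Lemma scalN r : scal (- r) = - scal r :> A. Proof. exact: rmorphN. Qed.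
Lemma scalM r s : scal (r * s) = scal r * scal s :> A.
Proof. exact: rmorphM. Qed.

(* The smallest family of subspaces that contains the elements declared
   homogeneous by g and is compatible with products. *)
Inductive generated_degree (g : bool -> A -> Prop) : bool -> A -> Prop :=
| Gdeg_gen b x : g b x -> generated_degree g b x
| Gdeg_0 b : generated_degree g b 0
| Gdeg_lin b (r : R) x y : generated_degree g b x -> generated_degree g b y ->
    generated_degree g b (scal r * x + y)
| Gdeg_1 : generated_degree g false 1
| Gdeg_mul b c x y : generated_degree g b x -> generated_degree g c y ->
    generated_degree g (b (+) c) (x * y).

End AlgTheory.

Section GeneratedDegree.
Variables (R : realType) (A : ralgType R) (g : bool -> A -> Prop).
Variable alpha : {rmorphism A -> A}.
Hypothesis alpha_scal : forall r : R, alpha (scal r) = scal r.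
Hypothesis alpha_gen : forall b x, g b x -> alpha x = (-1) ^+ b * x.

Lemma generated_degree_alpha b x :
  generated_degree g b x -> alpha x = (-1) ^+ b * x.
Proof.
elim=> {b x} [b x /alpha_gen //|b|b r x y _ hx _ hy||b c x y _ hx _ hy] /=.
- by rewrite rmorph0 mulr0.
- rewrite rmorphD rmorphM alpha_scal hx hy mulrDr.
  by rewrite !mulrA; congr (_ * _ + _); case: b {hx hy};
    rewrite ?expr0 ?expr1 ?mulr1 ?mul1r // mulrN1 mulN1r.
- by rewrite rmorph1 mulr1.
rewrite rmorphM hx hy; case: b {hx}; case: c {hy}; rewrite /= ?expr0 ?expr1.
- by rewrite !mulN1r mulrNN mul1r.
- by rewrite !mulN1r mul1r mulNr.
- by rewrite !mulN1r mul1r mulrN.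
by rewrite !mul1r.
Qed.

Lemma generated_degree_cap x :
  generated_degree g false x -> generated_degree g true x -> x = 0.
Proof.
move=> /generated_degree_alpha e0 /generated_degree_alpha; rewrite e0.
rewrite expr0 expr1 mul1r mulN1r => /eqP; rewrite -addr_eq0 => /eqP xx.
have : scal (2^-1 : R) * (x + x) = 0 by rewrite xx mulr0.
rewrite -[in LHS](mul1r x) -mulrDl mulrA -scal1 -scalD -scalM.
by rewrite -[1 + 1]/(2 : R) mulVf ?pnatr_eq0 // scal1 mul1r.
Qed.

End GeneratedDegree.

Section Parity.
Variables (R : realType) (A : superAlgType R).
Implicit Types (x y : A).

Lemma homogD b x y : homog b x -> homog b y -> homog b (x + y).
Proof.
by move=> hx hy; rewrite -[x]mul1r -(scal1 A); apply: homogP.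
Qed.

Lemma homogZ b (r : R) x : homog b x -> homog b (scal r * x).
Proof.
by move=> hx; rewrite -[scal r * x]addr0; apply: homogP => //; apply: homog0.
Qed.

Lemma homogN b x : homog b x -> homog b (- x).
Proof.
move=> hx; rewrite -mulN1r -(scal1 A) -scalN.
exact: homogZ.
Qed.

Lemma homog_pair x :
  exists p : A * A, [/\ homog false p.1, homog true p.2 & x = p.1 + p.2].
Proof. by have [x0 [x1 h]] := homog_sum x; exists (x0, x1). Qed.

Definition parity x : A :=
  let p := sval (cid (homog_pair x)) in p.1 - p.2.

Lemma parityE x0 x1 : homog false x0 -> homog true x1 ->
  parity (x0 + x1) = x0 - x1.
Proof.
move=> h0 h1; rewrite /parity; case: cid => -[y0 y1] /= [k0 k1 e].
have e' : x0 - y0 = y1 - x1.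
  by apply/eqP; rewrite subr_eq addrAC eq_sym subr_eq addrC -e addrC.
have z0 : x0 - y0 = 0.
  apply: homog_cap; first by apply: homogD => //; apply: homogN.
  by rewrite e'; apply: homogD => //; apply: homogN.
have -> : y0 = x0 by apply/eqP; rewrite eq_sym -subr_eq0 z0.
by have -> : y1 = x1 by apply/eqP; rewrite -subr_eq0 -e' z0.
Qed.

Lemma parity0 x : homog false x -> parity x = x.
Proof.
by move=> hx; rewrite -[in LHS](addr0 x) parityE ?subr0 //; apply: homog0.
Qed.

Lemma parity1 x : homog true x -> parity x = - x.
Proof.
by move=> hx; rewrite -[in LHS](add0r x) parityE ?sub0r //; apply: homog0.
Qed.

Lemma parity_zmod : zmod_morphism parity.
Proof.
move=> x y.
have [x0 [x1 [hx0 hx1 ->]]] := homog_sum x.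
have [y0 [y1 [hy0 hy1 ->]]] := homog_sum y.
have -> : x0 + x1 - (y0 + y1) = (x0 - y0) + (x1 - y1) by rewrite opprD addrACA.
rewrite !parityE //; try by apply: homogD => //; apply: homogN.
by rewrite !opprD opprK addrACA.
Qed.

Lemma parity_monoid : monoid_morphism parity.
Proof.
split=> [|x y]; first by rewrite parity0 //; apply: homog1.
have [x0 [x1 [hx0 hx1 ->]]] := homog_sum x.
have [y0 [y1 [hy0 hy1 ->]]] := homog_sum y.
have -> : (x0 + x1) * (y0 + y1) = (x0 * y0 + x1 * y1) + (x0 * y1 + x1 * y0).
  by rewrite mulrDl !mulrDr [x1 * y0 + _]addrC addrACA.
have h0 : homog false (x0 * y0 + x1 * y1).
  apply: homogD; first exact: (homogM _ _ _ _ hx0 hy0).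
  exact: (homogM _ _ _ _ hx1 hy1).
have h1 : homog true (x0 * y1 + x1 * y0).
  apply: homogD; first exact: (homogM _ _ _ _ hx0 hy1).
  exact: (homogM _ _ _ _ hx1 hy0).
rewrite !parityE // mulrDl !mulrDr !(mulrN, mulNr) opprK opprD addrACA.
by rewrite [- _ + x1 * y1]addrC.
Qed.

HB.instance Definition _ := GRing.isZmodMorphism.Build A A parity parity_zmod.
HB.instance Definition _ :=
  GRing.isMonoidMorphism.Build A A parity parity_monoid.

Lemma homog_scal (r : R) : homog false (scal r : A).
Proof. by rewrite -[scal r]mulr1; apply/homogZ/homog1. Qed.

Lemma parity_scal (r : R) : parity (scal r) = scal r.
Proof. exact/parity0/homog_scal. Qed.

End Parity.

(* Algebras given by generators X and relations. *)
Inductive term (R X : Type) : Type :=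
| Gen of X | Cst of R | Add of term R X & term R X | Mul of term R X & term R X.
Arguments Gen {R X}.
Arguments Cst {R X}.
Arguments Add {R X}.
Arguments Mul {R X}.

HB.instance Definition _ (R X : Type) := gen_eqMixin (term R X).
HB.instance Definition _ (R X : Type) := gen_choiceMixin (term R X).

Declare Scope presentation_scope.
Delimit Scope presentation_scope with pres.
Bind Scope presentation_scope with term.
Notation "x + y" := (Add x y) : presentation_scope.
Notation "x * y" := (Mul x y) : presentation_scope.

Section Presented.
Variables (R : comPzRingType) (X : Type) (rel : term R X -> term R X -> Prop).

Inductive congr_rel : term R X -> term R X -> Prop :=
| Crel t u : rel t u -> congr_rel t u
| Crefl t : congr_rel t t
| Csym t u : congr_rel t u -> congr_rel u t
| Ctrans t u v : congr_rel t u -> congr_rel u v -> congr_rel t v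
| CaddE t t' u u' : congr_rel t t' -> congr_rel u u' ->
    congr_rel (t + u) (t' + u')
| CmulE t t' u u' : congr_rel t t' -> congr_rel u u' ->
    congr_rel (t * u) (t' * u')
| CaddA t u v : congr_rel (t + (u + v)) (t + u + v)
| CaddC t u : congr_rel (t + u) (u + t)
| Cadd0 t : congr_rel (Cst 0 + t) t
| Cmul0 t : congr_rel (Cst 0 * t) (Cst 0)
| CmulA t u v : congr_rel (t * (u * v)) (t * u * v)
| Cmul1 t : congr_rel (Cst 1 * t) t
| CmulDl t u v : congr_rel ((t + u) * v) (t * v + u * v)
| CmulDr t u v : congr_rel (t * (u + v)) (t * u + t * v)
| CcstD r s : congr_rel (Cst (r + s)%R) (Cst r + Cst s)
| CcstM r s : congr_rel (Cst (r * s)%R) (Cst r * Cst s)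
| CcstC r t : congr_rel (Cst r * t) (t * Cst r).

Local Open Scope quotient_scope.

Definition congr_bool (t u : term R X) : bool := `[< congr_rel t u >].

Lemma congr_bool_equiv : equiv_class_of congr_bool.
Proof.
split.
- by move=> t; apply/asboolP; apply: Crefl.
- by move=> t u; apply/asboolP/asboolP; apply: Csym.
by move=> u t v /asboolP tu /asboolP uv; apply/asboolP; apply: Ctrans tu uv.
Qed.

Canonical congr_equiv := EquivRelPack congr_bool_equiv.

Definition presented : Type := {eq_quot congr_equiv}.
HB.instance Definition _ := Choice.on presented.
HB.instance Definition _ := Quotient.on presented.

Definition cls (t : term R X) : presented := \pi_presented t.

Lemma clsP t u : congr_rel t u <-> cls t = cls u.
Proof.
split=> [tu|/eqP]; first by apply/eqP; rewrite /cls eqmodE; apply/asboolP.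
by rewrite /cls eqmodE => /asboolP.
Qed.

Lemma clsK (x : presented) : cls (repr x) = x. Proof. exact: reprK. Qed.

Lemma repr_cls t : congr_rel (repr (cls t)) t.
Proof. by apply/clsP; rewrite clsK. Qed.

Definition presented_add (x y : presented) := cls (repr x + repr y).
Definition presented_mul (x y : presented) := cls (repr x * repr y).
Definition presented_opp (x : presented) := cls (Cst (-1)%R * repr x).

Lemma cls_addE t u : presented_add (cls t) (cls u) = cls (t + u).
Proof. by apply/clsP; apply: CaddE; apply: repr_cls. Qed.

Lemma cls_mulE t u : presented_mul (cls t) (cls u) = cls (t * u).
Proof. by apply/clsP; apply: CmulE; apply: repr_cls. Qed.

Let addA : associative presented_add.
Proof.
move=> x y z; rewrite -(clsK x) -(clsK y) -(clsK z) !cls_addE.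
by apply/clsP; apply: CaddA.
Qed.

Let addC : commutative presented_add.
Proof.
move=> x y; rewrite -(clsK x) -(clsK y) !cls_addE.
by apply/clsP; apply: CaddC.
Qed.

Let add0 : left_id (cls (Cst 0)) presented_add.
Proof. by move=> x; rewrite -(clsK x) cls_addE; apply/clsP; apply: Cadd0. Qed.

Let mulA : associative presented_mul.
Proof.
move=> x y z; rewrite -(clsK x) -(clsK y) -(clsK z) !cls_mulE.
by apply/clsP; apply: CmulA.
Qed.

Let mul1 : left_id (cls (Cst 1)) presented_mul.
Proof. by move=> x; rewrite -(clsK x) cls_mulE; apply/clsP; apply: Cmul1. Qed.

Let mul1' : right_id (cls (Cst 1)) presented_mul.
Proof.
move=> x; rewrite -(clsK x) cls_mulE; apply/clsP.
exact: Ctrans (Csym (CcstC _ _)) (Cmul1 _).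
Qed.

Let mulDl : left_distributive presented_mul presented_add.
Proof.
move=> x y z; rewrite -(clsK x) -(clsK y) -(clsK z).
by rewrite !(cls_addE, cls_mulE); apply/clsP; apply: CmulDl.
Qed.

Let mulDr : right_distributive presented_mul presented_add.
Proof.
move=> x y z; rewrite -(clsK x) -(clsK y) -(clsK z).
by rewrite !(cls_addE, cls_mulE); apply/clsP; apply: CmulDr.
Qed.

Let addN : left_inverse (cls (Cst 0)) presented_opp presented_add.
Proof.
move=> x; rewrite /presented_opp -[X in presented_add _ X](clsK x).
rewrite cls_addE; apply/clsP.
apply: Ctrans (Cmul0 (repr x)).
apply: Ctrans (CaddE (Crefl _) (Csym (Cmul1 _))) _.
apply: Ctrans (Csym (CmulDl _ _ _)) _; apply: CmulE; last exact: Crefl.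
by apply: Ctrans (Csym (CcstD _ _)) _; rewrite addNr; apply: Crefl.
Qed.

HB.instance Definition _ := GRing.isPzRing.Build presented
  addA addC add0 addN mulA mul1 mul1' mulDl mulDr.

Lemma clsD t u : cls (t + u)%pres = cls t + cls u.
Proof. by rewrite -cls_addE. Qed.

Lemma clsM t u : cls (t * u)%pres = cls t * cls u.
Proof. by rewrite -cls_mulE. Qed.

Let scal_zmod : zmod_morphism (fun r => cls (Cst r)).
Proof.
move=> r s; apply/eqP; rewrite eq_sym subr_eq -clsD.
by apply/eqP/clsP; apply: Ctrans (CcstD _ _); rewrite subrK; apply: Crefl.
Qed.

Let scal_monoid : monoid_morphism (fun r => cls (Cst r)).
Proof. by split=> // r s; rewrite -clsM; apply/clsP; apply: CcstM. Qed.

Let scal_central r x : cls (Cst r) * x = x * cls (Cst r).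
Proof. by rewrite -(clsK x) -!clsM; apply/clsP; apply: CcstC. Qed.

HB.instance Definition _ :=
  isRAlgebra.Build R presented scal_zmod scal_monoid scal_central.

Definition gen (x : X) : presented := cls (Gen x).

Lemma clsC r : cls (Cst r) = scal r. Proof. by []. Qed.

Lemma presented_ind (P : presented -> Prop) :
  (forall x, P (gen x)) -> (forall r, P (scal r)) ->
  (forall x y, P x -> P y -> P (x + y)) ->
  (forall x y, P x -> P y -> P (x * y)) -> forall x, P x.
Proof.
move=> Pg Ps PD PM x; rewrite -(clsK x).
elim: (repr x) => {x} [x|r|t Pt u Pu|t Pt u Pu].
- exact: Pg.
- exact: Ps.
- by rewrite clsD; apply: PD.
by rewrite clsM; apply: PM.
Qed.

Section Lift.
Variables (A : ralgType R) (v : X -> A).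

Fixpoint eval (t : term R X) : A :=
  match t with
  | Gen x => v x
  | Cst r => scal r
  | Add t u => eval t + eval u
  | Mul t u => eval t * eval u
  end.

Hypothesis vP : forall t u, rel t u -> eval t = eval u.

Lemma eval_congr t u : congr_rel t u -> eval t = eval u.
Proof.
elim=> {t u} /=.
- exact: vP.
- by [].
- by move=> t u _ ->.
- by move=> t u w _ -> _ ->.
- by move=> t t' u u' _ -> _ ->.
- by move=> t t' u u' _ -> _ ->.
- by move=> t u w; rewrite addrA.
- by move=> t u; rewrite addrC.
- by move=> t; rewrite rmorph0 add0r.
- by move=> t; rewrite rmorph0 mul0r.
- by move=> t u w; rewrite mulrA.
- by move=> t; rewrite rmorph1 mul1r.
- by move=> t u w; rewrite mulrDl.
- by move=> t u w; rewrite mulrDr.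
- by move=> r s; rewrite rmorphD.
- by move=> r s; rewrite rmorphM.
by move=> r t; rewrite scalC.
Qed.

Definition lift_fun (x : presented) : A := eval (repr x).

Lemma lift_cls t : lift_fun (cls t) = eval t.
Proof. exact/eval_congr/repr_cls. Qed.

Lemma lift_zmod : zmod_morphism lift_fun.
Proof.
move=> x y; apply/eqP; rewrite eq_sym subr_eq.
rewrite -[in X in _ == lift_fun X + _](clsK x) -{1}(clsK x) -(clsK y).
apply/eqP; set t := repr x; set u := repr y.
rewrite [lift_fun (cls u)]lift_cls.
have -> : cls t - cls u = cls (t + Cst (-1)%R * u)%pres.
  by rewrite clsD clsM clsC rmorphN rmorph1 mulN1r.
by rewrite !lift_cls /= rmorphN rmorph1 mulN1r subrK.
Qed.

Lemma lift_monoid : monoid_morphism lift_fun.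
Proof.
split=> [|x y]; first by rewrite -[1]/(cls (Cst 1)) lift_cls /= rmorph1.
by rewrite -(clsK x) -(clsK y) -clsM !lift_cls.
Qed.

HB.instance Definition _ :=
  GRing.isZmodMorphism.Build presented A lift_fun lift_zmod.
HB.instance Definition _ :=
  GRing.isMonoidMorphism.Build presented A lift_fun lift_monoid.

Definition lift : {rmorphism presented -> A} := lift_fun.

Lemma lift_gen x : lift (gen x) = v x. Proof. exact: lift_cls. Qed.
Lemma lift_scal r : lift (scal r) = scal r. Proof. exact: lift_cls. Qed.

End Lift.

End Presented.

(* Grading of a presented algebra for which the generators in g b are given
   degree b. The parity automorphism, given on generators by v, shows that the
   two homogeneous parts meet trivially. *)
Section PresentedGrading.
Variables (R : realType) (X : Type) (rel : term R X -> term R X -> Prop).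
Local Notation P := (presented rel).
Variables (g : bool -> X -> Prop) (v : X -> P).

Definition presented_homog : bool -> P -> Prop :=
  generated_degree (fun b y => exists2 x, g b x & y = gen rel x).

Hypothesis vP : forall t u, rel t u -> eval v t = eval v u.
Hypothesis vE : forall b x, g b x -> v x = (-1) ^+ b * gen rel x.
Hypothesis genE : forall x, exists x0 x1,
  [/\ presented_homog false x0, presented_homog true x1 & gen rel x = x0 + x1].

Lemma presented_homog_cap x :
  presented_homog false x -> presented_homog true x -> x = 0.
Proof.
apply: (@generated_degree_cap R P _ (lift vP)); first exact: lift_scal.
by move=> b _ [y gy ->]; rewrite lift_gen (vE gy).
Qed.

Let homogD b x y :
  presented_homog b x -> presented_homog b y -> presented_homog b (x + y).
Proof. by move=> hx hy; rewrite -[x]mul1r -(scal1 P); apply: Gdeg_lin. Qed.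

Lemma presented_homog_sum x : exists x0 x1,
  [/\ presented_homog false x0, presented_homog true x1 & x = x0 + x1].
Proof.
elim/presented_ind: x => [//|r|x y|x y].
- exists (scal r), 0; split; last by rewrite addr0.
    rewrite -[scal r]addr0 -[scal r]mulr1; apply: Gdeg_lin; last exact: Gdeg_0.
    exact: Gdeg_1.
  exact: Gdeg_0.
- move=> [x0 [x1 [hx0 hx1 ->]]] [y0 [y1 [hy0 hy1 ->]]].
  exists (x0 + y0), (x1 + y1).
  by split; [exact: homogD|exact: homogD|rewrite addrACA].
move=> [x0 [x1 [hx0 hx1 ->]]] [y0 [y1 [hy0 hy1 ->]]].
exists (x0 * y0 + x1 * y1), (x0 * y1 + x1 * y0); split.
- by apply: homogD; [exact: (Gdeg_mul hx0 hy0)|exact: (Gdeg_mul hx1 hy1)].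
- by apply: homogD; [exact: (Gdeg_mul hx0 hy1)|exact: (Gdeg_mul hx1 hy0)].
by rewrite mulrDl !mulrDr [x1 * y0 + _]addrC addrACA.
Qed.

Definition presented_super : isSuperAlgebra R P :=
  @isSuperAlgebra.Build R P presented_homog
    (fun b => Gdeg_0 _ b) (fun b r x y => @Gdeg_lin _ _ _ b r x y) (Gdeg_1 _)
    (fun b c x y => @Gdeg_mul _ _ _ b c x y)
    presented_homog_sum presented_homog_cap.

End PresentedGrading.

Lemma gen_rel (R : comPzRingType) X (rel : term R X -> term R X -> Prop) t u :
  rel t u -> eval (gen rel) t = eval (gen rel) u.
Proof.
have E w : eval (gen rel) w = cls rel w.
  elim: w => //= [w -> w' ->|w -> w' ->]; first by rewrite clsD.
  by rewrite clsM.
by move=> tu; rewrite !E; apply/clsP; apply: Crel.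
Qed.

(* Cl^{p,q}: inl indexes the e_i (square -1), inr the e~_j (square +1). *)
Section Clifford.
Variables (R : realType) (p q : nat).
Local Notation X := ('I_p + 'I_q)%type.

Inductive clifford_rel : term R X -> term R X -> Prop :=
| clifford_neg i : clifford_rel (Gen (inl i) * Gen (inl i)) (Cst (-1))
| clifford_pos j : clifford_rel (Gen (inr j) * Gen (inr j)) (Cst 1)
| clifford_anti x y : x != y ->
    clifford_rel (Gen x * Gen y) (Cst (-1) * (Gen y * Gen x)).

Definition clifford : Type := presented clifford_rel.
HB.instance Definition _ := RAlgebra.on clifford.

Definition clifford_homog : bool -> clifford -> Prop :=
  presented_homog (rel := clifford_rel) (fun b _ => b = true).

Let v (x : X) : presented clifford_rel := - gen clifford_rel x.

Let vP t u : clifford_rel t u -> eval v t = eval v u.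
Proof.
move=> tu; have := gen_rel tu; case: tu => [i|j|x y _] /=; rewrite /v.
- by rewrite mulrNN.
- by rewrite mulrNN.
by rewrite !mulrNN.
Qed.

Let vE b x : b = true -> v x = (-1) ^+ b * gen clifford_rel x.
Proof. by move=> ->; rewrite expr1 mulN1r. Qed.

Let genE x : exists x0 x1,
  [/\ clifford_homog false x0, clifford_homog true x1 &
      gen clifford_rel x = x0 + x1].
Proof.
exists 0, (gen clifford_rel x); split; last by rewrite add0r.
  exact: Gdeg_0.
by apply: Gdeg_gen; exists x.
Qed.

HB.instance Definition _ : isSuperAlgebra R clifford :=
  presented_super vP vE genE.

Definition clifford_gen (x : X) : clifford := gen clifford_rel x.
End Clifford.

(* The super tensor product over R: generated by copies a (x) 1 and 1 (x) b of A
   and B, subject to the sign rule for homogeneous elements. *)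
Section SuperTensor.
Variables (R : realType) (A B : superAlgType R).
Local Notation X := (A + B)%type.
Local Notation gl x := (Gen (inl x)).
Local Notation gr y := (Gen (inr y)).

Inductive super_tensor_rel : term R X -> term R X -> Prop :=
| st_scall r : super_tensor_rel (gl (scal r)) (Cst r)
| st_addl x y : super_tensor_rel (gl (x + y)%R) (gl x + gl y)
| st_mull x y : super_tensor_rel (gl (x * y)%R) (gl x * gl y)
| st_scalr r : super_tensor_rel (gr (scal r)) (Cst r)
| st_addr x y : super_tensor_rel (gr (x + y)%R) (gr x + gr y)
| st_mulr x y : super_tensor_rel (gr (x * y)%R) (gr x * gr y)
| st_comm b c x y : homog b x -> homog c y ->
    super_tensor_rel (gr y * gl x) (Cst ((-1) ^+ (b && c)) * (gl x * gr y)).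

Definition super_tensor : Type := presented super_tensor_rel.
HB.instance Definition _ := RAlgebra.on super_tensor.

Local Notation g := (gen super_tensor_rel).

Definition super_tensor_deg (b : bool) (x : X) : Prop :=
  match x with inl x => homog b x | inr y => homog b y end.

Definition super_tensor_homog : bool -> super_tensor -> Prop :=
  presented_homog (rel := super_tensor_rel) super_tensor_deg.

Let genlD x y : g (inl (x + y)) = g (inl x) + g (inl y).
Proof. exact: (gen_rel (st_addl x y)). Qed.
Let genlM x y : g (inl (x * y)) = g (inl x) * g (inl y).
Proof. exact: (gen_rel (st_mull x y)). Qed.
Let genls r : g (inl (scal r)) = scal r.
Proof. exact: (gen_rel (st_scall r)). Qed.
Let genrD x y : g (inr (x + y)) = g (inr x) + g (inr y).
Proof. exact: (gen_rel (st_addr x y)). Qed.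
Let genrM x y : g (inr (x * y)) = g (inr x) * g (inr y).
Proof. exact: (gen_rel (st_mulr x y)). Qed.
Let genrs r : g (inr (scal r)) = scal r.
Proof. exact: (gen_rel (st_scalr r)). Qed.

Let v (x : X) : presented super_tensor_rel :=
  match x with inl x => g (inl (parity x)) | inr y => g (inr (parity y)) end.

Let vE b x : super_tensor_deg b x -> v x = (-1) ^+ b * g x.
Proof.
have scN : scal (-1) = -1 :> presented super_tensor_rel by rewrite scalN scal1.
have nl x' : g (inl (- x')) = - g (inl x').
  by rewrite -mulN1r -[in LHS](scal1 A) -scalN genlM genls scN mulN1r.
have nr x' : g (inr (- x')) = - g (inr x').
  by rewrite -mulN1r -[in LHS](scal1 B) -scalN genrM genrs scN mulN1r.
case: x => x /=; case: b => hx; rewrite ?expr0 ?expr1 ?mul1r ?mulN1r.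
- by rewrite parity1 // nl.
- by rewrite parity0.
- by rewrite parity1 // nr.
by rewrite parity0.
Qed.

Let vP t u : super_tensor_rel t u -> eval v t = eval v u.
Proof.
case=> [r|x y|x y|r|x y|x y|b c x y hx hy] /=.
- by rewrite parity_scal genls.
- by rewrite rmorphD genlD.
- by rewrite rmorphM genlM.
- by rewrite parity_scal genrs.
- by rewrite rmorphD genrD.
- by rewrite rmorphM genrM.
rewrite -/(v (inl x)) -/(v (inr y)) (vE (x := inl x) hx) (vE (x := inr y) hy).
have := gen_rel (st_comm hx hy); rewrite /=.
case: b {hx}; case: c {hy} => /= e; rewrite ?expr0 ?expr1 ?mulN1r ?mul1r;
  rewrite ?mulrNN ?mulNr ?mulrN ?e //;
  by rewrite ?expr0 ?scal1 ?mul1r ?mulrNN.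
Qed.

Let genE x : exists x0 x1,
  [/\ super_tensor_homog false x0, super_tensor_homog true x1 & g x = x0 + x1].
Proof.
case: x => x; have [x0 [x1 [h0 h1 ->]]] := homog_sum x.
  exists (g (inl x0)), (g (inl x1)); split; last exact: genlD.
    by apply: Gdeg_gen; exists (inl x0).
  by apply: Gdeg_gen; exists (inl x1).
exists (g (inr x0)), (g (inr x1)); split; last exact: genrD.
  by apply: Gdeg_gen; exists (inr x0).
by apply: Gdeg_gen; exists (inr x1).
Qed.

HB.instance Definition _ : isSuperAlgebra R super_tensor :=
  presented_super vP vE genE.

Definition tensl (x : A) : super_tensor := g (inl x).
Definition tensr (y : B) : super_tensor := g (inr y).

Lemma tensl_zmod : zmod_morphism tensl.
Proof.
by move=> x y; apply/eqP; rewrite eq_sym subr_eq /tensl -genlD subrK.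
Qed.
Lemma tensl_monoid : monoid_morphism tensl.
Proof.
by split=> [|x y]; rewrite /tensl ?genlM // -[in LHS](scal1 A) genls scal1.
Qed.
Lemma tensr_zmod : zmod_morphism tensr.
Proof.
by move=> x y; apply/eqP; rewrite eq_sym subr_eq /tensr -genrD subrK.
Qed.
Lemma tensr_monoid : monoid_morphism tensr.
Proof.
by split=> [|x y]; rewrite /tensr ?genrM // -[in LHS](scal1 B) genrs scal1.
Qed.
HB.instance Definition _ :=
  GRing.isZmodMorphism.Build A super_tensor tensl tensl_zmod.
HB.instance Definition _ :=
  GRing.isMonoidMorphism.Build A super_tensor tensl tensl_monoid.
HB.instance Definition _ :=
  GRing.isZmodMorphism.Build B super_tensor tensr tensr_zmod.
HB.instance Definition _ :=
  GRing.isMonoidMorphism.Build B super_tensor tensr tensr_monoid.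

Lemma tensl_scal r : tensl (scal r) = scal r. Proof. exact: genls. Qed.
Lemma tensr_scal r : tensr (scal r) = scal r. Proof. exact: genrs. Qed.
Lemma tens_comm b c x y : homog b x -> homog c y ->
  tensr y * tensl x = scal ((-1) ^+ (b && c)) * (tensl x * tensr y).
Proof. by move=> hx hy; apply: (gen_rel (st_comm hx hy)). Qed.

End SuperTensor.

Section Symmetry.
Variables (R : realType) (G : finGroupType).
Local Notation C := R[i].

Definition conj_if (b : bool) (z : C) : C := if b then conjc z else z.

(* Homomorphisms s, h : G -> Z_2 and a normalized U(1)-valued 2-cocycle, with
   coefficients twisted by s. *)
Record symmetry := Symmetry {
  sgn : G -> bool;
  sgnM : {morph sgn : g k / (g * k)%g >-> g (+) k};
  hdeg : G -> bool;
  hdegM : {morph hdeg : g k / (g * k)%g >-> g (+) k};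
  omega : G -> G -> C;
  omega_norm : forall g k, `|omega g k| = 1;
  omega_cocycle : forall g k l,
    conj_if (sgn g) (omega k l) * omega g (k * l)%g =
    omega g k * omega (g * k)%g l;
  omega1g : forall g, omega 1%g g = 1;
  omegag1 : forall g, omega g 1%g = 1
}.

Lemma conj_if_zmod b : zmod_morphism (conj_if b).
Proof. by case: b => x y //; apply: rmorphB. Qed.
Lemma conj_if_monoid b : monoid_morphism (conj_if b).
Proof. by case: b; split=> // [|x y]; [apply: rmorph1|apply: rmorphM]. Qed.
HB.instance Definition _ b :=
  GRing.isZmodMorphism.Build C C (conj_if b) (conj_if_zmod b).
HB.instance Definition _ b :=
  GRing.isMonoidMorphism.Build C C (conj_if b) (conj_if_monoid b).

Lemma conj_ifD b c z : conj_if b (conj_if c z) = conj_if (b (+) c) z.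
Proof. by case: b; case: c => //; exact: conjcK. Qed.

Lemma conj_if_real b (r : R) : conj_if b r%:C%C = r%:C%C.
Proof. by case: b => //; exact: conjc_real. Qed.

(* C[G, omega, s]: a function a : G -> C stands for \sum_g a(g) g. *)
Definition twisted_alg of symmetry : Type := {ffun G -> C}.
HB.instance Definition _ S := GRing.Zmodule.on (twisted_alg S).

Variable S : symmetry.
Local Notation A := (twisted_alg S).
Local Notation s := (sgn S).
Local Notation h := (hdeg S).
Local Notation w := (omega S).

Lemma sgn1 : s 1%g = false.
Proof. by have := sgnM S 1%g 1%g; rewrite mul1g; case: (s 1%g). Qed.
Lemma hdeg1 : h 1%g = false.
Proof. by have := hdegM S 1%g 1%g; rewrite mul1g; case: (h 1%g). Qed.
Lemma hdegV g : h g^-1%g = h g.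
Proof.
have := hdegM S g g^-1%g; rewrite mulgV hdeg1.
by case: (h g); case: (h _).
Qed.

Definition tw_cst (z : C) : A :=
  [ffun g => if g == 1%g then z else 0].
Definition tw_basis (k : G) : A := [ffun g => (g == k)%:R].

(* The bilinear extension of (z g) (z' k) = z ^g z' omega(g, k) gk. *)
Definition tw_mul (a b : A) : A :=
  [ffun l => \sum_g a g * conj_if (s g) (b (g^-1 * l)%g) * w g (g^-1 * l)%g].


Let mulA : associative tw_mul.
Proof.
move=> a b c; apply/ffunP => l; rewrite !ffunE.
under [RHS]eq_bigr => u _ do rewrite ffunE !mulr_suml.
rewrite exchange_big /=; apply: eq_bigr => g _.
rewrite ffunE rmorph_sum mulr_sumr mulr_suml.
rewrite [RHS](reindex_inj (mulgI g)); apply: eq_bigr => k _ /=.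
rewrite mulKg !rmorphM /=. rewrite conj_ifD -sgnM invMg mulgA -!mulgA.
have -> : (g^-1 * l = k * (k^-1 * (g^-1 * l)))%g by rewrite mulKVg.
set m := (k^-1 * _)%g; rewrite mulKg !mulrA.
have := omega_cocycle S g k m => e.
rewrite -!mulrA; congr (_ * (_ * _)); rewrite e.
by rewrite mulrCA.
Qed.

Let mul1 : left_id (tw_cst 1) tw_mul.
Proof.
move=> a; apply/ffunP => l; rewrite ffunE (bigD1 1%g) //= ffunE eqxx sgn1.
rewrite invg1 mul1g omega1g mul1r mulr1 big1 ?addr0 // => g gn1.
by rewrite ffunE (negbTE gn1) !mul0r.
Qed.

Let mulr1' : right_id (tw_cst 1) tw_mul.
Proof.
move=> a; apply/ffunP => l; rewrite ffunE (bigD1 l) //= ffunE mulVg eqxx.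
rewrite rmorph1 omegag1 !mulr1 big1 ?addr0 // => g gl.
rewrite ffunE ifF ?rmorph0 ?mulr0 ?mul0r //.
by apply: contraNF gl => /eqP e; rewrite -[l](mulKVg g) e mulg1.
Qed.

Let mulDl : left_distributive tw_mul +%R.
Proof.
move=> a b c; apply/ffunP => l; rewrite !ffunE -big_split /=.
by apply: eq_bigr => g _; rewrite ffunE !mulrDl.
Qed.

Let mulDr : right_distributive tw_mul +%R.
Proof.
move=> a b c; apply/ffunP => l; rewrite !ffunE -big_split /=.
by apply: eq_bigr => g _; rewrite ffunE rmorphD mulrDr mulrDl.
Qed.

HB.instance Definition _ := GRing.Zmodule_isPzRing.Build A
  mulA mul1 mulr1' mulDl mulDr.

Lemma tw_mulE (a b : A) l : (a * b) l =
  \sum_g a g * conj_if (s g) (b (g^-1 * l)%g) * w g (g^-1 * l)%g.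
Proof. by rewrite [a * b]/(tw_mul a b) ffunE. Qed.

Lemma tw_cstl z (a : A) l : (tw_cst z * a) l = z * a l.
Proof.
rewrite tw_mulE (bigD1 1%g) //= ffunE eqxx sgn1.
rewrite invg1 mul1g omega1g mulr1 big1 ?addr0 // => g gn1.
by rewrite ffunE (negbTE gn1) !mul0r.
Qed.

Lemma tw_cstr z (a : A) l : (a * tw_cst z) l = a l * conj_if (s l) z.
Proof.
rewrite tw_mulE (bigD1 l) //= ffunE mulVg eqxx.
rewrite omegag1 !mulr1 big1 ?addr0 // => g gl.
rewrite ffunE ifF ?rmorph0 ?mulr0 ?mul0r //.
by apply: contraNF gl => /eqP e; rewrite -[l](mulKVg g) e mulg1.
Qed.

Lemma tw_cst_zmod : zmod_morphism tw_cst.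
Proof.
by move=> x y; apply/ffunP => g; rewrite !ffunE; case: ifP; rewrite ?subrr.
Qed.

Lemma tw_cst_monoid : monoid_morphism tw_cst.
Proof.
split=> // x y; apply/ffunP => g; rewrite tw_cstl !ffunE.
by case: ifP; rewrite ?mulr0.
Qed.

HB.instance Definition _ :=
  GRing.isZmodMorphism.Build C A tw_cst tw_cst_zmod.
HB.instance Definition _ :=
  GRing.isMonoidMorphism.Build C A tw_cst tw_cst_monoid.

Let tw_scal (r : R) : A := tw_cst r%:C%C.

Let tw_scal_zmod : zmod_morphism tw_scal.
Proof. by move=> x y; rewrite /tw_scal !rmorphB. Qed.
Let tw_scal_monoid : monoid_morphism tw_scal.
Proof. by split=> [|x y]; rewrite /tw_scal ?rmorph1 ?rmorphM. Qed.
Let tw_scalC r (a : A) : tw_scal r * a = a * tw_scal r.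
Proof. by apply/ffunP => l; rewrite tw_cstl tw_cstr conj_if_real mulrC. Qed.

HB.instance Definition _ :=
  isRAlgebra.Build R A tw_scal_zmod tw_scal_monoid tw_scalC.

Lemma tw_scalE r : scal r = tw_cst r%:C%C. Proof. by []. Qed.

Definition tw_homog (b : bool) (a : A) : Prop :=
  forall g, a g != 0 -> h g = b.

Let homogE b a : tw_homog b a <-> forall g, h g != b -> a g = 0.
Proof.
split=> H g; first by apply: contraNeq => /H ->.
by apply: contraNeq => /H ->.
Qed.

Let tw_homog0 b : tw_homog b 0.
Proof. by apply/homogE => g _; rewrite ffunE. Qed.

Let tw_homogP b (r : R) (x y : A) :
  tw_homog b x -> tw_homog b y -> tw_homog b (scal r * x + y).
Proof.
move=> /homogE hx /homogE hy; apply/homogE => g gb.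
by rewrite ffunE tw_cstl hx // hy // mulr0 addr0.
Qed.

Let tw_homog_cst z : tw_homog false (tw_cst z).
Proof.
by move=> g; rewrite ffunE; case: (g =P 1%g) => [->|]; rewrite ?hdeg1 ?eqxx.
Qed.

Let tw_homogM b c (x y : A) :
  tw_homog b x -> tw_homog c y -> tw_homog (b (+) c) (x * y).
Proof.
move=> hx hy l; rewrite tw_mulE => /negP; apply: contra_notP => lbc.
apply/eqP; apply: big1 => g _; apply/eqP/negPn/negP.
rewrite !mulf_eq0 !negb_or -andbA => /and3P[/hx hg] + _.
have [->|/hy hl _] := eqVneq (y (g^-1 * l)%g) 0; first by rewrite rmorph0 eqxx.
by apply: lbc; rewrite -(mulKVg g l) hdegM hg hl.
Qed.

Let tw_homog_sum (x : A) : exists x0 x1,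
  [/\ tw_homog false x0, tw_homog true x1 & x = x0 + x1].
Proof.
exists [ffun g => if h g then 0 else x g], [ffun g => if h g then x g else 0].
split; last first.
    by apply/ffunP => g; rewrite !ffunE; case: (h g); rewrite ?add0r ?addr0.
  by move=> g; rewrite ffunE; case: (h g); rewrite ?eqxx.
by move=> g; rewrite ffunE; case: (h g); rewrite ?eqxx.
Qed.

Let tw_homog_cap (x : A) : tw_homog false x -> tw_homog true x -> x = 0.
Proof.
move=> h0 h1; apply/ffunP => g; rewrite ffunE; apply/eqP/negPn/negP => xg.
by have := h0 g xg; rewrite h1.
Qed.

HB.instance Definition _ := isSuperAlgebra.Build R A
  tw_homog0 tw_homogP (@tw_homog_cst 1) tw_homogM tw_homog_sum tw_homog_cap.

Lemma homog_cst z : homog false (tw_cst z). Proof. exact: tw_homog_cst. Qed.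

Lemma homog_basis g : homog (h g) (tw_basis g).
Proof.
by move=> k; rewrite ffunE; case: (k =P g) => [->//|]; rewrite eqxx.
Qed.

Lemma tw_basis_mull k (b : A) l :
  (tw_basis k * b) l = conj_if (s k) (b (k^-1 * l)%g) * w k (k^-1 * l)%g.
Proof.
rewrite tw_mulE (bigD1 k) //= ffunE eqxx mul1r big1 ?addr0 // => g gk.
by rewrite ffunE (negbTE gk) !mul0r.
Qed.

Lemma tw_basisM g k :
  tw_basis g * tw_basis k = tw_cst (w g k) * tw_basis (g * k)%g.
Proof.
apply/ffunP => l; rewrite tw_basis_mull tw_cstl !ffunE.
have -> : (g^-1 * l == k)%g = (l == g * k)%g.
  by rewrite -(inj_eq (mulgI g)) mulKVg.
case: eqP => [->|_]; last by rewrite rmorph0 mul0r mulr0.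
by rewrite rmorph1 mul1r mulr1 mulKg.
Qed.

Lemma tw_basisC g z :
  tw_basis g * tw_cst z = tw_cst (conj_if (s g) z) * tw_basis g.
Proof.
apply/ffunP => l; rewrite tw_cstl tw_cstr !ffunE.
by case: eqP => [->|_]; rewrite ?mul1r ?mulr1 ?mul0r ?mulr0.
Qed.

(* The inverse of the basis element g in the algebra. *)
Definition tw_inv (g : G) : A :=
  tw_cst (w g^-1%g g)^-1 * tw_basis g^-1%g.

Lemma tw_basis1 : tw_basis 1%g = 1.
Proof. by apply/ffunP => l; rewrite !ffunE; case: eqP. Qed.

Let omega_neq0 g k : w g k != 0.
Proof. by rewrite -normr_eq0 omega_norm oner_eq0. Qed.

Lemma tw_mulV g : tw_inv g * tw_basis g = 1.
Proof.
rewrite -mulrA tw_basisM mulVg mulrA -rmorphM mulVf ?omega_neq0 //.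
by rewrite rmorph1 mul1r tw_basis1.
Qed.

Lemma tw_mulVr g : tw_basis g * tw_inv g = 1.
Proof.
rewrite mulrA tw_basisC -mulrA tw_basisM mulgV tw_basis1 mulr1 -rmorphM fmorphV.
have := omega_cocycle S g g^-1%g g.
rewrite mulgV mulVg omega1g omegag1 !mulr1 => e; rewrite /= e.
by rewrite mulVf ?omega_neq0 // rmorph1.
Qed.

Lemma homog_inv g : homog (h g) (tw_inv g).
Proof.
have := homogM _ _ _ _ (@homog_cst (w g^-1%g g)^-1) (@homog_basis g^-1%g).
by rewrite hdegV.
Qed.

Lemma tw_invC g z :
  tw_inv g * tw_cst (conj_if (s g) z) = tw_cst z * tw_inv g.
Proof.
rewrite -[LHS]mulr1 -(tw_mulVr g) mulrA -[X in X * tw_inv g]mulrA -tw_basisC.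
by rewrite mulrA tw_mulV mul1r.
Qed.

End Symmetry.

(* Orthogonal real representations on R^q, in the standard orthonormal basis:
   rho g (e_i) = \sum_j (rho g) j i e_j. *)
Record orth_rep (R : realType) (G : finGroupType) (q : nat) := OrthRep {
  orep :> mx_representation R [set: G] q;
  orep_orth : forall g, orep g *m (orep g)^T = 1%:M
}.

Section OrthRep.
Variables (R : realType) (G : finGroupType) (S : symmetry R G).

Lemma orep_trV q (W : orth_rep R G q) g : (W g)^T *m W g = 1%:M.
Proof. exact/mulmx1C/orep_orth. Qed.

Lemma orep0_repr : mx_repr [set: G] (fun _ => 1%:M : 'M[R]_0).
Proof. by split=> // g k _ _; rewrite mulmx1. Qed.
Lemma orep0_orth g : MxRepresentation orep0_repr g *m
  (MxRepresentation orep0_repr g)^T = 1%:M.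
Proof. by rewrite /= trmx1 mulmx1. Qed.
Definition zero_rep : orth_rep R G 0 := OrthRep orep0_orth.

Section Twist.
Variables (d : nat) (V : orth_rep R G d).
Lemma twist_repr : mx_repr [set: G] (fun g => (-1) ^+ sgn S g *: V g).
Proof.
split=> [|g k _ _]; first by rewrite sgn1 expr0 scale1r repr_mx1.
by rewrite -scalemxAl -scalemxAr scalerA sgnM signr_addb repr_mxM ?inE.
Qed.
Lemma twist_orth g : MxRepresentation twist_repr g *m
  (MxRepresentation twist_repr g)^T = 1%:M.
Proof.
rewrite /= linearZ /= -scalemxAl -scalemxAr scalerA -signr_addb addbb scale1r.
exact: orep_orth.
Qed.
Definition twist_rep : orth_rep R G d := OrthRep twist_orth.
End Twist.

Section DirectSum.
Variables (d e : nat) (V : orth_rep R G d) (W : orth_rep R G e).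
Lemma sum_repr : mx_repr [set: G] (fun g => block_mx (V g) 0 0 (W g)).
Proof.
split=> [|g k _ _]; first by rewrite !repr_mx1 -scalar_mx_block.
by rewrite !repr_mxM ?inE // mulmx_block !mulmx0 !mul0mx !addr0 !add0r.
Qed.
Lemma sum_orth g : MxRepresentation sum_repr g *m
  (MxRepresentation sum_repr g)^T = 1%:M.
Proof.
rewrite /= tr_block_mx !trmx0 mulmx_block !mulmx0 !mul0mx !addr0 !add0r.
by rewrite !orep_orth -scalar_mx_block.
Qed.
Definition sum_rep : orth_rep R G (d + e) := OrthRep sum_orth.
End DirectSum.

End OrthRep.

(* The algebra A^W for A = C[G, omega, s]: the first three relations make
   inl : A -> A^W a homomorphism of real algebras. *)
Section ExtendedAlgebra.
Variables (R : realType) (G : finGroupType) (S : symmetry R G).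
Variables (q : nat) (W : orth_rep R G q).
Local Notation A := (twisted_alg S).
Local Notation X := (A + 'I_q)%type.
Local Notation ga a := (Gen (inl a)).
Local Notation ge i := (Gen (inr i)).

Inductive ext_rel : term R X -> term R X -> Prop :=
| ext_scal r : ext_rel (ga (scal r)) (Cst r)
| ext_add a b : ext_rel (ga (a + b)%R) (ga a + ga b)
| ext_mul a b : ext_rel (ga (a * b)%R) (ga a * ga b)
| ext_sqr i : ext_rel (ge i * ge i) (Cst 1)
| ext_anti i j : i != j -> ext_rel (ge i * ge j) (Cst (-1) * (ge j * ge i))
| ext_cst i z : ext_rel (ge i * ga (tw_cst S z)) (ga (tw_cst S z) * ge i)
| ext_act g i : ext_rel
    (Cst ((-1) ^+ hdeg S g) * (ga (tw_basis S g) * ge i * ga (tw_inv S g)))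
    (\big[Add/Cst 0]_j (Cst (W g j i) * ge j)%pres).

Definition ext_alg : Type := presented ext_rel.
HB.instance Definition _ := RAlgebra.on ext_alg.

Definition ext_deg (b : bool) (x : X) : Prop :=
  match x with inl a => homog b a | inr _ => b = true end.

Definition ext_homog : bool -> ext_alg -> Prop :=
  presented_homog (rel := ext_rel) ext_deg.

Local Notation g := (gen ext_rel).

Let gD a b : g (inl (a + b)) = g (inl a) + g (inl b).
Proof. exact: (gen_rel (ext_add a b)). Qed.
Let gM a b : g (inl (a * b)) = g (inl a) * g (inl b).
Proof. exact: (gen_rel (ext_mul a b)). Qed.
Let gs r : g (inl (scal r)) = scal r.
Proof. exact: (gen_rel (ext_scal r)). Qed.

Let gN a : g (inl (- a)) = - g (inl a).
Proof.
have -> : - a = scal (-1) * a by rewrite scalN scal1 mulN1r.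
by rewrite gM gs scalN scal1 mulN1r.
Qed.

Lemma eval_sum (B : ralgType R) (v : X -> B) (F : 'I_q -> term R X) :
  eval v (\big[Add/Cst 0]_j F j) = \sum_j eval v (F j).
Proof.
by apply: (big_morph (eval v)) => //=; apply: scal0.
Qed.

Let v (x : X) : presented ext_rel :=
  match x with inl a => g (inl (parity a)) | inr i => - g (inr i) end.

Let vE b x : ext_deg b x -> v x = (-1) ^+ b * g x.
Proof.
case: x => [a|i] /=; last by move=> ->; rewrite expr1 mulN1r.
case: b => hx; rewrite ?expr0 ?expr1 ?mul1r ?mulN1r.
  by rewrite parity1 // gN.
by rewrite parity0.
Qed.

Let vP t u : ext_rel t u -> eval v t = eval v u.
Proof.
case=> [r|a b|a b|i|i j ij|i z|k i].
- by rewrite /= parity_scal gs.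
- by rewrite /= rmorphD gD.
- by rewrite /= rmorphM gM.
- by rewrite /= mulrNN; apply: (gen_rel (ext_sqr i)).
- by rewrite /= !mulrNN; apply: (gen_rel (ext_anti ij)).
- rewrite /= parity0; last exact: homog_cst.
  by rewrite mulNr mulrN; congr (- _); apply: (gen_rel (ext_cst i z)).
have := gen_rel (ext_act k i); rewrite !eval_sum /=.
rewrite -/(v (inl (tw_basis S k))) -/(v (inl (tw_inv S k))).
rewrite (vE (b := hdeg S k) (x := inl (tw_basis S k))); last exact: homog_basis.
rewrite (vE (b := hdeg S k) (x := inl (tw_inv S k))); last exact: homog_inv.
move=> e; under eq_bigr => j _ do rewrite mulrN.
rewrite sumrN -e; case: (hdeg S k); rewrite ?expr0 ?expr1 ?mulN1r ?mul1r.
  by rewrite !(mulrN, mulNr) !opprK.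
by rewrite !(mulrN, mulNr).
Qed.

Let genE x : exists x0 x1,
  [/\ ext_homog false x0, ext_homog true x1 & g x = x0 + x1].
Proof.
case: x => [a|i].
  have [x0 [x1 [h0 h1 ->]]] := homog_sum a.
  exists (g (inl x0)), (g (inl x1)); split; last exact: gD.
    by apply: Gdeg_gen; exists (inl x0).
  by apply: Gdeg_gen; exists (inl x1).
exists 0, (g (inr i)); split; last by rewrite add0r.
  exact: Gdeg_0.
by apply: Gdeg_gen; exists (inr i).
Qed.

HB.instance Definition _ : isSuperAlgebra R ext_alg :=
  presented_super vP vE genE.

Definition ext_in (a : A) : ext_alg := g (inl a).
Definition ext_gen (i : 'I_q) : ext_alg := g (inr i).

Lemma ext_in_zmod : zmod_morphism ext_in.
Proof. by move=> x y; apply/eqP; rewrite eq_sym subr_eq /ext_in -gD subrK. Qed.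
Lemma ext_in_monoid : monoid_morphism ext_in.
Proof.
by split=> [|x y]; rewrite /ext_in ?gM // -[in LHS](scal1 A) gs scal1.
Qed.
HB.instance Definition _ :=
  GRing.isZmodMorphism.Build A ext_alg ext_in ext_in_zmod.
HB.instance Definition _ :=
  GRing.isMonoidMorphism.Build A ext_alg ext_in ext_in_monoid.

Lemma ext_in_scal r : ext_in (scal r) = scal r. Proof. exact: gs. Qed.

Lemma ext_in_homog b a : homog b a -> homog b (ext_in a).
Proof. by move=> ha; apply: Gdeg_gen; exists (inl a). Qed.

Lemma ext_gen_homog i : homog true (ext_gen i).
Proof. by apply: Gdeg_gen; exists (inr i). Qed.

Lemma ext_actE k i :
  scal ((-1) ^+ hdeg S k) *
    (ext_in (tw_basis S k) * ext_gen i * ext_in (tw_inv S k)) =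
  \sum_j scal (W k j i) * ext_gen j.
Proof. by have := gen_rel (ext_act k i); rewrite eval_sum. Qed.

(* Conjugation by the inverse of g acts on the e_i by the transpose. *)
Lemma ext_actV k i : ext_in (tw_inv S k) * ext_gen i =
  scal ((-1) ^+ hdeg S k) * (\sum_j scal (W k i j) * ext_gen j) *
    ext_in (tw_inv S k).
Proof.
have E : \sum_j scal (W k i j) * (\sum_l scal (W k l j) * ext_gen l) =
    ext_gen i.
  under eq_bigr => j _ do rewrite mulr_sumr.
  rewrite exchange_big /=.
  under eq_bigr => l _.
    under eq_bigr => j _ do rewrite mulrA -scalM.
    rewrite -mulr_suml -rmorph_sum /=.
    have -> : \sum_j W k i j * W k l j = (i == l)%:R.
      have /matrixP/(_ i l) := orep_orth W k; rewrite !mxE => <-.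
      by apply: eq_bigr => j _; rewrite !mxE.
    over.
  rewrite (bigD1 i) //= eqxx scal1 mul1r big1 ?addr0 // => l li.
  by rewrite eq_sym (negbTE li) scal0 mul0r.
rewrite -[in LHS]E mulr_sumr mulr_sumr mulr_suml; apply: eq_bigr => j _.
rewrite -ext_actE !mulrA -[ext_in (tw_inv S k) * scal _]scalC.
rewrite -!mulrA [ext_in (tw_inv S k) * (scal _ * _)]mulrA -scalC -!mulrA.
rewrite [ext_in (tw_inv S k) * (ext_in _ * _)]mulrA -rmorphM tw_mulV rmorph1.
rewrite mul1r.
by rewrite !mulrA -!scalM; congr (scal _ * _ * _); rewrite mulrC.
Qed.

End ExtendedAlgebra.

(* For W = 0 the algebra A^W is A itself. *)
Section ZeroRep.
Variables (R : realType) (G : finGroupType) (S : symmetry R G).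
Local Notation A := (twisted_alg S).
Local Notation A0 := (ext_alg S (zero_rep R G)).

Let v (x : A + 'I_0) : A :=
  match x with inl a => a | inr _ => 0 end.

Let vP t u : ext_rel (S := S) (zero_rep R G) t u -> eval v t = eval v u.
Proof. by case=> [||||||] //= => [[]|[]|[]|? []]. Qed.

Let inv : {rmorphism A0 -> A} := lift vP.

Lemma ext_alg0 : super_isomorphic A A0.
Proof.
have K1 : cancel (ext_in (zero_rep R G) : A -> A0) inv.
  by move=> a; rewrite /inv /ext_in lift_gen.
have K2 : cancel inv (ext_in (zero_rep R G) : A -> A0).
  elim/presented_ind => [[a|[]]//|r|x y ex ey|x y ex ey].
  - by rewrite /inv lift_gen.
  - by rewrite /inv lift_scal ext_in_scal.
  - by rewrite !rmorphD /= ex ey.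
  by rewrite !rmorphM /= ex ey.
exists (ext_in (zero_rep R G) : {rmorphism A -> A0}); split.
- exact: ext_in_scal.
- by exists inv.
move=> b a; split=> [|ha]; first exact: ext_in_homog.
suff : homog b (inv (ext_in (zero_rep R G) a)) by rewrite K1.
elim: ha => {b a}
  [b x [[a /= ha|[]//] ->]|b|b r x y _ hx _ hy||b c x y _ hx _ hy].
- by rewrite /inv lift_gen.
- by rewrite rmorph0; apply: homog0.
- rewrite rmorphD rmorphM (_ : inv (scal r) = scal r); last exact: lift_scal.
  exact: (homogP _ _ _ _ hx hy).
- by rewrite rmorph1; apply: homog1.
by rewrite rmorphM; apply: (homogM _ _ _ _ hx hy).
Qed.
End ZeroRep.

Section Modules.
Variables (R : realType) (B : ralgType R).

Definition submodule (E : lmodType B) (P : E -> Prop) : Prop :=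
  [/\ P 0, forall x y, P x -> P y -> P (x + y) & forall b x, P x -> P (b *: x)].

Definition irreducible (E : lmodType B) : Prop :=
  (exists x : E, x != 0) /\
  forall P : E -> Prop, submodule P ->
    (forall x, P x -> x = 0) \/ (forall x, P x).

(* Finite dimension over R, which acts through [scal]. *)
Definition finite_dim (E : lmodType B) : Prop :=
  exists s : seq E, forall x, exists c : nat -> R,
    x = \sum_(i < size s) (scal (c i) : B) *: s`_i.

Definition mod_isomorphic (E F : lmodType B) : Prop :=
  exists f : {linear E -> F}, bijective f.

(* The summands W_1, W_2, ... are numbered from 0. *)
Record universe := Universe {
  summand : nat -> lmodType B;
  summand_irr : forall n, irreducible (summand n);
  summand_dim : forall n, finite_dim (summand n);
  summand_inf : forall E : lmodType B, irreducible E ->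
    forall N, exists2 n, (N <= n)%N & mod_isomorphic E (summand n)
}.

Record dsum (W : nat -> lmodType B) := Dsum {
  coord : forall n, W n;
  coord_fin : exists N, forall n, (N <= n)%N -> coord n = 0
}.

End Modules.

Section DirectSum.
Variables (R : realType) (B : ralgType R) (W : nat -> lmodType B).
Local Notation U := (dsum W).

HB.instance Definition _ := gen_eqMixin U.
HB.instance Definition _ := gen_choiceMixin U.

Lemma dsumP (x y : U) : (forall n, coord x n = coord y n) -> x = y.
Proof.
case: x y => [x hx] [y hy] /= e.
have {}e : x = y by apply: functional_extensionality_dep.
by subst y; congr Dsum; apply: Prop_irrelevance.
Qed.

Lemma dsum0_fin : exists N, forall n, (N <= n)%N -> (0 : W n) = 0.
Proof. by exists 0%N. Qed.
Lemma dsumN_fin (x : U) : exists N, forall n, (N <= n)%N -> - coord x n = 0.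
Proof.
by have [N h] := coord_fin x; exists N => n Nn; rewrite h // oppr0.
Qed.
Lemma dsumD_fin (x y : U) :
  exists N, forall n, (N <= n)%N -> coord x n + coord y n = 0.
Proof.
have [N h] := coord_fin x; have [M k] := coord_fin y.
by exists (maxn N M) => n; rewrite geq_max => /andP[/h-> /k->]; rewrite addr0.
Qed.
Lemma dsumZ_fin b (x : U) :
  exists N, forall n, (N <= n)%N -> b *: coord x n = 0.
Proof.
by have [N h] := coord_fin x; exists N => n Nn; rewrite h // scaler0.
Qed.

Definition dsum0 : U := Dsum dsum0_fin.
Definition dsumN x : U := Dsum (dsumN_fin x).
Definition dsumD x y : U := Dsum (dsumD_fin x y).
Definition dsumZ b x : U := Dsum (dsumZ_fin b x).

Let addA : associative dsumD.
Proof. by move=> x y z; apply: dsumP => n /=; rewrite addrA. Qed.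
Let addC : commutative dsumD.
Proof. by move=> x y; apply: dsumP => n /=; rewrite addrC. Qed.
Let add0 : left_id dsum0 dsumD.
Proof. by move=> x; apply: dsumP => n /=; rewrite add0r. Qed.
Let addN : left_inverse dsum0 dsumN dsumD.
Proof. by move=> x; apply: dsumP => n /=; rewrite addNr. Qed.

HB.instance Definition _ := GRing.isZmodule.Build U addA addC add0 addN.

Let scaleA b c x : dsumZ b (dsumZ c x) = dsumZ (b * c) x.
Proof. by apply: dsumP => n /=; rewrite scalerA. Qed.
Let scale1 : left_id 1 dsumZ.
Proof. by move=> x; apply: dsumP => n /=; rewrite scale1r. Qed.
Let scaleDr : right_distributive dsumZ +%R.
Proof. by move=> b x y; apply: dsumP => n /=; rewrite scalerDr. Qed.
Let scaleDl x : {morph dsumZ^~ x : b c / b + c}.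
Proof. by move=> b c; apply: dsumP => n /=; rewrite scalerDl. Qed.

HB.instance Definition _ :=
  GRing.Zmodule_isLmodule.Build B U scaleA scale1 scaleDr scaleDl.

Lemma coordZ b (x : U) n : coord (b *: x) n = b *: coord x n.
Proof. by []. Qed.

End DirectSum.

(* The classifying space K(A^W), for a universe Om of modules over
   Cl^{0,1} (x) A^W. *)
Section Classifying.
Variables (R : realType) (G : finGroupType) (S : symmetry R G).
Variables (q : nat) (W : orth_rep R G q).

(* B_eps is the generator of Cl^{0,1}, so that M_0 = B_eps *: _. *)
Definition Balg := super_tensor (clifford R 0 1) (ext_alg S W).
HB.instance Definition _ := SuperAlgebra.on Balg.

Definition B_eps : Balg := tensl (ext_alg S W) (clifford_gen R (inr ord0)).
Definition B_in (a : twisted_alg S) : Balg :=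
  tensr (clifford R 0 1) (ext_in W a).
Definition B_gen (i : 'I_q) : Balg := tensr (clifford R 0 1) (ext_gen S W i).

Variable Om : universe Balg.
Local Notation U := (dsum (summand Om)).

(* U_n and its complement, the sum of the W_j with j > n. *)
Definition in_Un (n : nat) (u : U) : Prop :=
  forall j, (n < j)%N -> coord u j = 0.
Definition above_Un (n : nat) (u : U) : Prop :=
  forall j, (j <= n)%N -> coord u j = 0.

Definition at_stage (n : nat) (M : U -> U) : Prop :=
  (forall u, in_Un n u -> in_Un n (M u)) /\
  (forall u, above_Un n u -> M u = B_eps *: u).

Record Kspace := KSpace {
  Kop :> U -> U;
  KopD : forall u v, Kop (u + v) = Kop u + Kop v;
  KopC : forall z u, Kop (B_in (tw_cst S z) *: u) = B_in (tw_cst S z) *: Kop u;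
  KopK : forall u, Kop (Kop u) = u;
  Kop_anti : forall i u, Kop (B_gen i *: u) = - (B_gen i *: Kop u);
  Kop_stage : exists n, at_stage n Kop
}.

HB.instance Definition _ := gen_eqMixin Kspace.
HB.instance Definition _ := gen_choiceMixin Kspace.

Definition Kstage (n : nat) : Type := {M : Kspace | `[< at_stage n M >]}.
HB.instance Definition _ n := Choice.on (Kstage n).

Definition Un_type (n : nat) : Type := {u : U | in_Un n u}.

Record functional := Functional {
  functional_fun :> U -> R;
  functionalD : forall u v,
    functional_fun (u + v) = functional_fun u + functional_fun v;
  functionalZ : forall (r : R) u,
    functional_fun ((scal r : Balg) *: u) = r * functional_fun u
}.

(* The n-th stage of K has the topology of the finite-dimensional real vector
   space End(U_n): the coarsest one for which all M |-> l (M u), with u in U_n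
   and l a linear functional, are continuous. *)
Definition matrix_coef (n : nat) (M : Kstage n) :
    {ptws Un_type n * functional -> R} :=
  fun p => p.2 (sval M (sval p.1)).

Definition Kopen : set (set Kspace) :=
  [set O | forall n,
    @open (initial_topology (@matrix_coef n)) [set M | O (sval M)]]%classic.

Let KopenT : Kopen setT.
Proof. by move=> n; apply: openT. Qed.
Let KopenI : setI_closed Kopen.
Proof. by move=> O1 O2 h1 h2 n; apply: openI. Qed.
Let Kopen_bigU (I : Type) (f : I -> set Kspace) :
  (forall i, Kopen (f i)) -> Kopen (\bigcup_i f i)%classic.
Proof.
move=> h n; have := @bigcup_open (initial_topology (@matrix_coef n)) I setT
  (fun i => [set M | f i (sval M)]%classic) (fun i _ => h i n).
by [].
Qed.

HB.instance Definition _ :=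
  isOpenTopological.Build Kspace KopenT KopenI Kopen_bigU.

Lemma Kspace_openE : open = Kopen.
Proof. by []. Qed.

Lemma Kspace_eq (M N : Kspace) : (forall u, M u = N u) -> M = N.
Proof.
case: M N => [M ? ? ? ? ?] [N ? ? ? ? ?] /= e.
have {}e : M = N by apply: funext.
by subst N; congr KSpace; apply: Prop_irrelevance.
Qed.

Section Action.
Variables (g : G) (M : Kspace).
Local Notation sg := (scal ((-1) ^+ hdeg S g) : Balg).
Local Notation rg := (B_in (tw_basis S g)).
Local Notation rgV := (B_in (tw_inv S g)).

(* g . M = (-1)^h(g) rho(g) M rho(g)^-1. *)
Definition Kact_op (u : U) : U := sg *: (rg *: M (rgV *: u)).

Lemma B_inM a b : B_in (a * b) = B_in a * B_in b.
Proof. by rewrite /B_in !rmorphM. Qed.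
Lemma B_in1 : B_in 1 = 1. Proof. by rewrite /B_in !rmorph1. Qed.
Lemma B_in_scal r : B_in (scal r) = scal r.
Proof. by rewrite /B_in ext_in_scal tensr_scal. Qed.

Lemma Kop_scal r u : M ((scal r : Balg) *: u) = (scal r : Balg) *: M u.
Proof. by rewrite -B_in_scal tw_scalE KopC. Qed.

Lemma Kop0 : M 0 = 0.
Proof. by have := Kop_scal 0 0; rewrite scal0 !scale0r. Qed.

Lemma Kop_sum (I : finType) (F : I -> U) :
  M (\sum_i F i) = \sum_i M (F i).
Proof. exact: (big_morph (Kop M) (@KopD M) Kop0). Qed.

Let sgK : sg * sg = 1.
Proof. by rewrite -scalM -signr_addb addbb scal1. Qed.

Let KactD u v : Kact_op (u + v) = Kact_op u + Kact_op v.
Proof. by rewrite /Kact_op scalerDr KopD !scalerDr. Qed.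

Let KactC z u :
  Kact_op (B_in (tw_cst S z) *: u) = B_in (tw_cst S z) *: Kact_op u.
Proof.
rewrite /Kact_op [rgV *: _]scalerA.
have -> : rgV * B_in (tw_cst S z) = B_in (tw_cst S (conj_if (sgn S g) z)) * rgV.
  by rewrite -!B_inM -tw_invC conj_ifD addbb.
rewrite -[in LHS]scalerA KopC [rg *: (B_in _ *: _)]scalerA -B_inM tw_basisC.
by rewrite conj_ifD addbb /= B_inM !scalerA !mulrA -scalC.
Qed.

Let KactK u : Kact_op (Kact_op u) = u.
Proof.
rewrite /Kact_op !scalerA -[rgV * sg]scalC -!scalerA Kop_scal.
rewrite [rgV *: _]scalerA -B_inM tw_mulV B_in1 scale1r KopK.
rewrite !scalerA -!mulrA [rg * (sg * _)]mulrA -[rg * sg]scalC.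
by rewrite -mulrA -B_inM tw_mulVr B_in1 mulr1 sgK scale1r.
Qed.

Let Kact_anti i u : Kact_op (B_gen i *: u) = - (B_gen i *: Kact_op u).
Proof.
have E : rgV * B_gen i = sg * (\sum_j scal (W g i j) * B_gen j) * rgV.
  rewrite /B_in /B_gen -rmorphM ext_actV 2!rmorphM /= tensr_scal rmorph_sum.
  congr (_ * _ * _); apply: eq_bigr => j _.
  by rewrite rmorphM /= tensr_scal.
rewrite /Kact_op [rgV *: (_ *: u)]scalerA E -!scalerA Kop_scal.
have -> : M ((\sum_j scal (W g i j) * B_gen j) *: (rgV *: u)) =
    - ((\sum_j scal (W g i j) * B_gen j) *: M (rgV *: u)).
  rewrite !scaler_suml Kop_sum -sumrN; apply: eq_bigr => j _.
  by rewrite -!scalerA Kop_scal Kop_anti scalerN.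
rewrite !scalerN; congr (- _).
set v := M _; rewrite !scalerA; congr (_ *: v).
rewrite -mulrA; set T := \sum_j _ in E *.
have -> : sg * T = rgV * B_gen i * rg.
  by rewrite E -!mulrA -B_inM tw_mulV B_in1 mulr1.
by rewrite !mulrA -[sg * rg * rgV]mulrA -B_inM tw_mulVr B_in1 mulr1 scalC.
Qed.

Let Kact_stage : exists n, at_stage n Kact_op.
Proof.
have [n [h1 h2]] := Kop_stage M; exists n; split=> u hu.
  move=> j nj; rewrite /Kact_op !coordZ h1 ?scaler0 // => k nk.
  by rewrite coordZ hu // scaler0.
rewrite /Kact_op h2; last by move=> j jn; rewrite coordZ hu // scaler0.
rewrite !scalerA; congr (_ *: u).
have e : rg * B_eps = sg * (B_eps * rg).
  have h0 : homog true (@clifford_gen R 0 1 (inr ord0)).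
    by apply: Gdeg_gen; exists (inr ord0).
  exact: (tens_comm h0 (ext_in_homog W (@homog_basis R G S g))).
rewrite -[sg * rg * B_eps]mulrA e -!mulrA -B_inM tw_mulVr B_in1 mulr1.
by rewrite mulrA sgK mul1r.
Qed.

Definition Kact : Kspace := KSpace KactD KactC KactK Kact_anti Kact_stage.
End Action.

Lemma Kact1 (M : Kspace) : Kact 1%g M = M.
Proof.
apply: Kspace_eq => u; rewrite /= /Kact_op.
have -> : B_in (tw_inv S 1%g) = 1.
  by rewrite -B_in1 -(tw_mulV S 1%g) tw_basis1 mulr1.
by rewrite tw_basis1 B_in1 hdeg1 scal1 !scale1r.
Qed.

Lemma KactM g k (M : Kspace) : Kact (g * k)%g M = Kact g (Kact k M).
Proof.
have w0 : omega S g k != 0 by rewrite -normr_eq0 omega_norm oner_eq0.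
set c := omega S g k in w0.
have cV : tw_cst S c^-1 * tw_cst S c = 1 by rewrite -rmorphM mulVf // rmorph1.
have Eb : tw_basis S g * tw_basis S k = tw_cst S c * tw_basis S (g * k)%g.
  exact: tw_basisM.
have Ei : tw_inv S (g * k)%g * tw_cst S c^-1 *
    (tw_basis S g * tw_basis S k) = 1.
  rewrite Eb mulrA -[_ * _ * tw_cst S c]mulrA cV mulr1; exact: tw_mulV.
have Er : tw_basis S g * tw_basis S k * (tw_inv S k * tw_inv S g) = 1.
  by rewrite -mulrA [tw_basis S k * _]mulrA tw_mulVr mul1r tw_mulVr.
have Ei' : tw_inv S k * tw_inv S g = tw_inv S (g * k)%g * tw_cst S c^-1.
  by rewrite -[LHS]mul1r -Ei -[LHS]mulrA Er mulr1.
have Em : tw_inv S (g * k)%g * tw_cst S c^-1 =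
    tw_cst S (conj_if (sgn S (g * k)%g) c^-1) * tw_inv S (g * k)%g.
  by rewrite -tw_invC conj_ifD addbb.
apply: Kspace_eq => u; rewrite /= {1}/Kact_op [RHS]/Kact_op /= /Kact_op.
have -> : B_in (tw_inv S k) *: (B_in (tw_inv S g) *: u) =
    B_in (tw_cst S (conj_if (sgn S (g * k)%g) c^-1)) *:
      (B_in (tw_inv S (g * k)%g) *: u).
  by rewrite !scalerA -!B_inM Ei' Em.
rewrite KopC !scalerA; congr (_ *: M _).
rewrite -!mulrA [B_in (tw_basis S g) * (scal _ * _)]mulrA -scalC.
rewrite -[scal _ * B_in (tw_basis S g) * _]mulrA [RHS]mulrA -scalM.
rewrite -signr_addb -hdegM.
congr (_ * _); rewrite [RHS]mulrA -!B_inM Eb -mulrA tw_basisC conj_ifD addbb /=.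
by rewrite mulrA -rmorphM mulfV // rmorph1 mul1r.
Qed.

End Classifying.

Section GHomotopy.
Variables (R : realType) (G : finGroupType).
Local Open Scope classical_set_scope.

Definition equivariant (X Y : Type) (aX : G -> X -> X) (aY : G -> Y -> Y)
  (f : X -> Y) : Prop := forall g x, f (aX g x) = aY g (f x).

Variables (X Y : topologicalType) (aX : G -> X -> X) (aY : G -> Y -> Y).

Definition G_homotopic (f0 f1 : X -> Y) : Prop :=
  exists H : X * R -> Y,
    [/\ {within [set: X] `*` `[0, 1], continuous H},
        forall x, H (x, 0) = f0 x,
        forall x, H (x, 1) = f1 x &
        forall t, 0 <= t <= 1 -> equivariant aX aY (fun x => H (x, t))].
End GHomotopy.

Definition G_homotopy_equivalent (R : realType) (G : finGroupType)
    (X Y : topologicalType) (aX : G -> X -> X) (aY : G -> Y -> Y) : Prop :=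
  exists (f : X -> Y) (k : Y -> X),
    [/\ continuous f /\ equivariant aX aY f,
        continuous k /\ equivariant aY aX k,
        G_homotopic R aX aX (k \o f) id &
        G_homotopic R aY aY (f \o k) id].

(* Main.v *)
(* Let e_j, f_j be the orthonormal bases of V and V'. In A^(V+V') the elements
   e_j and i f_j both transform by rho_V, so a_j = (e_j + i f_j) / 2 and
   b_j = (e_j - i f_j) / 2 satisfy the canonical anticommutation relations, and
   an orthogonal matrix M acting simultaneously on the a_j and on the b_j is
   implemented by the even element x_M = \sum_I (M b_I) p a_I^*, where
   p = \prod_j a_j b_j is the projection onto the vacuum. As M |-> x_M is
   multiplicative, the elements x_g^-1 g span a copy of A that supercommutes with
   the e_j and i f_j; this is the isomorphism of superalgebras.

   For a module over B = Cl^{0,1} (x) A^(V+V'), the vacuum vectors (those killed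
   by all the a_j) form a module over B0 = Cl^{0,1} (x) A, since x_g p = p. This
   is a Morita equivalence: irreducibles go to irreducibles, and the Fock space of
   a B0-module E, which is d times the doubling of E with the second copy twisted
   by the parity, has vacuum E. So the two universes have summands that match up
   to a bijection of the indices. An operator in K(A^(V+V')) anticommutes with the
   a_j and b_j, hence is determined by its restriction N to the vacuum, as
   \sum_I (-1)^|I| b_I N p a_I^*. This gives an equivariant homeomorphism of
   K(A^(V+V')) with K(A), of which both homotopies are constant. *)
From HB Require Import structures.
Require Import Defs.
From mathcomp Require Import all_boot all_order all_algebra fingroup.
From mathcomp Require Import mxrepresentation complex.
From mathcomp Require Import all_classical all_reals all_analysis.

Set Implicit Arguments.
Unset Strict Implicit.
Unset Printing Implicit Defensive.
Import GRing.Theory Num.Theory numFieldNormedType.Exports.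
Local Open Scope ring_scope.

(** The factor i does two jobs: it turns the square 1 of f_j into -1, which is why Cl^{d,0} appears
    beside Cl^{0,d}, and since g i = (-1)^s(g) i g it absorbs the sign in V'. Orthogonal matrices
    lift to a Clifford algebra only up to sign in general, and such signs could change the cocycle
    omega. Here the action on V + V is diagonal and preserves the span of the b_j, so it acts
    without ambiguity on the exterior algebra on the b_j, which is the Fock space; x_M is this
    operator, normalized by fixing the vacuum. The algebras A^W and the tensor products come by
    generators and relations, without a basis to count. Hence everything rests on one expansion of 1
    around the vacuum, and the isomorphism is checked by two morphisms that are inverse on
    generators. Replacing b by another family beta in that expansion, and p by an operator
    compatible with both vacua, gives an intertwiner: beta = M b yields x_M, and beta = -b extends
    an operator from the vacuum to the whole module. *)

(** * Canonical anticommutation relations: vacuum projection and sums over subsets of modes *)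

Section CAR.
Variables (T : pzRingType) (d : nat).
Implicit Types (a b beta gamma : 'I_d -> T) (s : seq 'I_d) (x y z : T).

Record car a b : Prop := Car {
  car_aa : forall i j, a i * a j = - (a j * a i);
  car_a2 : forall i, a i * a i = 0;
  car_bb : forall i j, b i * b j = - (b j * b i);
  car_b2 : forall i, b i * b i = 0;
  car_ab : forall i j, a i * b j = (i == j)%:R - b j * a i
}.

(* \sum_(I \subset s) beta_I z a_I^*, where a_I^* is a_I with its factors in
   reverse order. *)
Fixpoint dress a beta s z : T :=
  if s is i :: s' then
    let y := dress a beta s' z in y + beta i * y * a i
  else z.

Fixpoint vacuum a b s : T :=
  if s is i :: s' then a i * b i * vacuum a b s' else 1.

Lemma dress_mull a beta beta' s y z :
  (forall i, i \in s -> y * beta i = beta' i * y) ->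
  y * dress a beta s z = dress a beta' s (y * z).
Proof.
elim: s => //= i s IH h.
rewrite mulrDr IH; last by move=> j js; apply: h; rewrite in_cons js orbT.
by rewrite -IH ?mulrA ?h ?mem_head // => j js; apply: h; rewrite in_cons js orbT.
Qed.

Lemma dress_mulr a beta s y z : (forall i, a i * y = y * a i) ->
  dress a beta s z * y = dress a beta s (z * y).
Proof.
by move=> h; elim: s => //= i s IH; rewrite mulrDl -IH -!mulrA h.
Qed.

(** Each term with a nonempty index set begins with some [beta i], so only the term [z] of the empty
    set survives. *)
Lemma dress_killl a beta s x z : (forall i, x * beta i = 0) ->
  x * dress a beta s z = x * z.
Proof.
by move=> h; elim: s => //= i s IH; rewrite mulrDr !mulrA h !mul0r addr0.
Qed.

Lemma dress_killr a beta s x z : (forall i, a i * x = 0) ->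
  dress a beta s z * x = z * x.
Proof.
by move=> h; elim: s => //= i s IH; rewrite mulrDl -!mulrA h !mulr0 addr0.
Qed.

Lemma eq_dress a beta beta' s z : beta =1 beta' ->
  dress a beta s z = dress a beta' s z.
Proof. by move=> h; elim: s => //= i s ->; rewrite h. Qed.

(** Each term contains as many factors [beta] as factors [a], so the signs cancel in pairs. *)
Lemma dress_sign_comm a beta s x z (c : bool) :
  (forall i, x * beta i = (-1) ^+ c * (beta i * x)) ->
  (forall i, x * a i = (-1) ^+ c * (a i * x)) ->
  x * z = z * x -> x * dress a beta s z = dress a beta s z * x.
Proof.
move=> hb ha hz; elim: s => //= i s IH; rewrite mulrDr mulrDl IH; congr (_ + _).
rewrite !mulrA hb -!mulrA [x * (_ * a i)]mulrA IH -!mulrA ha.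
case: c {hb ha}; rewrite ?expr0 ?expr1 ?mulN1r ?mul1r //.
by rewrite !mulrN opprK.
Qed.

Section Rels.
Variables (a b : 'I_d -> T).
Hypothesis ab : car a b.

Lemma car_ab1 i : a i * b i = 1 - b i * a i.
Proof. by rewrite (car_ab ab) eqxx. Qed.
Lemma car_abN i j : i != j -> a i * b j = - (b j * a i).
Proof. by move=> /negbTE ij; rewrite (car_ab ab) ij sub0r. Qed.

Lemma number_comm x i (c : bool) :
  x * a i = (-1) ^+ c * (a i * x) -> x * b i = (-1) ^+ c * (b i * x) ->
  x * (a i * b i) = a i * b i * x.
Proof.
move=> ha hb; rewrite mulrA ha -!mulrA hb.
case: c {ha hb}; rewrite ?expr0 ?expr1 ?mulN1r ?mul1r //.
by rewrite !mulrN opprK.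
Qed.

Lemma vacuum_comm x s (c : bool) :
  (forall i, i \in s -> x * a i = (-1) ^+ c * (a i * x)) ->
  (forall i, i \in s -> x * b i = (-1) ^+ c * (b i * x)) ->
  x * vacuum a b s = vacuum a b s * x.
Proof.
elim: s => [|i s IH] ha hb /=; first by rewrite mulr1 mul1r.
rewrite mulrA (@number_comm x i c) ?ha ?hb ?mem_head //.
rewrite -[LHS]mulrA IH ?mulrA // => j js; [apply: ha|apply: hb];
  by rewrite in_cons js orbT.
Qed.

(** The factors [a j * b j] with j different from i are even and let [a i] pass, until it meets
    [a i * b i] and squares to zero. *)
Lemma a_vacuum s i : i \in s -> uniq s -> a i * vacuum a b s = 0.
Proof.
elim: s => //= j s IH; rewrite in_cons => ijs /andP[js us].
have [<-|ij] := eqVneq i j; first by rewrite !mulrA (car_a2 ab) !mul0r.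
rewrite mulrA (@number_comm _ _ true); first last.
- by rewrite expr1 mulN1r car_abN.
- by rewrite expr1 mulN1r (car_aa ab).
by rewrite -mulrA IH ?mulr0 //; move: ijs; rewrite (negbTE ij).
Qed.

Lemma b_a_sign i j : i != j -> b i * a j = - (a j * b i).
Proof. by rewrite eq_sym => ij; rewrite car_abN // opprK. Qed.

Lemma vacuum_b s i : i \in s -> uniq s -> vacuum a b s * b i = 0.
Proof.
elim: s => //= j s IH; rewrite in_cons => ijs /andP[js us].
have [eij|ij] := eqVneq i j; last first.
  by rewrite -mulrA IH ?mulr0 //; move: ijs; rewrite (negbTE ij).
rewrite -mulrA -(@vacuum_comm (b i) s true).
- by rewrite -!mulrA eij [b j * (b j * _)]mulrA (car_b2 ab) mul0r !mulr0.
- by move=> k ks; rewrite mulN1r b_a_sign // eij; apply: contraNneq js => ->.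
by move=> k ks; rewrite mulN1r (car_bb ab).
Qed.

(** The expansion of 1 around the vacuum. For one mode it reads a b + b (a b) a = a b + b a = 1; the
    modes combine because [a j * b j] is even and can be pulled out of the sum over the other
    modes. *)
Lemma dress_vacuum s : uniq s -> dress a b s (vacuum a b s) = 1.
Proof.
elim: s => //= j s IH /andP[js us].
have -> : dress a b s (a j * b j * vacuum a b s) = a j * b j.
  rewrite -(@dress_mull a b) ?IH ?mulr1 // => i is_.
  rewrite (@number_comm (b i) j true) // mulN1r 1?(car_bb ab) 1?b_a_sign //.
  by apply: contraNneq js => <-.
rewrite car_ab1 mulrBr mulr1 mulrBl.
by rewrite -!mulrA (car_a2 ab) !mulr0 subr0 subrK.
Qed.

Variables (beta gamma : 'I_d -> T) (z : T).
Hypothesis betabeta : forall i j, beta i * beta j = - (beta j * beta i).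
Hypothesis beta2 : forall i, beta i * beta i = 0.
Hypothesis gammabeta :
  forall i j, gamma i * beta j = (i == j)%:R - beta j * gamma i.
Hypothesis zb : forall i, z * b i = 0.
Hypothesis gammaz : forall i, gamma i * z = 0.

Lemma dress_b_notin s i : i \notin s -> dress a beta s z * b i = 0.
Proof.
elim: s => [|j s IH]; first by rewrite /= zb.
rewrite in_cons negb_or => /andP[ij /IH {}IH] /=.
by rewrite mulrDl IH add0r -mulrA car_abN 1?eq_sym // mulrN mulrA
  -[beta j * _ * b i]mulrA IH mulr0 mul0r oppr0.
Qed.

Lemma gamma_dress_notin s i : i \notin s -> gamma i * dress a beta s z = 0.
Proof.
elim: s => [|j s IH]; first by rewrite /= gammaz.
rewrite in_cons negb_or => /andP[ij /IH {}IH] /=.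
rewrite mulrDr IH add0r !mulrA gammabeta (negbTE ij) sub0r -!mulrA.
by rewrite mulNr -mulrA [gamma i * (_ * _)]mulrA IH mul0r mulr0 oppr0.
Qed.

(** Here [z] carries the vacuum of (a, b) to that of (gamma, beta), and the dressed sum intertwines
    the two pairs. Splitting off mode i writes it as y + beta_i y a_i with y b_i = 0. Multiplying by
    b_i on the right leaves beta_i y, and so does multiplying by beta_i on the left, as beta_i
    squares to zero. For the other modes both sides pick up the same sign. *)
Lemma dress_b s i : uniq s -> i \in s ->
  dress a beta s z * b i = beta i * dress a beta s z.
Proof.
elim: s => //= j s IH /andP[js us]; rewrite in_cons.
have [->|ij /= /(IH us) {}IH] := eqVneq i j.
  move=> _; rewrite mulrDl mulrDr dress_b_notin // add0r -!mulrA.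
  rewrite [beta j * (beta j * _)]mulrA beta2 mul0r addr0 car_ab1.
  rewrite mulrBr mulr1 [X in _ - X]mulrA dress_b_notin // mul0r subr0.
  by [].
rewrite mulrDl mulrDr IH; congr (_ + _).
rewrite -[LHS]mulrA car_abN 1?eq_sym // mulrN mulrA -[X in X * a j]mulrA IH.
by rewrite !mulrA betabeta !mulNr opprK.
Qed.

Lemma dress_a s i : uniq s -> i \in s ->
  dress a beta s z * a i = gamma i * dress a beta s z.
Proof.
elim: s => //= j s IH /andP[js us]; rewrite in_cons.
have [->|ij /= /(IH us) {}IH] := eqVneq i j.
  move=> _; rewrite mulrDl mulrDr gamma_dress_notin // add0r -!mulrA.
  rewrite (car_a2 ab) !mulr0 addr0 mulrA gammabeta eqxx mulrBl mul1r.
  by rewrite -mulrA [gamma j * (_ * _)]mulrA gamma_dress_notin // mul0r mulr0 subr0.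
rewrite mulrDl mulrDr IH; congr (_ + _).
rewrite -[LHS]mulrA (car_aa ab) mulrN mulrA -[X in X * a j]mulrA IH.
by rewrite !mulrA gammabeta (negbTE ij) sub0r !mulNr.
Qed.
End Rels.
End CAR.

Lemma signrCA (T : pzRingType) (x y : T) (c : bool) :
  x * ((-1) ^+ c * y) = (-1) ^+ c * (x * y).
Proof. by case: c; rewrite ?expr0 ?expr1 ?mulN1r ?mul1r ?mulrN. Qed.

(** * Clifford generators as creators and annihilators; elements implementing orthogonal matrices *)

Section Implementers.
Variables (R : realType) (T : ralgType R) (d : nat).
Implicit Types (a b E F : 'I_d -> T) (x y : T) (M N : 'M[R]_d).

Lemma scalMl (r : R) x y : x * (scal r * y) = scal r * (x * y).
Proof. by rewrite mulrA -scalC mulrA. Qed.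

Lemma scalMM (r t : R) x y :
  scal r * x * (scal t * y) = scal (r * t) * (x * y).
Proof. by rewrite -mulrA scalMl scalM !mulrA. Qed.

Lemma scal_half x : scal (2^-1 : R) * (x + x) = x.
Proof.
rewrite -{1 2}(mul1r x) -mulrDl mulrA -(scal1 T) -scalD -scalM.
by rewrite -[1 + 1]/(2 : R) mulVf ?pnatr_eq0 // scal1 mul1r.
Qed.

Definition annihilator E F i : T := scal (2^-1 : R) * (E i + F i).
Definition creator E F i : T := scal (2^-1 : R) * (E i - F i).

Lemma annihilatorDcreator E F i : annihilator E F i + creator E F i = E i.
Proof. by rewrite /annihilator /creator -mulrDr addrACA subrr addr0 scal_half. Qed.

Lemma annihilatorBcreator E F i : annihilator E F i - creator E F i = F i.
Proof. by rewrite /annihilator /creator -mulrBr opprD opprK addrACA subrr add0r scal_half. Qed.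

Lemma clifford_car E F :
  (forall i, E i * E i = 1) -> (forall i, F i * F i = -1) ->
  (forall i j, i != j -> E i * E j = - (E j * E i)) ->
  (forall i j, i != j -> F i * F j = - (F j * F i)) ->
  (forall i j, E i * F j = - (F j * E i)) ->
  car (annihilator E F) (creator E F).
Proof.
move=> E2 F2 EE FF EF.
(* The bit [c] treats [E i + F i] and [E i - F i] at once. *)
have nilE (c : bool) i : (E i + (-1) ^+ c * F i) * (E i + (-1) ^+ c * F i) = 0.
  case: c; rewrite ?expr0 ?expr1 ?mulN1r ?mul1r !mulrDl !mulrDr E2.
    by rewrite !(mulrN, mulNr) opprK F2 EF opprK addrA addrK addrN.
  by rewrite F2 EF addrA subrK addrN.
have antiE (c : bool) i j : (E i + (-1) ^+ c * F i) * (E j + (-1) ^+ c * F j) =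
    - ((E j + (-1) ^+ c * F j) * (E i + (-1) ^+ c * F i)).
  have [->|ij] := eqVneq i j; first by rewrite nilE oppr0.
  case: c; rewrite ?expr0 ?expr1 ?mulN1r ?mul1r !mulrDl !mulrDr ?(mulrN, mulNr);
    by rewrite EE // FF // (EF i j) (EF j i) !opprD ?opprK addrACA.
have mixE i j : i != j ->
    (E i + F i) * (E j - F j) = - ((E j - F j) * (E i + F i)).
  move=> ij; rewrite !mulrDl !mulrDr !(mulrN, mulNr).
  by rewrite EE // FF // (EF i j) (EF j i) !opprD ?opprK addrACA.
(* This anticommutator is 2 (E_i^2 - F_i^2) = 4; the two factors 1/2 in [annihilator] and [creator]
   turn it into 1. *)
have mix1 i : (E i + F i) * (E i - F i) + (E i - F i) * (E i + F i) = 2%:R + 2%:R.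
  rewrite !mulrDl !mulrDr !(mulrN, mulNr) E2 F2 opprK EF opprK.
  rewrite [LHS]addrACA [1 + _ + (1 - _)]addrACA addrN addr0.
  by rewrite [F i * E i + 1 + _]addrACA addrN add0r.
have sg0 E' F' (c : bool) i : E' i + (-1) ^+ c * F' i =
   if c then E' i - F' i else E' i + F' i :> T.
  by case: c; rewrite ?expr1 ?mulN1r // mul1r.
split=> [i j|i|i j|i|i j]; rewrite /annihilator /creator !scalMM.
- by have := antiE false i j; rewrite !sg0 => ->; rewrite mulrN.
- by have := nilE false i; rewrite !sg0 => ->; rewrite mulr0.
- by have := antiE true i j; rewrite !sg0 => ->; rewrite mulrN.
- by have := nilE true i; rewrite !sg0 => ->; rewrite mulr0.
have [->|ij] := eqVneq i j; last by rewrite mixE // mulrN sub0r.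
apply/eqP; rewrite eq_sym subr_eq -mulrDr mix1 scalM -mulrA scal_half.
by rewrite -[2%:R]/(1 + 1) scal_half.
Qed.

Lemma car_clifford a b : car a b ->
  [/\ forall i, (a i + b i) * (a i + b i) = 1,
      forall i, (a i - b i) * (a i - b i) = -1,
      forall i j, i != j -> (a i + b i) * (a j + b j) =
        - ((a j + b j) * (a i + b i)),
      forall i j, i != j -> (a i - b i) * (a j - b j) =
        - ((a j - b j) * (a i - b i)) &
      forall i j, (a i + b i) * (a j - b j) = - ((a j - b j) * (a i + b i))].
Proof.
(* The anticommutator is biadditive and symmetric, so all five relations reduce to its values on the
   [a i] and [b j]; squares are recovered by halving. *)
move=> ab; pose ac x y := x * y + y * x.
have acDl x y z : ac (x + y) z = ac x z + ac y z.
  by rewrite /ac mulrDl mulrDr addrACA.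
have acDr x y z : ac z (x + y) = ac z x + ac z y.
  by rewrite /ac mulrDl mulrDr addrACA.
have acC x y : ac x y = ac y x by rewrite /ac addrC.
have acNl x y : ac (- x) y = - ac x y by rewrite /ac mulrN mulNr opprD.
have acNr x y : ac x (- y) = - ac x y by rewrite /ac mulrN mulNr opprD.
have aa i j : ac (a i) (a j) = 0 by rewrite /ac (car_aa ab) addNr.
have bb i j : ac (b i) (b j) = 0 by rewrite /ac (car_bb ab) addNr.
have mix i j : ac (a i) (b j) = (i == j)%:R by rewrite /ac (car_ab ab) subrK.
have mix' i j : ac (b i) (a j) = (i == j)%:R by rewrite acC mix eq_sym.
have acS x y : ac x x = y + y -> x * x = y.
  by rewrite /ac => e; rewrite -[LHS]scal_half e scal_half.
have ac0 x y : ac x y = 0 -> x * y = - (y * x).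
  by rewrite /ac => /eqP; rewrite addr_eq0 => /eqP.
split=> [i|i|i j /negbTE ij|i j /negbTE ij|i j]; (apply: acS || apply: ac0);
  rewrite !(acDl, acDr, acNl, acNr, aa, bb, mix, mix') ?eqxx ?ij;
  by rewrite ?oppr0 ?add0r ?addr0 ?oppr0 ?addr0 ?addNr ?subrr.
Qed.

Lemma car_rmorph (T' : ralgType R) (phi : {rmorphism T -> T'}) a b :
  car a b -> car (fun i => phi (a i)) (fun i => phi (b i)).
Proof.
move=> ab; split=> *; rewrite -!rmorphM.
- by rewrite (car_aa ab) rmorphN.
- by rewrite (car_a2 ab) rmorph0.
- by rewrite (car_bb ab) rmorphN.
- by rewrite (car_b2 ab) rmorph0.
by rewrite (car_ab ab) rmorphB rmorph_nat.
Qed.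

(** The convention of [orth_rep]: column [i] of [M] holds the image of the i-th vector. *)
Definition mxrot M (x : 'I_d -> T) (i : 'I_d) : T := \sum_j scal (M j i) * x j.

Lemma mxrotM M N (x : 'I_d -> T) i : mxrot (M *m N) x i = mxrot N (mxrot M x) i.
Proof.
rewrite /mxrot; under eq_bigr do rewrite mxE rmorph_sum mulr_suml.
rewrite exchange_big; apply: eq_bigr => k _ /=.
by rewrite mulr_sumr; apply: eq_bigr => j _; rewrite mulrA -scalM mulrC.
Qed.

Lemma mxrot1 (x : 'I_d -> T) i : mxrot 1%:M x i = x i.
Proof.
rewrite /mxrot (bigD1 i) //= mxE eqxx scal1 mul1r big1 ?addr0 // => j ji.
by rewrite mxE (negbTE ji) scal0 mul0r.
Qed.

Lemma mxrot_commr M (x : 'I_d -> T) y z (c : bool) i :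
  (forall j, y * x j = (-1) ^+ c * (x j * z)) ->
  y * mxrot M x i = (-1) ^+ c * (mxrot M x i * z).
Proof.
move=> h; rewrite /mxrot mulr_sumr mulr_suml mulr_sumr; apply: eq_bigr => j _.
by rewrite scalMl h -[_ * _ * z]mulrA scalMl.
Qed.

Lemma mxrot_annih M (x : 'I_d -> T) y i : (forall j, y * x j = 0) -> y * mxrot M x i = 0.
Proof. by move=> h; rewrite mulr_sumr big1 // => j _; rewrite scalMl h mulr0. Qed.

Lemma mxrot_annihl M (x : 'I_d -> T) y i :
  (forall j, x j * y = 0) -> mxrot M x i * y = 0.
Proof. by move=> h; rewrite mulr_suml big1 // => j _; rewrite -mulrA h mulr0. Qed.

Lemma mxrot_anti M (x y : 'I_d -> T) i j :
  (forall k l, x k * y l = - (y l * x k)) ->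
  mxrot M x i * mxrot M y j = - (mxrot M y j * mxrot M x i).
Proof.
move=> h; rewrite /mxrot !mulr_suml; under eq_bigr do rewrite mulr_sumr.
rewrite exchange_big -sumrN /=; apply: eq_bigr => k _.
rewrite mulr_sumr -sumrN; apply: eq_bigr => l _.
by rewrite !scalMM h mulrN; congr (- (scal _ * _)); apply: mulrC.
Qed.

Section Car.
Variables (a b : 'I_d -> T).
Hypothesis ab : car a b.
Local Notation all_i := (enum 'I_d).
Local Notation p := (vacuum a b all_i).

Let uI : uniq all_i. Proof. exact: enum_uniq. Qed.
Let inI i : i \in all_i. Proof. by rewrite mem_enum. Qed.

Definition implementer M : T := dress a (mxrot M b) all_i p.

Lemma a_vac i : a i * p = 0. Proof. exact: a_vacuum. Qed.
Lemma vac_b i : p * b i = 0. Proof. exact: vacuum_b. Qed.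
Lemma dress_vac : dress a b all_i p = 1. Proof. exact: dress_vacuum. Qed.

Lemma vac_mulr x : (forall i, x * b i = 0) -> x * p = x.
Proof. by move=> h; rewrite -{2}[x]mulr1 -dress_vac dress_killl. Qed.
Lemma vac_mull x : (forall i, a i * x = 0) -> p * x = x.
Proof. by move=> h; rewrite -{2}[x]mul1r -dress_vac dress_killr. Qed.
Lemma vacK : p * p = p. Proof. exact: vac_mull a_vac. Qed.

(** An arbitrary invertible matrix acting on the [b j] would force its inverse transpose on the
    [a j]; orthogonality lets one matrix act on both families. *)
Lemma mxrot_car_ab M i j : M^T *m M = 1%:M ->
  mxrot M a i * mxrot M b j = (i == j)%:R - mxrot M b j * mxrot M a i.
Proof.
move=> orth; have E k l : scal (M k i) * a k * (scal (M l j) * b l) =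
    scal (M k i * M l j) * (k == l)%:R -
    scal (M l j) * b l * (scal (M k i) * a k).
  by rewrite !scalMM (car_ab ab) mulrBr [M l j * _]mulrC.
rewrite /mxrot !mulr_suml.
under eq_bigr do rewrite mulr_sumr.
under eq_bigr => k _ do under eq_bigr => l _ do rewrite E.
under eq_bigr do rewrite sumrB.
rewrite sumrB; congr (_ - _); last first.
  by rewrite exchange_big; apply: eq_bigr => l _; rewrite mulr_sumr.
have -> : (i == j)%:R = scal (\sum_k M k i * M k j) :> T.
  have /matrixP/(_ i j) := orth; rewrite !mxE => e.
  rewrite -[LHS](rmorph_nat (scal : R -> T)) -e; congr scal.
  by apply: eq_bigr => k _; rewrite mxE.
under eq_bigr => k _.
  rewrite (bigD1 k) //= eqxx mulr1 big1 ?addr0; last first.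
    by move=> l lk; rewrite eq_sym (negbTE lk) mulr0.
  over.
by rewrite -rmorph_sum.
Qed.

Section Orth.
Variable M : 'M[R]_d.
Hypothesis orthM : M^T *m M = 1%:M.

Let bb i j : mxrot M b i * mxrot M b j = - (mxrot M b j * mxrot M b i).
Proof. exact/mxrot_anti/(car_bb ab). Qed.

Let b2 i : mxrot M b i * mxrot M b i = 0.
Proof. by have := scal_half (mxrot M b i * mxrot M b i); rewrite {2}bb subrr mulr0. Qed.

Lemma implementer_b i : implementer M * b i = mxrot M b i * implementer M.
Proof.
apply: (@dress_b _ _ a b ab) => //; exact: vac_b.
Qed.

Lemma implementer_a i : implementer M * a i = mxrot M a i * implementer M.
Proof.
apply: (@dress_a _ _ a b ab) => //.
- by move=> k j; apply: mxrot_car_ab.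
by move=> k; apply/mxrot_annihl/a_vac.
Qed.

Lemma implementer_vac : implementer M * p = p.
Proof. by rewrite dress_killr ?vacK //; exact: a_vac. Qed.

Lemma implementer_rot N i (c : 'I_d -> T) :
  (forall j, implementer M * c j = mxrot M c j * implementer M) ->
  implementer M * mxrot N c i = mxrot (M *m N) c i * implementer M.
Proof.
move=> h; rewrite mxrotM /mxrot mulr_sumr mulr_suml; apply: eq_bigr => j _.
by rewrite scalMl h mulrA.
Qed.

(** Pushing x_M through the sum that defines x_N rotates every creator by [M] and ends at x_M p = p.
    No scalar appears because the vacuum is fixed exactly, and not merely up to a factor. *)
Lemma implementerM N : implementer M * implementer N = implementer (M *m N).
Proof.
rewrite {2}/implementer (@dress_mull _ _ a _ (mxrot (M *m N) b)) ?implementer_vac //.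
by move=> i _; apply/implementer_rot/implementer_b.
Qed.
End Orth.

Lemma implementer1 : implementer 1%:M = 1.
Proof. by rewrite -dress_vac; apply: eq_dress => i; rewrite mxrot1. Qed.

Lemma implementer_comm M x (c : bool) :
  (forall i, x * a i = (-1) ^+ c * (a i * x)) ->
  (forall i, x * b i = (-1) ^+ c * (b i * x)) ->
  x * implementer M = implementer M * x.
Proof.
move=> ha hb; apply: (@dress_sign_comm _ _ _ _ _ _ _ c) => //.
  by move=> i; apply: mxrot_commr.
exact: (@vacuum_comm _ _ _ _ _ _ c).
Qed.

End Car.
End Implementers.

(** * Morphisms out of algebras given by generators *)

Section Lifts.
Variable R : realType.

Lemma scal_sign (T : ralgType R) (c : bool) : scal ((-1) ^+ c) = (-1) ^+ c :> T.
Proof. by case: c; rewrite ?scalN scal1. Qed.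

Section PresentedMorphisms.
Variables (X : Type) (rel : term R X -> term R X -> Prop).
Local Notation P := (presented rel).

Variable g : bool -> X -> Prop.

Lemma presented_hom_homog (T : superAlgType R) (f : {rmorphism P -> T}) :
  (forall r, f (scal r) = scal r) ->
  (forall c x, g c x -> homog c (f (gen rel x))) ->
  forall c y, presented_homog (rel := rel) g c y -> homog c (f y).
Proof.
move=> fs fg c y; elim=> {c y} [b _ [x gx ->]|b|b r x y _ hx _ hy||
    b c x y _ hx _ hy].
- exact: fg.
- by rewrite rmorph0; apply: homog0.
- by rewrite rmorphD rmorphM fs; apply: homogP.
- by rewrite rmorph1; apply: homog1.
by rewrite rmorphM; apply: homogM.
Qed.

(** With [w] in the role of an element of degree [b], this reduces the sign rule of a super tensor
    product to generators of one factor; applying it to each factor in turn reduces it to generators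
    of both. *)
Lemma presented_supercomm (T : ralgType R) (f : {rmorphism P -> T}) w b :
  (forall r, f (scal r) = scal r) ->
  (forall c x, g c x ->
    w * f (gen rel x) = (-1) ^+ (b && c) * (f (gen rel x) * w)) ->
  forall c y, presented_homog (rel := rel) g c y ->
    w * f y = (-1) ^+ (b && c) * (f y * w).
Proof.
move=> fs fg c y; elim=> {c y} [c _ [x gx ->]|c|c r x y _ hx _ hy||
    c c' x y _ hx _ hy].
- exact: fg.
- by rewrite rmorph0 mulr0 mul0r mulr0.
- rewrite rmorphD rmorphM fs mulrDr scalMl hx hy mulrDl mulrDr.
  by rewrite -!mulrA scalMl.
- by rewrite rmorph1 andbF expr0 mulr1 !mul1r.
rewrite rmorphM mulrA hx -!mulrA hy; case: b {fg hx hy} => //=; last first.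
  by rewrite !expr0 !mul1r.
by case: c; case: c';
  rewrite /= ?expr0 ?expr1 ?mulN1r ?mul1r ?mulNr ?mulrN ?opprK.
Qed.

End PresentedMorphisms.

Section SuperTensorMaps.
Variables (A B : superAlgType R) (T : ralgType R).
Variables (fA : {rmorphism A -> T}) (fB : {rmorphism B -> T}).
Hypothesis fAs : forall r, fA (scal r) = scal r.
Hypothesis fBs : forall r, fB (scal r) = scal r.
Hypothesis fAB : forall b c x y, homog b x -> homog c y ->
  fB y * fA x = (-1) ^+ (b && c) * (fA x * fB y).

Lemma super_tensor_lift : exists f : {rmorphism super_tensor A B -> T},
  [/\ forall r, f (scal r) = scal r, forall x, f (tensl B x) = fA x &
      forall y, f (tensr A y) = fB y].
Proof.
pose v (x : A + B) := match x with inl x => fA x | inr y => fB y end.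
have vP t u : super_tensor_rel t u -> Defs.eval v t = Defs.eval v u.
  case=> [r|x y|x y|r|x y|x y|b c x y hx hy] /=.
  - exact: fAs.
  - exact: rmorphD.
  - exact: rmorphM.
  - exact: fBs.
  - exact: rmorphD.
  - exact: rmorphM.
  by rewrite (fAB hx hy) scal_sign.
exists (Defs.lift vP); split=> [r|x|y]; first exact: lift_scal.
  exact: lift_gen.
exact: lift_gen.
Qed.

End SuperTensorMaps.

Section CliffordMaps.
Variables (p q : nat) (T : ralgType R) (e : 'I_p + 'I_q -> T).
Hypothesis e_neg : forall i, e (inl i) * e (inl i) = -1.
Hypothesis e_pos : forall i, e (inr i) * e (inr i) = 1.
Hypothesis e_anti : forall x y, x != y -> e x * e y = - (e y * e x).

Lemma clifford_lift : exists f : {rmorphism clifford R p q -> T},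
  (forall r, f (scal r) = scal r) /\
  (forall x, f (clifford_gen R x) = e x).
Proof.
have eP t u : clifford_rel t u -> Defs.eval e t = Defs.eval e u.
  case=> [i|j|x y xy] /=; rewrite ?e_neg ?e_pos ?scalN ?scal1 //.
  by rewrite e_anti // mulN1r.
by exists (Defs.lift eP); split=> [r|x]; [exact: lift_scal|exact: lift_gen].
Qed.
End CliffordMaps.

Lemma clifford_hom_eq p q (T : ralgType R) (f h : {rmorphism clifford R p q -> T}) :
  (forall r, f (scal r) = h (scal r)) ->
  (forall x, f (clifford_gen R x) = h (clifford_gen R x)) -> f =1 h.
Proof.
move=> es eg; elim/presented_ind => // x y ex ey; first by rewrite !rmorphD ex ey.
by rewrite !rmorphM ex ey.
Qed.

Lemma super_tensor_hom_eq (A B : superAlgType R) (T : ralgType R)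
    (f h : {rmorphism super_tensor A B -> T}) :
  f \o tensl B =1 h \o tensl B -> f \o @tensr R A B =1 h \o @tensr R A B ->
  f =1 h.
Proof.
move=> el er; elim/presented_ind => [[x|x]|r|x y ex ey|x y ex ey].
- exact: el.
- exact: er.
- by rewrite -(tensl_scal A B); apply: el.
- by rewrite !rmorphD ex ey.
by rewrite !rmorphM ex ey.
Qed.

Section TwistedMaps.
Variables (G : finGroupType) (S : symmetry R G) (T : ralgType R).
Local Notation A := (twisted_alg S).

Lemma tw_decomp (a : A) : a = \sum_g tw_cst S (a g) * tw_basis S g.
Proof.
apply/ffunP => l; rewrite sum_ffunE (bigD1 l) //= tw_cstl ffunE eqxx mulr1.
rewrite big1 ?addr0 // => g gl.
by rewrite tw_cstl ffunE eq_sym (negbTE gl) mulr0.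
Qed.

Lemma twisted_hom_eq (f h : {rmorphism A -> T}) :
  (forall z, f (tw_cst S z) = h (tw_cst S z)) ->
  (forall g, f (tw_basis S g) = h (tw_basis S g)) -> f =1 h.
Proof.
move=> ec eb a; rewrite (tw_decomp a) !rmorph_sum; apply: eq_bigr => g _.
by rewrite !rmorphM ec eb.
Qed.

Variables (tc : {rmorphism R[i] -> T}) (Y : G -> T).
Hypothesis tcs : forall r : R, tc r%:C%C = scal r.
Hypothesis Yc : forall g z, Y g * tc z = tc (conj_if (sgn S g) z) * Y g.
Hypothesis YM : forall g k, Y g * Y k = tc (omega S g k) * Y (g * k)%g.
Hypothesis Y1 : Y 1%g = 1.

(** The universal property of a crossed product: [Yc], [YM] and [Y1] say that constants and the
    [Y g] multiply as in the twisted group algebra. The explicit sum is part of the conclusion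
    because degrees and commutation signs are later checked term by term on it. *)
Lemma twisted_lift : exists f : {rmorphism A -> T},
  [/\ forall a, f a = \sum_g tc (a g) * Y g,
      forall r, f (scal r) = scal r,
      forall z, f (tw_cst S z) = tc z & forall g, f (tw_basis S g) = Y g].
Proof.
pose f (a : A) := \sum_g tc (a g) * Y g.
have fz : zmod_morphism f.
  move=> a b; rewrite /f -sumrB; apply: eq_bigr => g _.
  by rewrite !ffunE rmorphB mulrBl.
have fc z : f (tw_cst S z) = tc z.
  rewrite /f (bigD1 1%g) //= ffunE eqxx Y1 mulr1 big1 ?addr0 // => g g1.
  by rewrite ffunE (negbTE g1) rmorph0 mul0r.
have fm : monoid_morphism f.
  split=> [|a b]; first by rewrite -[1]/(tw_cst S 1) fc rmorph1.
  rewrite /f mulr_suml.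
  under eq_bigr => l _ do rewrite tw_mulE rmorph_sum mulr_suml.
  rewrite exchange_big; apply: eq_bigr => g _ /=.
  rewrite mulr_sumr (reindex_inj (mulgI g)); apply: eq_bigr => k _ /=.
  rewrite mulKg !rmorphM -!mulrA -YM; congr (_ * _).
  by rewrite mulrA -Yc mulrA.
pose mz := GRing.isZmodMorphism.Build A T f fz.
pose mm := GRing.isMonoidMorphism.Build A T f fm.
pose F : {rmorphism A -> T} := HB.pack f mz mm.
exists F; split=> //= [r|g]; first by rewrite tw_scalE fc tcs.
rewrite /f (bigD1 g) //= ffunE eqxx rmorph1 mul1r big1 ?addr0 // => k kg.
by rewrite ffunE (negbTE kg) rmorph0 mul0r.
Qed.
End TwistedMaps.

Section ExtMaps.
Variables (G : finGroupType) (S : symmetry R G) (T : ralgType R).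
Variables (q : nat) (W : orth_rep R G q).
Variables (eta : {rmorphism twisted_alg S -> T}) (e : 'I_q -> T).
Hypothesis etas : forall r, eta (scal r) = scal r.
Hypothesis e2 : forall i, e i * e i = 1.
Hypothesis e_anti : forall i j, i != j -> e i * e j = - (e j * e i).
Hypothesis e_cst : forall i z, e i * eta (tw_cst S z) = eta (tw_cst S z) * e i.
Hypothesis e_act : forall g i, eta (tw_basis S g) * e i =
  (-1) ^+ hdeg S g * (mxrot (W g) e i * eta (tw_basis S g)).

Lemma ext_lift : exists f : {rmorphism ext_alg S W -> T},
  [/\ forall r, f (scal r) = scal r, forall a, f (ext_in W a) = eta a &
      forall i, f (ext_gen S W i) = e i].
Proof.
pose v (x : twisted_alg S + 'I_q) := match x with inl a => eta a | inr i => e i end.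
have vP t u : ext_rel (S := S) W t u -> Defs.eval v t = Defs.eval v u.
  case=> [r|a b|a b|i|i j ij|i z|g i].
  - exact: etas.
  - exact: rmorphD.
  - exact: rmorphM.
  - by rewrite /= scal1.
  - by rewrite /= scalN scal1 mulN1r e_anti.
  - exact: e_cst.
  rewrite eval_sum /= e_act scal_sign -!mulrA -rmorphM tw_mulVr rmorph1 mulr1.
  by rewrite mulrA -signr_addb addbb mul1r.
by exists (Defs.lift vP); split=> [r|a|i]; [exact: lift_scal|exact: lift_gen..].
Qed.
End ExtMaps.

Lemma ext_hom_eq (G : finGroupType) (S : symmetry R G) (T : ralgType R) q
    (W : orth_rep R G q) (f h : {rmorphism ext_alg S W -> T}) :
  f \o ext_in W =1 h \o ext_in W ->
  (forall i, f (ext_gen S W i) = h (ext_gen S W i)) -> f =1 h.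
Proof.
move=> ea eg; elim/presented_ind => [[x|x]|r|x y ex ey|x y ex ey].
- exact: ea.
- exact: eg.
- by rewrite -(ext_in_scal S W); apply: ea.
- by rewrite !rmorphD ex ey.
by rewrite !rmorphM ex ey.
Qed.

End Lifts.

Section Imaginary.
Variable R : realType.
Lemma i_mul_i : 'i%C * 'i%C = -1 :> R[i].
Proof. exact: sqr_i. Qed.
Lemma conj_if_i (c : bool) : conj_if c 'i%C = (-1) ^+ c * 'i%C :> R[i].
Proof.
case: c => /=; rewrite ?expr1 ?mulN1r ?mul1r //.
by apply/eqP; rewrite eq_complex /= oppr0 !eqxx.
Qed.
End Imaginary.

(** * The algebra of a doubled representation *)

Section DoubledRep.
Variables (R : realType) (G : finGroupType) (S : symmetry R G).
Variables (d : nat) (V : orth_rep R G d).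
Local Notation A := (twisted_alg S).
Local Notation VV' := (sum_rep V (twist_rep S V)).
Local Notation cst := (tw_cst S).
Local Notation bas := (tw_basis S).

Lemma sum_mxrot_l (T : ralgType R) (e : 'I_(d + d) -> T) g i :
  mxrot (VV' g) e (lshift d i) = mxrot (V g) (fun j => e (lshift d j)) i.
Proof.
rewrite /mxrot big_split_ord /= [X in _ + X]big1 ?addr0; last first.
  by move=> j _; rewrite block_mxEdl mxE scal0 mul0r.
by apply: eq_bigr => j _; rewrite block_mxEul.
Qed.

Lemma sum_mxrot_r (T : ralgType R) (e : 'I_(d + d) -> T) g i :
  mxrot (VV' g) e (rshift d i) =
  (-1) ^+ sgn S g * mxrot (V g) (fun j => e (rshift d j)) i.
Proof.
rewrite /mxrot big_split_ord /= [X in X + _]big1 ?add0r; last first.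
  by move=> j _; rewrite block_mxEur mxE scal0 mul0r.
rewrite mulr_sumr; apply: eq_bigr => j _.
by rewrite block_mxEdr mxE scalM scal_sign mulrA.
Qed.

Lemma repM g k : V g *m V k = V (g * k)%g.
Proof. by rewrite repr_mxM ?inE. Qed.
Lemma rep1 : V 1%g = 1%:M. Proof. exact: repr_mx1. Qed.

Section FockLift.
Variables (T : ralgType R) (tau : {rmorphism A -> T}) (a b : 'I_d -> T).
Hypothesis taus : forall r, tau (scal r) = scal r.
Hypothesis ab : car a b.
Hypothesis tau_cst_a : forall z i, tau (cst z) * a i = a i * tau (cst z).
Hypothesis tau_cst_b : forall z i, tau (cst z) * b i = b i * tau (cst z).
Hypothesis tau_bas_a : forall g i,
  tau (bas g) * a i = (-1) ^+ hdeg S g * (a i * tau (bas g)).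
Hypothesis tau_bas_b : forall g i,
  tau (bas g) * b i = (-1) ^+ hdeg S g * (b i * tau (bas g)).
Local Notation X g := (implementer a b (V g)).

Lemma implementer_cst M z :
  tau (cst z) * implementer a b M = implementer a b M * tau (cst z).
Proof.
by apply: (@implementer_comm _ _ _ _ _ _ _ false) => i; rewrite mul1r.
Qed.

Lemma implementer_bas M g :
  tau (bas g) * implementer a b M = implementer a b M * tau (bas g).
Proof. exact: (@implementer_comm _ _ _ _ _ _ _ (hdeg S g)). Qed.

(** A copy [tau] of the twisted group algebra that supercommutes with the modes does not rotate
    them; the factor [X g] supplies the rotation by [V g]. The target is an arbitrary real algebra,
    so that the lemma serves both for the super tensor product and for operators on a Fock
    module. *)
Lemma fock_lift : exists f : {rmorphism ext_alg S VV' -> T},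
  [/\ forall r, f (scal r) = scal r,
      forall x, f (ext_in VV' x) =
        \sum_g tau (cst (x g)) * (X g * tau (bas g)),
      (forall z, f (ext_in VV' (cst z)) = tau (cst z)) /\
      (forall g, f (ext_in VV' (bas g)) = X g * tau (bas g)),
      forall i, f (ext_gen S VV' (lshift d i)) = a i + b i &
      forall i, f (ext_gen S VV' (rshift d i)) =
        - (tau (cst 'i%C) * (a i - b i))].
Proof.
pose tc : {rmorphism R[i] -> T} := tau \o cst.
have orthV g : (V g)^T *m V g = 1%:M by exact: orep_trV.
(* [X g] is even, hence commutes with the image of [tau], and it is multiplicative in g; so the
   products [X g * tau (bas g)] obey the same cocycle [omega]. *)
have [||||eta [etaE etas etac etab]] := @twisted_lift _ _ S T tc
    (fun g => X g * tau (bas g)).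
- by move=> r; rewrite /= -tw_scalE taus.
- move=> g z; rewrite /= -mulrA -rmorphM tw_basisC rmorphM /=.
  by rewrite mulrA -implementer_cst mulrA.
- move=> g k; rewrite /= !mulrA -[X g * _ * X k]mulrA implementer_bas.
  rewrite mulrA (implementerM ab) repM -mulrA -rmorphM tw_basisM.
  by rewrite implementer_cst -mulrA -rmorphM.
- by rewrite tw_basis1 rmorph1 mulr1 rep1 implementer1.
(* The second half is forced: i f_j has to become a_j - b_j, so f_j goes to -i (a_j - b_j). *)
pose e (i : 'I_(d + d)) := match fintype.split i with
  | inl i => a i + b i | inr i => - (tau (cst 'i%C) * (a i - b i)) end.
have el i : e (lshift d i) = a i + b i by rewrite /e (unsplitK (inl i)).
have er i : e (rshift d i) = - (tau (cst 'i%C) * (a i - b i)).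
  by rewrite /e (unsplitK (inr i)).
have ii : tau (cst 'i%C) * tau (cst 'i%C) = -1.
  by rewrite -!rmorphM i_mul_i !rmorphN !rmorph1.
have cD z i : tau (cst z) * (a i + b i) = (a i + b i) * tau (cst z).
  by rewrite mulrDl mulrDr tau_cst_a tau_cst_b.
have cB z i : tau (cst z) * (a i - b i) = (a i - b i) * tau (cst z).
  by rewrite mulrBl mulrBr tau_cst_a tau_cst_b.
have [E2 F2 EE FF EF] := car_clifford ab.
have XA g i : X g * tau (bas g) * a i =
    (-1) ^+ hdeg S g * (mxrot (V g) a i * (X g * tau (bas g))).
  rewrite -mulrA tau_bas_a signrCA; congr (_ * _).
  by rewrite [RHS]mulrA -(implementer_a ab) // mulrA.
have XC g i : X g * tau (bas g) * b i =
    (-1) ^+ hdeg S g * (mxrot (V g) b i * (X g * tau (bas g))).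
  rewrite -mulrA tau_bas_b signrCA; congr (_ * _).
  by rewrite [RHS]mulrA -(implementer_b ab) // mulrA.
have rotN M y i : mxrot M (fun j => - y j) i = - mxrot M y i :> T.
  by rewrite /mxrot -sumrN; apply: eq_bigr => j _; rewrite mulrN.
have rotD M x y i : mxrot M (fun j => x j + y j) i = mxrot M x i + mxrot M y i :> T.
  by rewrite /mxrot -big_split; apply: eq_bigr => j _; rewrite mulrDr.
have XD g i : X g * tau (bas g) * (a i + b i) =
    (-1) ^+ hdeg S g * (mxrot (V g) (fun j => a j + b j) i * (X g * tau (bas g))).
  by rewrite mulrDr XA XC -mulrDr -mulrDl rotD.
have XB g i : X g * tau (bas g) * (a i - b i) =
    (-1) ^+ hdeg S g * (mxrot (V g) (fun j => a j - b j) i * (X g * tau (bas g))).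
  by rewrite mulrBr XA XC -mulrBr -mulrBl rotD rotN.
have Fsq i j : - (tau (cst 'i%C) * (a i - b i)) * - (tau (cst 'i%C) * (a j - b j)) =
    - ((a i - b i) * (a j - b j)).
  rewrite mulrNN -mulrA [Z in _ * Z]mulrA -cB !mulrA ii.
  by rewrite !mulN1r mulNr.
have EFc i j : (a i + b i) * - (tau (cst 'i%C) * (a j - b j)) =
    - (- (tau (cst 'i%C) * (a j - b j)) * (a i + b i)).
  by rewrite mulrN mulNr mulrA -cD -!mulrA EF mulrN !opprK.
have [||||f [fs fin fgen]] := @ext_lift _ _ S T _ VV' eta e etas.
- by move=> i; case: (split_ordP i) => k ->; rewrite ?el ?er // Fsq F2 opprK.
- move=> i j; case: (split_ordP i) => k ->; case: (split_ordP j) => l ->;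
    rewrite ?el ?er ?Fsq ?EFc ?opprK //.
  + by rewrite (inj_eq (@lshift_inj _ _)); apply: EE.
  + by rewrite (inj_eq (@rshift_inj _ _)) => /FF ->; rewrite opprK.
- move=> i z; rewrite etac; case: (split_ordP i) => k ->; rewrite ?el ?er /=.
    by rewrite cD.
  rewrite mulNr -!mulrA -cB mulrN !mulrA -!rmorphM.
  by rewrite mulrC.
- move=> g i; rewrite etab; case: (split_ordP i) => k ->; rewrite ?el ?er.
    rewrite sum_mxrot_l XD; congr (_ * (_ * _)).
    by apply: eq_bigr => j _; rewrite el.
  (* Passing the constant i costs the sign (-1)^s(g), exactly the sign by which V' differs from
     V. *)
  have Xi : X g * tau (bas g) * tau (cst 'i%C) =
      (-1) ^+ sgn S g * (tau (cst 'i%C) * (X g * tau (bas g))).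
    rewrite -mulrA -rmorphM tw_basisC conj_if_i.
    have -> : cst ((-1) ^+ sgn S g * 'i%C) = (-1) ^+ sgn S g * cst 'i%C.
      by rewrite rmorphM rmorph_sign.
    rewrite -mulrA rmorphM rmorph_sign signrCA rmorphM; congr (_ * _).
    by rewrite [RHS]mulrA implementer_cst mulrA.
  have er' : mxrot (V g) (fun j => e (rshift d j)) k =
      - (tau (cst 'i%C) * mxrot (V g) (fun j => a j - b j) k).
    rewrite /mxrot mulr_sumr -sumrN; apply: eq_bigr => j _.
    by rewrite er mulrN scalMl.
  have -> : X g * tau (bas g) * - (tau (cst 'i%C) * (a k - b k)) =
      - ((-1) ^+ sgn S g * (tau (cst 'i%C) * ((-1) ^+ hdeg S g *
          (mxrot (V g) (fun j => a j - b j) k * (X g * tau (bas g)))))).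
    rewrite mulrN [in LHS]mulrA Xi -[in LHS]mulrA -[tau _ * (X g * _) * _]mulrA XB.
    by [].
  rewrite sum_mxrot_r er' mulrN mulNr mulrN; congr (- _).
  by rewrite [tau _ * (_ ^+ _ * _)]signrCA [LHS]signrCA -!mulrA.
exists f; split=> // [x||i|i]; first by rewrite fin etaE.
- by split=> [z|g]; rewrite fin ?etac ?etab.
- by rewrite fgen el.
by rewrite fgen er.
Qed.
End FockLift.

Section InExt.
Local Notation E := (ext_alg S VV').
Local Notation inE := (ext_in VV').

(** [ext_neg] and [ext_pos] are named after their squares, -1 and 1. *)
Definition ext_neg (i : 'I_d) : E := inE (cst 'i%C) * ext_gen S VV' (rshift d i).
Definition ext_pos (i : 'I_d) : E := ext_gen S VV' (lshift d i).
Definition ext_ann : 'I_d -> E := annihilator ext_pos ext_neg.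
Definition ext_cre : 'I_d -> E := creator ext_pos ext_neg.

Lemma ext_gen2 i : ext_gen S VV' i * ext_gen S VV' i = 1.
Proof. by have := gen_rel (ext_sqr S VV' i); rewrite /= scal1. Qed.

Lemma ext_gen_anti i j : i != j ->
  ext_gen S VV' i * ext_gen S VV' j = - (ext_gen S VV' j * ext_gen S VV' i).
Proof.
by move=> ij; have := gen_rel (ext_anti S VV' ij); rewrite /= scalN scal1 mulN1r.
Qed.

Lemma ext_gen_cst z i :
  inE (cst z) * ext_gen S VV' i = ext_gen S VV' i * inE (cst z).
Proof. exact/esym/(gen_rel (ext_cst S VV' i z)). Qed.

Lemma ext_gen_bas g i : inE (bas g) * ext_gen S VV' i =
  (-1) ^+ hdeg S g * (mxrot (VV' g) (ext_gen S VV') i * inE (bas g)).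
Proof.
have := ext_actE S VV' g i; rewrite -/(mxrot _ _ _) scal_sign => <-.
by rewrite -!mulrA -rmorphM tw_mulV rmorph1 mulr1 [RHS]mulrA -signr_addb addbb mul1r.
Qed.

Lemma in_i2 : inE (cst 'i%C) * inE (cst 'i%C) = -1.
Proof. by rewrite -!rmorphM i_mul_i !rmorphN !rmorph1. Qed.

Lemma ext_neg_cst z i : inE (cst z) * ext_neg i = ext_neg i * inE (cst z).
Proof.
by rewrite /ext_neg -mulrA -ext_gen_cst !mulrA -!rmorphM mulrC.
Qed.

Lemma ext_pos_bas g i : inE (bas g) * ext_pos i =
  (-1) ^+ hdeg S g * (mxrot (V g) ext_pos i * inE (bas g)).
Proof. by rewrite ext_gen_bas sum_mxrot_l. Qed.

Lemma ext_neg_bas g i : inE (bas g) * ext_neg i =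
  (-1) ^+ hdeg S g * (mxrot (V g) ext_neg i * inE (bas g)).
Proof.
have -> : mxrot (V g) ext_neg i = inE (cst 'i%C) *
    mxrot (V g) (fun j => ext_gen S VV' (rshift d j)) i.
  by rewrite /mxrot mulr_sumr; apply: eq_bigr => j _; rewrite scalMl.
have cs : cst ((-1) ^+ sgn S g * 'i%C) = (-1) ^+ sgn S g * cst 'i%C.
  by rewrite rmorphM rmorph_sign.
rewrite mulrA -rmorphM tw_basisC conj_if_i cs -mulrA rmorphM rmorph_sign rmorphM.
rewrite -!mulrA ext_gen_bas sum_mxrot_r -!mulrA.
rewrite [inE _ * (_ ^+ _ * _)]signrCA [_ * (_ ^+ hdeg S g * _)]signrCA.
rewrite [inE _ * (_ ^+ _ * _)]signrCA.
by rewrite [_ ^+ sgn S g * (_ ^+ sgn S g * _)]mulrA -signr_addb addbb mul1r.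
Qed.

Lemma ext_car : car ext_ann ext_cre.
Proof.
have nn i j : ext_neg i * ext_neg j = - (ext_gen S VV' (rshift d i) * ext_gen S VV' (rshift d j)).
  rewrite {1}/ext_neg ext_gen_cst -mulrA [inE _ * _]mulrA in_i2 mulN1r mulrN //.
apply: clifford_car => [i|i|i j ij|i j ij|i j].
- exact: ext_gen2.
- by rewrite nn ext_gen2.
- by apply: ext_gen_anti; rewrite (inj_eq (@lshift_inj _ _)).
- by rewrite !nn opprK ext_gen_anti ?opprK // (inj_eq (@rshift_inj _ _)).
rewrite /ext_neg /ext_pos mulrA -ext_gen_cst -!mulrA ext_gen_anti ?mulrN //.
by rewrite eq_lrshift.
Qed.

Lemma ext_ann_cst z i : inE (cst z) * ext_ann i = ext_ann i * inE (cst z).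
Proof.
by rewrite scalMl mulrDr ext_neg_cst /ext_pos ext_gen_cst -mulrDl mulrA.
Qed.
Lemma ext_cre_cst z i : inE (cst z) * ext_cre i = ext_cre i * inE (cst z).
Proof.
by rewrite scalMl mulrBr ext_neg_cst /ext_pos ext_gen_cst -mulrBl mulrA.
Qed.

Lemma ext_ann_bas g i : inE (bas g) * ext_ann i =
  (-1) ^+ hdeg S g * (mxrot (V g) ext_ann i * inE (bas g)).
Proof.
have -> : mxrot (V g) ext_ann i =
    scal 2^-1 * (mxrot (V g) ext_pos i + mxrot (V g) ext_neg i).
  rewrite /mxrot -big_split mulr_sumr; apply: eq_bigr => j _ /=.
  by rewrite -mulrDr scalMl.
rewrite scalMl mulrDr ext_neg_bas ext_pos_bas -mulrDr signrCA.
by rewrite -mulrDl -!mulrA.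
Qed.

Lemma ext_cre_bas g i : inE (bas g) * ext_cre i =
  (-1) ^+ hdeg S g * (mxrot (V g) ext_cre i * inE (bas g)).
Proof.
have -> : mxrot (V g) ext_cre i =
    scal 2^-1 * (mxrot (V g) ext_pos i - mxrot (V g) ext_neg i).
  rewrite /mxrot -sumrB mulr_sumr; apply: eq_bigr => j _ /=.
  by rewrite -mulrBr scalMl.
rewrite scalMl mulrBr ext_neg_bas ext_pos_bas -mulrBr signrCA.
by rewrite -mulrBl -!mulrA.
Qed.

End InExt.
End DoubledRep.

(** * Images of implementers under morphisms, and their degree *)

Section Naturality.
Variables (R : realType) (T U : ralgType R) (d : nat) (f : {rmorphism T -> U}).
Hypothesis fs : forall r, f (scal r) = scal r.

Lemma mxrot_rmorph (M : 'M[R]_d) (x : 'I_d -> T) i :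
  f (mxrot M x i) = mxrot M (f \o x) i.
Proof.
rewrite /mxrot rmorph_sum; apply: eq_bigr => j _.
by rewrite rmorphM fs.
Qed.

Lemma vacuum_rmorph (a b : 'I_d -> T) s :
  f (vacuum a b s) = vacuum (f \o a) (f \o b) s.
Proof. by elim: s => /= [|i s IH]; rewrite ?rmorph1 // !rmorphM IH. Qed.

Lemma implementer_rmorph (a b : 'I_d -> T) M :
  f (implementer a b M) = implementer (f \o a) (f \o b) M.
Proof.
rewrite /implementer -vacuum_rmorph; elim: (enum 'I_d) (vacuum _ _ _) => //=.
by move=> i s IH z; rewrite rmorphD !rmorphM IH mxrot_rmorph.
Qed.

Lemma annihilator_rmorph (E F : 'I_d -> T) i :
  f (annihilator E F i) = annihilator (f \o E) (f \o F) i.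
Proof. by rewrite rmorphM fs rmorphD. Qed.

Lemma creator_rmorph (E F : 'I_d -> T) i :
  f (creator E F i) = creator (f \o E) (f \o F) i.
Proof. by rewrite rmorphM fs rmorphB. Qed.
End Naturality.

Section HomogImplementers.
Variables (R : realType) (T : superAlgType R) (d : nat) (a b : 'I_d -> T).
Hypothesis ha : forall i, homog true (a i).
Hypothesis hb : forall i, homog true (b i).

Lemma homog_bigsum (I : finType) (F : I -> T) c :
  (forall i, homog c (F i)) -> homog c (\sum_i F i).
Proof.
move=> h; elim/big_ind: _ => // [|x y]; [exact: homog0|exact: homogD].
Qed.

Lemma implementer_homog M : homog false (implementer a b M).
Proof.
have hr i : homog true (mxrot M b i).
  by apply: homog_bigsum => j; apply: homogZ.
have hm (x y : T) c : homog c x -> homog c y -> homog false (x * y).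
  by move=> hx hy; rewrite -(addbb c); apply: homogM.
rewrite /implementer.
have hv s : homog false (vacuum a b s).
  elim: s => [|i s IH] /=; first exact: homog1.
  by apply: (hm _ _ false) => //; apply: (hm _ _ true).
elim: (enum 'I_d) (vacuum a b _) (hv (enum 'I_d)) => //= i s IH z hz.
apply: homogD; first exact: IH.
apply: (hm _ _ true) => //.
by have := homogM _ _ _ _ (hr i) (IH _ hz).
Qed.
End HomogImplementers.

Section TensorHomog.
Variables (R : realType) (A B : superAlgType R).
Lemma tensl_homog c (x : A) : homog c x -> homog c (tensl B x).
Proof. by move=> hx; apply: Gdeg_gen; exists (inl x). Qed.
Lemma tensr_homog c (y : B) : homog c y -> homog c (tensr A y).
Proof. by move=> hy; apply: Gdeg_gen; exists (inr y). Qed.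
End TensorHomog.

Lemma sign_flip (T : pzRingType) (x y : T) (c : bool) :
  x * y = (-1) ^+ c * (y * x) -> y * x = (-1) ^+ c * (x * y).
Proof. by move=> ->; rewrite mulrA -signr_addb addbb mul1r. Qed.

(** * The isomorphism of superalgebras *)

Section Iso.
Variables (R : realType) (G : finGroupType) (S : symmetry R G).
Variables (d : nat) (V : orth_rep R G d).
Local Notation A := (twisted_alg S).
Local Notation VV' := (sum_rep V (twist_rep S V)).
Local Notation cst := (tw_cst S).
Local Notation bas := (tw_basis S).
Local Notation inE := (ext_in VV').

(** Knowing the images of the annihilators and creators is what makes [implementer_rmorph] usable: a
    lift then carries implementers to implementers. *)
Lemma fock_lift_ann (T : ralgType R) (f : {rmorphism ext_alg S VV' -> T})
    (a b : 'I_d -> T) (ti : T) :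
  (forall r, f (scal r) = scal r) -> ti * ti = -1 ->
  f (ext_in VV' (tw_cst S 'i%C)) = ti ->
  (forall i, f (ext_gen S VV' (lshift d i)) = a i + b i) ->
  (forall i, f (ext_gen S VV' (rshift d i)) = - (ti * (a i - b i))) ->
  f \o ext_ann S V = a /\ f \o ext_cre S V = b.
Proof.
move=> fs ti2 fi fl fr.
have fn i : f (ext_neg S V i) = a i - b i.
  by rewrite (rmorphM f) fi fr mulrN mulrA ti2 mulN1r opprK.
split; apply: funext => i /=; rewrite ?(annihilator_rmorph fs) ?(creator_rmorph fs);
  rewrite /annihilator /creator /= fl fn.
  by rewrite addrACA subrr addr0 scal_half.
by rewrite opprD opprK addrACA subrr add0r scal_half.
Qed.

Section Untwist.
Local Notation E := (ext_alg S VV').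
Local Notation a := (ext_ann S V).
Local Notation b := (ext_cre S V).
Local Notation X g := (implementer a b (V g)).

Definition untwisted g : E := X g^-1%g * inE (bas g).

Lemma untwistedE g : untwisted g = X g^-1%g * inE (bas g). Proof. by []. Qed.

Let car_ab := ext_car S V.

Lemma untwisted_ann g i :
  untwisted g * a i = (-1) ^+ hdeg S g * (a i * untwisted g).
Proof.
rewrite /untwisted -mulrA ext_ann_bas signrCA; congr (_ * _).
rewrite [LHS]mulrA (implementer_rot _ _ (implementer_a car_ab (orep_trV _ _))).
by rewrite repM mulVg rep1 mxrot1 !mulrA.
Qed.

Lemma untwisted_cre g i :
  untwisted g * b i = (-1) ^+ hdeg S g * (b i * untwisted g).
Proof.
rewrite /untwisted -mulrA ext_cre_bas signrCA; congr (_ * _).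
rewrite [LHS]mulrA (implementer_rot _ _ (implementer_b car_ab _)).
by rewrite repM mulVg rep1 mxrot1 !mulrA.
Qed.

Lemma ext_implementer_cst M z :
  inE (cst z) * implementer a b M = implementer a b M * inE (cst z).
Proof.
apply: (@implementer_comm _ _ _ _ _ _ _ false) => i; rewrite mul1r.
  exact: ext_ann_cst.
exact: ext_cre_cst.
Qed.

Lemma untwisted_cst g z :
  untwisted g * inE (cst z) = inE (cst (conj_if (sgn S g) z)) * untwisted g.
Proof.
rewrite /untwisted -mulrA -rmorphM tw_basisC rmorphM mulrA.
by rewrite -ext_implementer_cst mulrA.
Qed.

(** [X k^-1] is even in modes with which [untwisted g] supercommutes, so it moves to the front.
    There X_(k^-1) X_(g^-1) = X_((gk)^-1), in the right order because inversion reverses products,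
    and the basis elements contribute [omega S g k]. *)
Lemma untwistedM g k :
  untwisted g * untwisted k = inE (cst (omega S g k)) * untwisted (g * k)%g.
Proof.
rewrite {2}/untwisted mulrA.
have -> : untwisted g * X k^-1%g = X k^-1%g * untwisted g.
  apply: (@implementer_comm _ _ _ _ _ _ _ (hdeg S g)).
    exact: untwisted_ann.
  exact: untwisted_cre.
rewrite /untwisted !mulrA (implementerM car_ab) repM -invMg -[LHS]mulrA.
by rewrite -rmorphM tw_basisM rmorphM ext_implementer_cst mulrA.
Qed.

Lemma untwisted1 : untwisted 1%g = 1.
Proof. by rewrite /untwisted invg1 rep1 (implementer1 car_ab) tw_basis1 rmorph1 mulr1. Qed.

Lemma ext_pos_homog i : homog true (ext_pos S V i).
Proof. exact: ext_gen_homog. Qed.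
Lemma ext_neg_homog i : homog true (ext_neg S V i).
Proof.
have := homogM _ _ _ _ (ext_in_homog VV' (@homog_cst R G S 'i%C)) (ext_gen_homog S VV' (rshift d i)).
exact.
Qed.
Lemma ext_ann_homog i : homog true (a i).
Proof. by apply/homogZ/homogD; [exact: ext_pos_homog|exact: ext_neg_homog]. Qed.
Lemma ext_cre_homog i : homog true (b i).
Proof. by apply/homogZ/homogD; [exact: ext_pos_homog|apply/homogN/ext_neg_homog]. Qed.

Lemma untwisted_homog g : homog (hdeg S g) (untwisted g).
Proof.
rewrite -[hdeg S g]addFb; apply: homogM.
  by apply: implementer_homog; [exact: ext_ann_homog|exact: ext_cre_homog].
exact/ext_in_homog/homog_basis.
Qed.

Lemma untwisted_pos g i :
  untwisted g * ext_pos S V i = (-1) ^+ hdeg S g * (ext_pos S V i * untwisted g).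
Proof.
rewrite -(annihilatorDcreator (ext_pos S V) (ext_neg S V)) mulrDr.
by rewrite untwisted_ann untwisted_cre -mulrDr -mulrDl.
Qed.
Lemma untwisted_neg g i :
  untwisted g * ext_neg S V i = (-1) ^+ hdeg S g * (ext_neg S V i * untwisted g).
Proof.
rewrite -(annihilatorBcreator (ext_pos S V) (ext_neg S V)) mulrBr.
by rewrite untwisted_ann untwisted_cre -mulrBr -mulrBl.
Qed.
End Untwist.

Lemma doubled_lift (T : superAlgType R) (tau : {rmorphism A -> T}) (E F : 'I_d -> T) :
  (forall r, tau (scal r) = scal r) ->
  (forall c x, homog c x -> homog c (tau x)) ->
  (forall i, homog true (E i)) -> (forall i, homog true (F i)) ->
  (forall i, E i * E i = 1) -> (forall i, F i * F i = -1) ->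
  (forall i j, i != j -> E i * E j = - (E j * E i)) ->
  (forall i j, i != j -> F i * F j = - (F j * F i)) ->
  (forall i j, E i * F j = - (F j * E i)) ->
  (forall c x i, homog c x -> tau x * E i = (-1) ^+ c * (E i * tau x)) ->
  (forall c x i, homog c x -> tau x * F i = (-1) ^+ c * (F i * tau x)) ->
  exists f : {rmorphism ext_alg S VV' -> T},
  [/\ forall r, f (scal r) = scal r,
      forall i, f (ext_pos S V i) = E i, forall i, f (ext_neg S V i) = F i,
      (forall z, f (inE (cst z)) = tau (cst z)) /\
      (forall g, f (untwisted g) = tau (bas g)) &
      forall c y, homog c y -> homog c (f y)].
Proof.
move=> taus htau hE hF E2 F2E EE FF EF tE tF.
pose a := annihilator E F; pose b := creator E F.
have ab : car a b by apply: clifford_car.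
have ta c (x : A) i : homog c x -> tau x * a i = (-1) ^+ c * (a i * tau x).
  move=> hx; rewrite scalMl mulrDr (tE c) // (tF c) // -mulrDr signrCA -mulrDl.
  by congr (_ * _); rewrite mulrA.
have tb c (x : A) i : homog c x -> tau x * b i = (-1) ^+ c * (b i * tau x).
  move=> hx; rewrite scalMl mulrBr (tE c) // (tF c) // -mulrBr signrCA -mulrBl.
  by congr (_ * _); rewrite mulrA.
have [||||||f [fs finE [fc fb] fl fr]] := @fock_lift _ _ S _ V T tau a b.
- exact: taus.
- exact: ab.
- by move=> z i; rewrite (ta false) ?mul1r //; apply: homog_cst.
- by move=> z i; rewrite (tb false) ?mul1r //; apply: homog_cst.
- by move=> g i; apply/ta/homog_basis.
- by move=> g i; apply/tb/homog_basis.
have fp i : f (ext_pos S V i) = E i by rewrite fl annihilatorDcreator.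
have fn i : f (ext_neg S V i) = F i.
  rewrite rmorphM fr fc annihilatorBcreator mulrN mulrA -rmorphM -rmorphM i_mul_i.
  by rewrite !rmorphN !rmorph1 mulN1r opprK.
have ti2 : tau (cst 'i%C) * tau (cst 'i%C) = -1.
  by rewrite -!rmorphM i_mul_i !rmorphN !rmorph1.
have [fa fbE] := fock_lift_ann fs ti2 (fc _) fl fr.
exists f; split=> //.
  (* The lift sends g to x_g tau(g), and the factor x_(g^-1) in [untwisted g] cancels x_g. *)
  split=> // g; rewrite untwistedE (rmorphM f _ (inE (bas g))).
  rewrite implementer_rmorph // fa fbE fb mulrA.
  by rewrite (implementerM ab) repM mulVg rep1 implementer1 // mul1r.
apply: presented_hom_homog => // c [x /= hx|i /= ->].
  rewrite [f _]finE; apply: homog_bigsum => g.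
  have [->|xg] := eqVneq (x g) 0; first by rewrite !rmorph0 mul0r; apply: homog0.
  rewrite -(hx g xg) -[hdeg S g]addFb; apply: homogM.
    exact/htau/homog_cst.
  rewrite -[hdeg S g]addFb; apply: homogM.
    apply: implementer_homog => i; apply/homogZ/homogD => //.
    exact/homogN/hF.
  exact/htau/homog_basis.
case: (split_ordP i) => k ->; first by rewrite [f _]fp.
rewrite [f _]fr annihilatorBcreator; apply: homogN.
rewrite -[true]addFb; apply: homogM => //.
exact/htau/homog_cst.
Qed.

Local Notation C1 := (clifford R d 0).
Local Notation C2 := (clifford R 0 d).
Local Notation CC := (super_tensor C1 C2).
Local Notation T := (super_tensor CC A).
Local Notation F1 i := (@clifford_gen R d 0 (inl i)).
Local Notation F2 i := (@clifford_gen R 0 d (inr i)).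

Lemma ext_alg_to_tensor : exists f : {rmorphism ext_alg S VV' -> T},
  [/\ forall r, f (scal r) = scal r,
      forall i, f (ext_pos S V i) = tensl A (tensr C1 (F2 i)),
      forall i, f (ext_neg S V i) = tensl A (tensl C2 (F1 i)),
      (forall z, f (inE (cst z)) = tensr CC (cst z)) /\
      (forall g, f (untwisted g) = tensr CC (bas g)) &
      forall c y, homog c y -> homog c (f y)].
Proof.
pose E i : T := tensl A (tensr C1 (F2 i)).
pose F i : T := tensl A (tensl C2 (F1 i)).
have h1 i : homog true (F1 i) by apply: Gdeg_gen; exists (inl i).
have h2 i : homog true (F2 i) by apply: Gdeg_gen; exists (inr i).
have h1' i : homog true (tensl C2 (F1 i)) by apply: tensl_homog.
have h2' i : homog true (tensr C1 (F2 i)) by apply: tensr_homog.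
have hE i : homog true (E i) by apply: tensl_homog.
have hF i : homog true (F i) by apply: tensl_homog.
have E2 i : E i * E i = 1.
  have e : F2 i * F2 i = 1.
    by have := gen_rel (clifford_pos R 0 i); rewrite /= scal1.
  by rewrite /E -!rmorphM e !rmorph1.
have F2E i : F i * F i = -1.
  have e : F1 i * F1 i = -1.
    by have := gen_rel (clifford_neg R 0 i); rewrite /= scalN scal1.
  by rewrite /F -!rmorphM e !rmorphN !rmorph1.
have EE i j : i != j -> E i * E j = - (E j * E i).
  move=> ij; have ij' : inr i != inr j :> ('I_0 + 'I_d)%type by [].
  have e : F2 i * F2 j = - (F2 j * F2 i).
    by have := gen_rel (clifford_anti R ij'); rewrite /= scalN scal1 mulN1r.
  by rewrite /E -!rmorphM e !rmorphN.
have FF i j : i != j -> F i * F j = - (F j * F i).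
  move=> ij; have ij' : inl i != inl j :> ('I_d + 'I_0)%type by [].
  have e : F1 i * F1 j = - (F1 j * F1 i).
    by have := gen_rel (clifford_anti R ij'); rewrite /= scalN scal1 mulN1r.
  by rewrite /F -!rmorphM e !rmorphN.
have EF i j : E i * F j = - (F j * E i).
  rewrite /E /F -!rmorphM (tens_comm (h1 j) (h2 i)) /= scalN scal1 mulN1r.
  by rewrite rmorphN.
have tE c (x : A) i : homog c x -> tensr CC x * E i = (-1) ^+ c * (E i * tensr CC x).
  by move=> hx; rewrite (tens_comm (h2' i) hx) scal_sign.
have tF c (x : A) i : homog c x -> tensr CC x * F i = (-1) ^+ c * (F i * tensr CC x).
  by move=> hx; rewrite (tens_comm (h1' i) hx) scal_sign.
exact: (@doubled_lift T (@tensr R CC A) E F (@tensr_scal R CC A)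
  (@tensr_homog R CC A) hE hF E2 F2E EE FF EF tE tF).
Qed.

Lemma tensor_to_ext_alg : exists f : {rmorphism T -> ext_alg S VV'},
  [/\ forall r, f (scal r) = scal r,
      forall i, f (tensl A (tensr C1 (F2 i))) = ext_pos S V i,
      forall i, f (tensl A (tensl C2 (F1 i))) = ext_neg S V i,
      (forall z, f (tensr CC (cst z)) = inE (cst z)) /\
      (forall g, f (tensr CC (bas g)) = untwisted g) &
      forall c y, homog c y -> homog c (f y)].
Proof.
have [car1 car2 carE carF carEF] := car_clifford (ext_car S V).
pose EE i := annihilatorDcreator (ext_pos S V) (ext_neg S V) i.
pose FF i := annihilatorBcreator (ext_pos S V) (ext_neg S V) i.
have [|[]|x y|f1 [f1s f1g]] := @clifford_lift R d 0 (ext_alg S VV')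
  (fun x => match x with inl i => ext_neg S V i | inr _ => 0 end) => //.
- by move=> i; rewrite -FF; apply: car2.
- by case: x y => [i|[]//] [j|[]//] ij; rewrite -!FF; apply: carF.
have [[]||x y|f2 [f2s f2g]] := @clifford_lift R 0 d (ext_alg S VV')
  (fun x => match x with inl _ => 0 | inr i => ext_pos S V i end) => //.
- by move=> i; rewrite -EE; apply: car1.
- by case: x y => [[]//|i] [[]//|j] ij; rewrite -!EE; apply: carE.
have [|f12 [f12s f12l f12r]] := super_tensor_lift f1s f2s.
  (* The sign rule is reduced to generators of the second factor and, after exchanging the two
     sides, to generators of the first. *)
  move=> b c x y hx hy; apply: sign_flip; apply: (presented_supercomm _ _ hy) => //.
  move=> _ [[]//|i] ->; rewrite andbT [f2 _]f2g; apply: sign_flip.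
  rewrite -[b]/(true && b).
  apply: (presented_supercomm _ _ hx) => // _ [j|[]//] -> /=.
  by rewrite [f1 _]f1g expr1 mulN1r -EE -FF; apply: carEF.
have [||||f3 [f3E f3s f3c f3b]] := @twisted_lift R G S (ext_alg S VV')
    (ext_in VV' \o cst) untwisted.
- by move=> r; rewrite /= -tw_scalE ext_in_scal.
- exact: untwisted_cst.
- exact: untwistedM.
- exact: untwisted1.
have f3neg c x i : homog c x -> f3 x * ext_neg S V i = (-1) ^+ c * (ext_neg S V i * f3 x).
  move=> hx; rewrite f3E mulr_suml mulr_sumr mulr_sumr; apply: eq_bigr => g _.
  have [->|/hx <-] := eqVneq (x g) 0; first by rewrite !rmorph0 !(mul0r, mulr0).
  rewrite -mulrA untwisted_neg signrCA; congr (_ * _).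
  by rewrite [LHS]mulrA [RHS]mulrA /= ext_neg_cst.
have f3pos c x i : homog c x -> f3 x * ext_pos S V i = (-1) ^+ c * (ext_pos S V i * f3 x).
  move=> hx; rewrite f3E mulr_suml mulr_sumr mulr_sumr; apply: eq_bigr => g _.
  have [->|/hx <-] := eqVneq (x g) 0; first by rewrite !rmorph0 !(mul0r, mulr0).
  rewrite -mulrA untwisted_pos signrCA; congr (_ * _).
  by rewrite [LHS]mulrA [RHS]mulrA /= ext_gen_cst.
have [|f [fs fl fr]] := super_tensor_lift f12s f3s.
  move=> b c x y hx hy; rewrite andbC.
  apply: (presented_supercomm _ _ hx) => // {hx x}b' [x|x] /= hx.
    rewrite [f12 _]f12l; apply: (presented_supercomm _ _ hx) => // _ [i|[]//] ->.
    by rewrite andbT [f1 _]f1g; apply: f3neg.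
  rewrite [f12 _]f12r; apply: (presented_supercomm _ _ hx) => // _ [[]//|i] ->.
  by rewrite andbT [f2 _]f2g; apply: f3pos.
exists f; split=> [//|i|i||].
- by rewrite fl f12r f2g.
- by rewrite fl f12l f1g.
- by split=> [z|g]; rewrite fr ?f3c ?f3b.
apply: presented_hom_homog => // c [x|x] /= hx.
  rewrite [f _]fl; apply: (presented_hom_homog _ _ hx) => // {hx x}c [x|x] /= hx.
    rewrite [f12 _]f12l; apply: (presented_hom_homog _ _ hx) => // _ [i|[]//] ->.
    by rewrite [f1 _]f1g; apply: ext_neg_homog.
  rewrite [f12 _]f12r; apply: (presented_hom_homog _ _ hx) => // _ [[]//|i] ->.
  by rewrite [f2 _]f2g; apply: ext_pos_homog.
rewrite [f _]fr f3E; apply: homog_bigsum => g.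
have [->|/hx <-] := eqVneq (x g) 0; first by rewrite rmorph0 mul0r; apply: homog0.
rewrite -[hdeg S g]addFb; apply: homogM; last exact: untwisted_homog.
exact/ext_in_homog/homog_cst.
Qed.

Theorem ext_alg_doubled : super_isomorphic (ext_alg S VV') T.
Proof.
have [f [fs fp fn [fc fb] fh]] := ext_alg_to_tensor.
have [k [ks kp kn [kc kb] kh]] := tensor_to_ext_alg.
have kf : cancel f k.
  have kfn i : k (f (ext_neg S V i)) = ext_neg S V i by rewrite fn kn.
  apply: (@ext_hom_eq _ _ _ _ _ _ (k \o f) idfun) => [x|i] /=.
    move: x; refine (@twisted_hom_eq R G S _ (k \o f \o inE) inE _ _)
      => [z|g] /=; first by rewrite fc kc.
    have car_ab := ext_car S V.
    (* The image of g is not given directly. It follows from g = x_g (x_g^-1 g), since morphisms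
       respect implementers and the image of [untwisted g] is known. *)
    have -> : inE (bas g) = implementer (ext_ann S V) (ext_cre S V) (V g) * untwisted g.
      by rewrite mulrA (implementerM car_ab) repM mulgV rep1 implementer1 // mul1r.
    rewrite (rmorphM f _ (untwisted g)) fb (rmorphM k _ (tensr _ _)) kb.
    rewrite (implementer_rmorph fs) (implementer_rmorph ks).
    congr (implementer _ _ _ * _); apply: funext => i /=.
      rewrite (annihilator_rmorph fs) (annihilator_rmorph ks).
      by rewrite /annihilator /= fp kp kfn.
    rewrite (creator_rmorph fs) (creator_rmorph ks).
    by rewrite /creator /= fp kp kfn.
  case: (split_ordP i) => j ->; first by rewrite [f _]fp kp.
  have -> : ext_gen S VV' (rshift d j) = - (inE (cst 'i%C) * ext_neg S V j).
    by rewrite /ext_neg mulrA in_i2 mulN1r opprK.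
  by rewrite (rmorphN f) (rmorphN k) (rmorphM f) (rmorphM k) kfn fc kc.
have fk : cancel k f.
  refine (@super_tensor_hom_eq R CC A T (f \o k) idfun _ _) => x /=.
    move: x.
    refine (@super_tensor_hom_eq R C1 C2 T (f \o k \o tensl A) (tensl A) _ _).
      apply: (@clifford_hom_eq _ _ _ _ (f \o k \o tensl A \o tensl C2)
        (tensl A \o tensl C2)) => [r|[i|[]//]] /=.
        by rewrite !tensl_scal ks fs.
      by rewrite kn fn.
    apply: (@clifford_hom_eq _ _ _ _ (f \o k \o tensl A \o @tensr R C1 C2)
      (tensl A \o @tensr R C1 C2)) => [r|[[]//|i]] /=.
      by rewrite tensr_scal tensl_scal ks fs.
    by rewrite kp fp.
  move: x; refine (@twisted_hom_eq R G S T (f \o k \o @tensr R CC A)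
    (@tensr R CC A) _ _) => [z|g] /=; first by rewrite kc fc.
  by rewrite kb fb.
exists f; split=> //; first by exists k.
by move=> c x; split=> [/fh //|/kh]; rewrite kf.
Qed.
End Iso.

(** * Vacuum modules *)

Section LinearEndomorphisms.
Variables (R : realType) (B : ralgType R) (E : lmodType B).

(** Only real linearity is required: the action of [B] and the operators in K are not [B]-linear in
    general, and the ring must contain both for the identities about [car] to apply to them. *)
Record lend := Lend {
  lfun :> E -> E;
  lfunD : forall u v, lfun (u + v) = lfun u + lfun v;
  lfunZ : forall (r : R) u, lfun ((scal r : B) *: u) = (scal r : B) *: lfun u
}.

HB.instance Definition _ := gen_eqMixin lend.
HB.instance Definition _ := gen_choiceMixin lend.

Lemma lendP (f g : lend) : f =1 g -> f = g.
Proof.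
case: f g => [f ? ?] [g ? ?] /= e; have {}e : f = g by apply: funext.
by subst g; congr Lend; apply: Prop_irrelevance.
Qed.

Lemma scal_scalerCA (r : R) (b : B) (u : E) :
  b *: ((scal r : B) *: u) = (scal r : B) *: (b *: u).
Proof. by rewrite !scalerA scalC. Qed.

Fact lend0D (u v : E) : 0 = 0 + 0 :> E. Proof. by rewrite addr0. Qed.
Fact lend0Z (r : R) (u : E) : 0 = (scal r : B) *: 0 :> E.
Proof. by rewrite scaler0. Qed.
Definition lend0 : lend := Lend lend0D lend0Z.

Fact lendND (f : lend) u v : - f (u + v) = - f u - f v.
Proof. by rewrite lfunD opprD. Qed.
Fact lendNZ (f : lend) (r : R) u : - f ((scal r : B) *: u) = (scal r : B) *: - f u.
Proof. by rewrite lfunZ scalerN. Qed.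
Definition lendN (f : lend) : lend := Lend (lendND f) (lendNZ f).

Fact lendDD (f g : lend) u v : f (u + v) + g (u + v) = f u + g u + (f v + g v).
Proof. by rewrite !lfunD addrACA. Qed.
Fact lendDZ (f g : lend) (r : R) u :
  f ((scal r : B) *: u) + g ((scal r : B) *: u) = (scal r : B) *: (f u + g u).
Proof. by rewrite !lfunZ scalerDr. Qed.
Definition lendD (f g : lend) : lend := Lend (lendDD f g) (lendDZ f g).

Definition lend1 : lend := @Lend id (fun _ _ => erefl) (fun _ _ => erefl).

Fact lendMD (f g : lend) u v : (f \o g) (u + v) = (f \o g) u + (f \o g) v.
Proof. by rewrite /= !lfunD. Qed.
Fact lendMZ (f g : lend) (r : R) u :
  (f \o g) ((scal r : B) *: u) = (scal r : B) *: (f \o g) u.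
Proof. by rewrite /= !lfunZ. Qed.
Definition lendM (f g : lend) : lend := Lend (lendMD f g) (lendMZ f g).

Let addA : associative lendD.
Proof. by move=> f g h; apply: lendP => u /=; rewrite addrA. Qed.
Let addC : commutative lendD.
Proof. by move=> f g; apply: lendP => u /=; rewrite addrC. Qed.
Let add0 : left_id lend0 lendD.
Proof. by move=> f; apply: lendP => u /=; rewrite add0r. Qed.
Let addN : left_inverse lend0 lendN lendD.
Proof. by move=> f; apply: lendP => u /=; rewrite addNr. Qed.
Let mulA : associative lendM.
Proof. by move=> f g h; apply: lendP. Qed.
Let mul1 : left_id lend1 lendM.
Proof. by move=> f; apply: lendP. Qed.
Let mul1' : right_id lend1 lendM.
Proof. by move=> f; apply: lendP. Qed.
Let mulDl : left_distributive lendM lendD.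
Proof. by move=> f g h; apply: lendP. Qed.
Let mulDr : right_distributive lendM lendD.
Proof. by move=> f g h; apply: lendP => u /=; rewrite lfunD. Qed.

HB.instance Definition _ := GRing.isPzRing.Build lend
  addA addC add0 addN mulA mul1 mul1' mulDl mulDr.

Definition lact (b : B) : lend := Lend (scalerDr b) (fun r => scal_scalerCA r b).

Lemma lact_zmod : zmod_morphism lact.
Proof. by move=> b c; apply: lendP => u /=; rewrite scalerBl. Qed.
Lemma lact_monoid : monoid_morphism lact.
Proof.
split=> [|b c]; apply: lendP => u /=; first by rewrite scale1r.
by rewrite scalerA.
Qed.
HB.instance Definition _ := GRing.isZmodMorphism.Build B lend lact lact_zmod.
HB.instance Definition _ := GRing.isMonoidMorphism.Build B lend lact lact_monoid.

Let lscal (r : R) : lend := lact (scal r).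
Let lscal_zmod : zmod_morphism lscal.
Proof. by move=> r s; rewrite /lscal !rmorphB. Qed.
Let lscal_monoid : monoid_morphism lscal.
Proof. by split=> [|r s]; rewrite /lscal ?rmorph1 ?rmorphM. Qed.
Let lscalC r f : lscal r * f = f * lscal r.
Proof. by apply: lendP => u /=; rewrite lfunZ. Qed.
HB.instance Definition _ := isRAlgebra.Build R lend lscal_zmod lscal_monoid lscalC.

Lemma lact_scal r : lact (scal r) = scal r. Proof. by []. Qed.

Lemma lendDE (f g : lend) u : (f + g) u = f u + g u. Proof. by []. Qed.
Lemma lendME (f g : lend) u : (f * g) u = f (g u). Proof. by []. Qed.
Lemma lendNE (f : lend) u : (- f) u = - f u. Proof. by []. Qed.

Lemma lact_comm (f : lend) b : f * lact b = lact b * f ->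
  forall u, f (b *: u) = b *: f u.
Proof. by move=> /(congr1 lfun) e u; have := congr1 (@^~ u) e. Qed.

Lemma lfun0 (f : lend) : f 0 = 0.
Proof. by have := lfunZ f 0 0; rewrite scal0 !scale0r. Qed.
Lemma lfunN (f : lend) u : f (- u) = - f u.
Proof. by apply/eqP; rewrite -addr_eq0 -lfunD addNr lfun0. Qed.

End LinearEndomorphisms.

(** * The algebras over which the universes are formed: generators and morphisms *)

Section BalgTheory.
Variables (R : realType) (G : finGroupType) (S : symmetry R G).

Lemma Balg_ind q (W : orth_rep R G q) (P : Balg S W -> Prop) :
  P (B_eps S W) -> (forall z, P (B_in W (tw_cst S z))) ->
  (forall g, P (B_in W (tw_basis S g))) -> (forall i, P (B_gen S W i)) ->
  (forall x y, P x -> P y -> P (x + y)) ->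
  (forall x y, P x -> P y -> P (x * y)) -> forall x, P x.
Proof.
move=> Pe Pc Pb Pg PD PM.
have Ps r : P (scal r) by rewrite -(B_in_scal S W r) tw_scalE; apply: Pc.
have Pin a : P (B_in W a).
  rewrite (tw_decomp a) /B_in !rmorph_sum; elim/big_ind: _ => [|x y|g _].
  - by rewrite -(scal0 (Balg S W)); apply: Ps.
  - exact: PD.
  by rewrite 2!rmorphM; apply: PM; [apply: Pc|apply: Pb].
elim/presented_ind => [[x|y]|r||] //.
  elim/presented_ind: x => [[[]//|i]|r|x y hx hy|x y hx hy].
  - by rewrite (ord1 i); apply: Pe.
  - by have := Ps r; rewrite -(tensl_scal (clifford R 0 1) (ext_alg S W)).
  - have := PD _ _ hx hy; rewrite -!/(tensl _ _) -rmorphD; exact.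
  have := PM _ _ hx hy; rewrite -!/(tensl _ _) -rmorphM; exact.
elim/presented_ind: y => [[a|i]|r|x y hx hy|x y hx hy].
- exact: Pin.
- exact: Pg.
- by have := Ps r; rewrite -(tensr_scal (clifford R 0 1) (ext_alg S W)).
- have := PD _ _ hx hy; rewrite -!/(tensr _ _) -rmorphD; exact.
have := PM _ _ hx hy; rewrite -!/(tensr _ _) -rmorphM; exact.
Qed.

Lemma clifford_gen_homog p q x : homog true (@clifford_gen R p q x).
Proof. by apply: Gdeg_gen; exists x. Qed.

Lemma B_eps2 q (W : orth_rep R G q) : B_eps S W * B_eps S W = 1.
Proof.
have e : @clifford_gen R 0 1 (inr ord0) * clifford_gen R (inr ord0) = 1.
  by have := gen_rel (clifford_pos R 0 (ord0 : 'I_1)); rewrite /= scal1.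
by rewrite /B_eps -rmorphM e rmorph1.
Qed.

Lemma B_eps_comm q (W : orth_rep R G q) c y : homog c y ->
  B_eps S W * tensr (clifford R 0 1) y =
  (-1) ^+ c * (tensr (clifford R 0 1) y * B_eps S W).
Proof.
move=> hy; apply: sign_flip.
by rewrite (tens_comm (clifford_gen_homog _) hy) scal_sign.
Qed.

Lemma balg_lift q (W : orth_rep R G q) (T : ralgType R) (eps : T)
    (f : {rmorphism ext_alg S W -> T}) :
  eps * eps = 1 -> (forall r, f (scal r) = scal r) ->
  (forall c a, homog c a -> eps * f (ext_in W a) = (-1) ^+ c * (f (ext_in W a) * eps)) ->
  (forall i, eps * f (ext_gen S W i) = - (f (ext_gen S W i) * eps)) ->
  exists F : {rmorphism Balg S W -> T},
    [/\ forall r, F (scal r) = scal r, F (B_eps S W) = eps &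
        forall y, F (tensr (clifford R 0 1) y) = f y].
Proof.
move=> eps2 fs fa fg.
have [[]//|//|x y|f1 [f1s f1g]] := @clifford_lift R 0 1 T
  (fun x => match x with inl _ => 0 | inr _ => eps end).
  by case: x y => [[]//|i] [[]//|j]; rewrite (ord1 i) (ord1 j) eqxx.
have [|F [Fs Fl Fr]] := super_tensor_lift f1s fs.
  move=> b c x y hx hy; apply: sign_flip; apply: (presented_supercomm _ _ hy) => //.
  move=> {hy y}c y hy; apply: sign_flip; rewrite andbC.
  apply: (presented_supercomm _ _ hx) => // {hx x b}b x ->.
  rewrite [f1 _]f1g; case: x => [[]//|i]; rewrite andbT.
  apply: sign_flip; case: y hy => [a|j] /= hy; first exact: fa.
  by rewrite hy expr1 mulN1r; apply: fg.
by exists F; split=> //; rewrite Fl f1g.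
Qed.

End BalgTheory.

Section DoubledBalg.
Variables (R : realType) (G : finGroupType) (S : symmetry R G).
Variables (d : nat) (V : orth_rep R G d).
Local Notation VV' := (sum_rep V (twist_rep S V)).
Local Notation W0 := (zero_rep R G).
Local Notation B := (Balg S VV').
Local Notation B0 := (Balg S W0).
Local Notation C1 := (clifford R 0 1).
Local Notation eps := (B_eps S VV').
Local Notation cst z := (B_in VV' (tw_cst S z)).
Local Notation bas g := (B_in VV' (tw_basis S g)).

Definition Bann i : B := tensr C1 (ext_ann S V i).
Definition Bcre i : B := tensr C1 (ext_cre S V i).

Lemma Bcar : car Bann Bcre.
Proof. exact: (car_rmorph (@tensr R C1 _) (ext_car S V)). Qed.

Lemma Beps_ann i : eps * Bann i = - (Bann i * eps).
Proof. by rewrite (B_eps_comm (ext_ann_homog S V i)) mulN1r. Qed.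
Lemma Beps_cre i : eps * Bcre i = - (Bcre i * eps).
Proof. by rewrite (B_eps_comm (ext_cre_homog S V i)) mulN1r. Qed.
Lemma Bcst_ann z i : cst z * Bann i = Bann i * cst z.
Proof. by rewrite -[LHS]rmorphM ext_ann_cst rmorphM. Qed.
Lemma Bcst_cre z i : cst z * Bcre i = Bcre i * cst z.
Proof. by rewrite -[LHS]rmorphM ext_cre_cst rmorphM. Qed.
Lemma Bbas_ann g i :
  bas g * Bann i = (-1) ^+ hdeg S g * (mxrot (V g) Bann i * bas g).
Proof.
rewrite -[LHS]rmorphM ext_ann_bas rmorphM rmorph_sign rmorphM.
by rewrite (mxrot_rmorph (@tensr_scal R C1 _)).
Qed.
Lemma Bbas_cre g i :
  bas g * Bcre i = (-1) ^+ hdeg S g * (mxrot (V g) Bcre i * bas g).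
Proof.
rewrite -[LHS]rmorphM ext_cre_bas rmorphM rmorph_sign rmorphM.
by rewrite (mxrot_rmorph (@tensr_scal R C1 _)).
Qed.

Definition Bvac : B := vacuum Bann Bcre (enum 'I_d).

Lemma Bvac_eps : Bvac * eps = eps * Bvac.
Proof.
apply/esym/(@vacuum_comm _ _ _ _ _ _ true) => i _; rewrite mulN1r.
  exact: Beps_ann.
exact: Beps_cre.
Qed.

Lemma Bvac_cst z : Bvac * cst z = cst z * Bvac.
Proof.
apply/esym/(@vacuum_comm _ _ _ _ _ _ false) => i _; rewrite mul1r.
  exact: Bcst_ann.
exact: Bcst_cre.
Qed.

(* [bas g * Bvac] is killed by the annihilators on the left and [Bvac * bas g] by
   the creators on the right, so both are equal to [Bvac * bas g * Bvac]. *)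
Lemma Bvac_bas g : Bvac * bas g = bas g * Bvac.
Proof.
have <- : Bvac * (bas g * Bvac) = bas g * Bvac.
  apply: (vac_mull Bcar) => i.
  rewrite -[Bann i](mxrot1 Bann) -(orep_orth V g) mxrotM mulrA.
  have e j : mxrot (V g) Bann j * bas g = (-1) ^+ hdeg S g * (bas g * Bann j).
    by rewrite Bbas_ann mulrA -signr_addb addbb mul1r.
  rewrite {1}/mxrot !mulr_suml big1 // => j _.
  by rewrite -!mulrA [X in _ * X]mulrA e -!mulrA (a_vac Bcar) !mulr0.
rewrite mulrA; apply/esym/(vac_mulr Bcar) => i.
have e : Bvac * mxrot (V g) Bcre i = 0 by apply/mxrot_annih/vac_b/Bcar.
by rewrite -mulrA Bbas_cre signrCA [Bvac * _]mulrA e mul0r mulr0.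
Qed.

(** Group elements go to g, and not to x_g^-1 g. On vacuum vectors both act alike because x_M fixes
    the vacuum, and with this choice the actions of G on the two classifying spaces correspond
    without further argument. *)
Lemma balg_incl_exists : exists f : {rmorphism B0 -> B},
  [/\ forall r, f (scal r) = scal r, f (B_eps S W0) = eps &
      forall a, f (B_in W0 a) = B_in VV' a].
Proof.
have [|[]|[]|[]|? []|f [fs fa _]] := @ext_lift R G S (ext_alg S VV') 0 W0
  (ext_in VV') (fun _ => 0) => //.
  exact: ext_in_scal.
have [||||F [Fs Fe Fr]] := @balg_lift R G S 0 W0 B eps (@tensr R C1 _ \o f).
- exact: B_eps2.
- by move=> r; rewrite /= fs tensr_scal.
- by move=> c a ha; rewrite /= fa; apply/B_eps_comm/ext_in_homog.
- by case.
by exists F; split=> // a; rewrite Fr /= fa.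
Qed.

Definition balg_incl : {rmorphism B0 -> B} := sval (cid balg_incl_exists).
Local Notation iota := balg_incl.

Lemma balg_incl_scal r : iota (scal r) = scal r.
Proof. by rewrite /balg_incl; case: cid => f []. Qed.
Lemma balg_incl_eps : iota (B_eps S W0) = eps.
Proof. by rewrite /balg_incl; case: cid => f []. Qed.
Lemma balg_incl_in a : iota (B_in W0 a) = B_in VV' a.
Proof. by rewrite /balg_incl; case: cid => f []. Qed.

Lemma Bvac_incl x : Bvac * iota x = iota x * Bvac.
Proof.
elim/Balg_ind: x => [|z|g|[]//|x y hx hy|x y hx hy].
- by rewrite balg_incl_eps Bvac_eps.
- by rewrite balg_incl_in Bvac_cst.
- by rewrite balg_incl_in Bvac_bas.
- by rewrite rmorphD mulrDr mulrDl hx hy.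
by rewrite rmorphM mulrA hx -!mulrA hy.
Qed.

Section VacuumModule.
Variable E : lmodType B.
Implicit Types (u v : E).

Definition is_vac u : Prop := forall i, Bann i *: u = 0.

Lemma is_vacP u : is_vac u <-> Bvac *: u = u.
Proof.
split=> h.
  have e (s : seq 'I_d) (x : B) : dress Bann Bcre s x *: u = x *: u.
    elim: s => //= i s IH; rewrite scalerDl IH -[X in _ + X]scalerA h scaler0.
    by rewrite addr0.
  by rewrite -(e (enum 'I_d)) (dress_vac Bcar) scale1r.
by move=> i; rewrite -h scalerA (a_vac Bcar) scale0r.
Qed.

Lemma is_vac_Bvac u : is_vac (Bvac *: u).
Proof. by apply/is_vacP; rewrite scalerA (vacK Bcar). Qed.

Lemma is_vac0 : is_vac 0. Proof. by move=> i; rewrite scaler0. Qed.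
Lemma is_vacN u : is_vac u -> is_vac (- u).
Proof. by move=> h i; rewrite scalerN h oppr0. Qed.
Lemma is_vacD u v : is_vac u -> is_vac v -> is_vac (u + v).
Proof. by move=> hu hv i; rewrite scalerDr hu hv addr0. Qed.
Lemma is_vacZ x u : is_vac u -> is_vac (iota x *: u).
Proof. by move=> /is_vacP h; apply/is_vacP; rewrite scalerA Bvac_incl -scalerA h. Qed.

Record vacmod := VacMod { vac_val : E; vac_prop : is_vac vac_val }.
HB.instance Definition _ := gen_eqMixin vacmod.
HB.instance Definition _ := gen_choiceMixin vacmod.

Lemma vac_val_inj : injective vac_val.
Proof. by case=> u hu [v hv] /= e; subst v; congr VacMod; apply: Prop_irrelevance. Qed.

Definition vm0 := VacMod is_vac0.
Definition vmN x := VacMod (is_vacN (vac_prop x)).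
Definition vmD x y := VacMod (is_vacD (vac_prop x) (vac_prop y)).
Definition vmZ b x := VacMod (is_vacZ b (vac_prop x)).

Let addA : associative vmD.
Proof. by move=> x y z; apply: vac_val_inj; rewrite /= addrA. Qed.
Let addC : commutative vmD.
Proof. by move=> x y; apply: vac_val_inj; rewrite /= addrC. Qed.
Let add0 : left_id vm0 vmD.
Proof. by move=> x; apply: vac_val_inj; rewrite /= add0r. Qed.
Let addN : left_inverse vm0 vmN vmD.
Proof. by move=> x; apply: vac_val_inj; rewrite /= addNr. Qed.
HB.instance Definition _ := GRing.isZmodule.Build vacmod addA addC add0 addN.

Let scaleA b c x : vmZ b (vmZ c x) = vmZ (b * c) x.
Proof. by apply: vac_val_inj; rewrite /= rmorphM scalerA. Qed.
Let scale1 : left_id 1 vmZ.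
Proof. by move=> x; apply: vac_val_inj; rewrite /= rmorph1 scale1r. Qed.
Let scaleDr : right_distributive vmZ +%R.
Proof. by move=> b x y; apply: vac_val_inj; rewrite /= scalerDr. Qed.
Let scaleDl x : {morph vmZ^~ x : b c / b + c}.
Proof. by move=> b c; apply: vac_val_inj; rewrite /= rmorphD scalerDl. Qed.
HB.instance Definition _ :=
  GRing.Zmodule_isLmodule.Build B0 vacmod scaleA scale1 scaleDr scaleDl.

Lemma vac_valD (x y : vacmod) : vac_val (x + y) = vac_val x + vac_val y.
Proof. by []. Qed.
Lemma vac_valZ b (x : vacmod) : vac_val (b *: x) = iota b *: vac_val x.
Proof. by []. Qed.

Definition vac_proj u : vacmod := VacMod (is_vac_Bvac u).

Lemma vac_projK : cancel vac_val vac_proj.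
Proof. by move=> x; apply: vac_val_inj; apply/is_vacP/vac_prop. Qed.

(* Expands u along 1 = \sum_I b_I p a_I^*, where p is the vacuum. *)
Lemma vac_expand (P Q : E -> Prop) :
  (forall u v, Q u -> Q v -> Q (u + v)) -> (forall i u, Q u -> Q (Bcre i *: u)) ->
  (forall i u, P u -> P (Bann i *: u)) -> (forall u, P u -> Q (Bvac *: u)) ->
  forall u, P u -> Q u.
Proof.
move=> QD Qb Pa PQ.
suff h s u : P u -> Q (dress Bann Bcre s Bvac *: u).
  by move=> u /(h (enum 'I_d)); rewrite (dress_vac Bcar) scale1r.
elim: s u => /= [|i s IH] u hu; first exact: PQ.
rewrite scalerDl -!scalerA; apply: QD; first exact: IH.
by apply/Qb/IH/Pa.
Qed.

End VacuumModule.

Lemma vacmod_iso (E F : lmodType B) :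
  mod_isomorphic E F -> mod_isomorphic (vacmod E) (vacmod F).
Proof.
move=> [f [k fk kf]].
have kZ b u : k (b *: u) = b *: k u.
  by apply: (can_inj fk); rewrite linearZ /= !kf.
have hf (x : vacmod E) : is_vac (f (vac_val x)).
  by move=> i; rewrite -(linearZZ f) (vac_prop x) (linear0 f).
have hk (x : vacmod F) : is_vac (k (vac_val x)).
  by move=> i; rewrite -kZ (vac_prop x) -[0 in LHS](linear0 f) fk.
pose F1 (x : vacmod E) := VacMod (hf x).
have lF : linear F1.
  by move=> b x y; apply: vac_val_inj; rewrite /= linearP.
pose ml := GRing.isLinear.Build B0 (vacmod E) (vacmod F) *:%R F1 lF.
pose FL : {linear vacmod E -> vacmod F} := HB.pack F1 ml.
exists FL; exists (fun y => VacMod (hk y)) => x; apply: vac_val_inj.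
  exact: fk.
exact: kf.
Qed.

End DoubledBalg.

(** * Irreducibility of the vacuum of an irreducible module *)

Section AnnihilatorSpan.
Variables (R : realType) (B : ralgType R) (d : nat) (a b : 'I_d -> B).
Hypothesis ab : car a b.

Definition ann_span (y : B) : Prop :=
  exists c : 'I_d -> R, y = \sum_i scal (c i) * a i.

Lemma ann_span1 i : ann_span (a i).
Proof.
exists (fun j => (j == i)%:R); rewrite (bigD1 i) //= eqxx scal1 mul1r.
by rewrite big1 ?addr0 // => j /negbTE ->; rewrite scal0 mul0r.
Qed.

Lemma ann_spanZ r y : ann_span y -> ann_span (scal r * y).
Proof.
move=> [c ->]; exists (fun i => r * c i); rewrite mulr_sumr.
by apply: eq_bigr => i _; rewrite scalM mulrA.
Qed.

Lemma ann_spanN y : ann_span y -> ann_span (- y).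
Proof. by move=> /(@ann_spanZ (- 1)); rewrite scalN scal1 mulN1r. Qed.

Lemma ann_span_sum (y : 'I_d -> B) :
  (forall i, ann_span (y i)) -> ann_span (\sum_i y i).
Proof.
move=> h; elim/big_ind: _ => [|x z [c ->] [c' ->]|//].
  by exists (fun _ => 0); rewrite big1 // => i _; rewrite scal0 mul0r.
exists (fun i => c i + c' i); rewrite -big_split; apply: eq_bigr => i _ /=.
by rewrite scalD mulrDl.
Qed.

Lemma ann_span_cre y i : ann_span y ->
  exists r : R, y * b i = scal r - b i * y.
Proof.
move=> [c ->]; exists (c i); rewrite mulr_suml mulr_sumr.
rewrite (bigD1 i) //= [X in _ = _ - X](bigD1 i) //= -mulrA (car_ab ab) eqxx.
rewrite mulrBr mulr1 scalMl opprD addrA; congr (_ + _).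
rewrite -sumrN; apply: eq_bigr => j ji.
by rewrite -mulrA (car_ab ab) (negbTE ji) sub0r mulrN scalMl.
Qed.

(** Commutation up to sign would be too strong: an element of G rotates the annihilators among
    themselves. For the same reason words below have letters in the whole span. *)
Definition normalizes_ann (x : B) : Prop :=
  forall y, ann_span y -> exists2 y', ann_span y' & y * x = x * y'.

Lemma normalizes_annP x :
  (forall i, exists2 y, ann_span y & a i * x = x * y) -> normalizes_ann x.
Proof.
move=> h _ [c ->]; pose z i := sval (cid2 (h i)).
exists (\sum_i scal (c i) * z i).
  by apply: ann_span_sum => i; apply: ann_spanZ; rewrite /z; case: cid2.
rewrite mulr_suml mulr_sumr; apply: eq_bigr => i _; rewrite /z -mulrA scalMl.
by case: cid2 => y _ /= ->.
Qed.

Lemma normalizes_ann_rot (x : B) (N : 'M[R]_d) (t : bool) :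
  N *m N^T = 1%:M ->
  (forall i, x * a i = (-1) ^+ t * (mxrot N a i * x)) -> normalizes_ann x.
Proof.
move=> NN h; apply: normalizes_annP => i.
exists ((-1) ^+ t * mxrot N^T a i).
  rewrite -scal_sign; apply: ann_spanZ; apply: ann_span_sum => j.
  exact/ann_spanZ/ann_span1.
have e j : mxrot N a j * x = (-1) ^+ t * (x * a j).
  by rewrite h mulrA -signr_addb addbb mul1r.
transitivity (\sum_j scal (N^T j i) * mxrot N a j * x).
  by rewrite -mulr_suml -/(mxrot _ _ _) -mxrotM NN mxrot1.
rewrite [mxrot N^T a i]/mxrot [RHS]signrCA [in RHS]mulr_sumr [RHS]mulr_sumr.
by apply: eq_bigr => j _; rewrite -mulrA e signrCA; congr (_ * _); rewrite scalMl.
Qed.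

Variables (B0 : ralgType R) (E : lmodType B) (F : lmodType B0).
Variables (iota : {rmorphism B0 -> B}) (p : B) (val : F -> E) (proj : E -> F).
Hypothesis iota_scal : forall r, iota (scal r) = scal r.
Hypothesis projD : forall u v, proj (u + v) = proj u + proj v.
Hypothesis projZ : forall x u, proj (iota x *: u) = x *: proj u.
Hypothesis valK : cancel val proj.
Hypothesis projK : forall u, val (proj u) = p *: u.
Hypothesis ann_val : forall i x, a i *: val x = 0.
Hypothesis p_cre : forall i, p * b i = 0.
Hypothesis alg_ind : forall P : B -> Prop,
  (forall x, normalizes_ann (iota x) -> P (iota x)) ->
  (forall i, P (a i)) -> (forall i, P (b i)) ->
  (forall x y, P x -> P y -> P (x + y)) ->
  (forall x y, P x -> P y -> P (x * y)) -> forall x, P x.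
Hypothesis proj_eq0 : (forall u : E, p *: u = 0) -> forall u : E, u = 0.

Lemma vacuum_irreducible : irreducible E -> irreducible F.
Proof.
have proj0 : proj 0 = 0 by rewrite -[RHS](scale0r (proj 0)) -projZ scaler0.
have val0 : val 0 = 0 by rewrite -proj0 projK scaler0.
move=> [[u u0] irr]; split.
  (* A nonzero vacuum vector exists, for otherwise [p] acts by zero and [proj_eq0] makes the whole
     module zero. *)
  have [[v hv]|h] := pselect (exists v : E, p *: v != 0).
    by exists (proj v); apply: contraNneq hv => e; rewrite -projK e val0.
  exfalso; move/eqP: u0; apply; apply: proj_eq0 => x.
  by apply/eqP/negPn/negP => hx; apply: h; exists x.
move=> P [P0 PD PZ].
(* [Q] is a submodule whose vacuum vectors are those of [P]: creators can be moved
   to the left end of a word, where the vacuum kills them. *)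
pose Q (w : E) := forall s : seq B, {in s, forall y, ann_span y} ->
  P (proj ((\prod_(y <- s) y) *: w)).
have Qsub : submodule Q.
  split=> [s _|v w hv hw s hs|x].
  - by rewrite scaler0 proj0.
  - by rewrite scalerDr projD; apply: PD; [apply: hv|apply: hw].
  have norm x0 : normalizes_ann (iota x0) -> forall w, Q w -> Q (iota x0 *: w).
    move=> nx w hw s hs.
    have [s' hs' e] : exists2 s' : seq B, {in s', forall y, ann_span y} &
        (\prod_(y <- s) y) * iota x0 = iota x0 * \prod_(y <- s') y.
      elim: s hs => [|y s IH] hs.
        by exists [::] => //; rewrite !big_nil mulr1 mul1r.
      have [z zs|s' hs' e] := IH; first by apply: hs; rewrite in_cons zs orbT.
      have [y' hy' ey] := nx y (hs y (mem_head _ _)).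
      exists (y' :: s'); last by rewrite !big_cons -mulrA e mulrA ey -mulrA.
      by move=> z; rewrite in_cons => /orP[/eqP ->|/hs'].
    by rewrite scalerA e -scalerA projZ; apply/PZ/hw.
  elim/alg_ind: x => [x nx|i|i|x y hx hy|x y hx hy] w hw.
  - exact: norm.
  - move=> s hs; rewrite scalerA.
    have -> : (\prod_(y <- s) y) * a i = \prod_(y <- rcons s (a i)) y.
      by rewrite big_rcons.
    apply: hw => z; rewrite mem_rcons in_cons => /orP[/eqP ->|/hs //].
    exact: ann_span1.
  (* Induction from the right end of the word. Exchanging the last letter y with b_i leaves a scalar
     times the shorter word and turns w into y w, which is why w is generalized. *)
  - move=> s; elim/last_ind: s w hw => [|s y IH] w hw hs.
      rewrite big_nil scale1r.
      have -> : proj (b i *: w) = 0.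
        by rewrite -[LHS]valK projK scalerA p_cre scale0r.
      exact: P0.
    have hs' : {in s, forall y, ann_span y}.
      by move=> z zs; apply: hs; rewrite mem_rcons in_cons zs orbT.
    have hy : ann_span y by apply: hs; rewrite mem_rcons mem_head.
    have [r e] := ann_span_cre i hy.
    rewrite big_rcons -scalerA [y *: _]scalerA e scalerBl scalerBr.
    rewrite scal_scalerCA -iota_scal -scalerA.
    have -> (u1 u2 : E) : u1 - u2 = u1 + iota (scal (-1)) *: u2.
      by rewrite scalN scal1 rmorphN rmorph1 scaleN1r.
    rewrite projD !projZ; apply: PD; apply: PZ; first exact: hw.
    apply: IH => // s' hs2; rewrite scalerA -[_ * y](big_rcons _ _ _ xpredT).
    apply: hw => z; rewrite mem_rcons in_cons => /orP[/eqP -> //|/hs2 //].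
  - move=> s hs; rewrite scalerDl scalerDr projD.
    by apply: PD; [apply: hx|apply: hy].
  by rewrite -scalerA; apply/hx/hy.
have PQ (x : F) : P x -> Q (val x).
  (* The last letter of a nonempty word already kills a vacuum vector, so only the empty word
     imposes a condition. *)
  move=> hx [_|y s hs]; first by rewrite big_nil scale1r valK.
  have -> : proj ((\prod_(z <- y :: s) z) *: val x) = 0.
    have [c e] : ann_span (last y s) by apply/hs/mem_last.
    have e0 : last y s *: val x = 0.
      rewrite e scaler_suml big1 // => i _.
      by rewrite -scalerA ann_val scaler0.
    by rewrite lastI big_rcons -scalerA e0 scaler0.
  exact: P0.
have [Q0|QT] := irr Q Qsub; [left|right] => x.
  by move=> /PQ /Q0 e; rewrite -[x]valK e.
by have := QT (val x) [::] (fun y => ltac:(done)); rewrite big_nil scale1r valK.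
Qed.
End AnnihilatorSpan.

(* Unification otherwise unfolds the quotient of terms behind each algebra. *)
Opaque Balg super_tensor presented ext_alg clifford.
Section DoubledNormalizers.
Variables (R : realType) (G : finGroupType) (S : symmetry R G).
Variables (d : nat) (V : orth_rep R G d).
Local Notation VV' := (sum_rep V (twist_rep S V)).
Local Notation W0 := (zero_rep R G).
Local Notation B := (Balg S VV').
Local Notation B0 := (Balg S W0).
Local Notation C1 := (clifford R 0 1).
Local Notation eps := (B_eps S VV').
Local Notation cst z := (B_in VV' (tw_cst S z)).
Local Notation bas g := (B_in VV' (tw_basis S g)).

Local Notation iota := (balg_incl S V).
Local Notation Bann := (Bann S V).
Local Notation Bcre := (Bcre S V).
Local Notation Bvac := (Bvac S V).
Local Notation Bcar := (Bcar S V).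

Lemma Bgen_decomp (i : 'I_(d + d)) : exists j,
  B_gen S VV' i = Bann j + Bcre j \/
  B_gen S VV' i = cst (- 'i%C) * (Bann j + - 1 * Bcre j).
Proof.
case: (split_ordP i) => j ->; exists j; [left|right].
  by rewrite -rmorphD annihilatorDcreator.
rewrite mulN1r -rmorphB annihilatorBcreator -[RHS]rmorphM mulrA -!rmorphM.
by rewrite mulNr i_mul_i opprK !rmorph1 mul1r.
Qed.

Lemma Balg_doubled_ind (P : B -> Prop) :
  P eps -> (forall z, P (cst z)) -> (forall g, P (bas g)) ->
  (forall i, P (Bann i)) -> (forall i, P (Bcre i)) ->
  (forall x y, P x -> P y -> P (x + y)) ->
  (forall x y, P x -> P y -> P (x * y)) -> forall x, P x.
Proof.
move=> Pe Pc Pb Pa Pcr PD PM; apply: Balg_ind => // i.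
have PN : P (-1) by have := Pc (-1); rewrite /B_in !rmorphN !rmorph1.
have [j [->|->]] := Bgen_decomp i; first exact: PD.
by apply: (PM) => //; apply: (PD) => //; apply: (PM).
Qed.

Lemma normalizes_eps : normalizes_ann Bann eps.
Proof.
apply: normalizes_annP => i; exists (- Bann i); first exact/ann_spanN/ann_span1.
by rewrite mulrN Beps_ann opprK.
Qed.

Lemma normalizes_cst z : normalizes_ann Bann (cst z).
Proof.
apply: normalizes_annP => i; exists (Bann i); first exact: ann_span1.
by rewrite Bcst_ann.
Qed.

Lemma normalizes_bas g : normalizes_ann Bann (bas g).
Proof.
apply: (@normalizes_ann_rot _ _ _ _ _ (V g) (hdeg S g)) => [|i].
  exact: orep_orth.
exact: Bbas_ann.
Qed.
End DoubledNormalizers.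

Section VacIrreducible.
Variables (R : realType) (G : finGroupType) (S : symmetry R G).
Variables (d : nat) (V : orth_rep R G d).
Local Notation VV' := (sum_rep V (twist_rep S V)).
Local Notation W0 := (zero_rep R G).
Local Notation B := (Balg S VV').
Local Notation B0 := (Balg S W0).
Local Notation C1 := (clifford R 0 1).
Local Notation eps := (B_eps S VV').
Local Notation cst z := (B_in VV' (tw_cst S z)).
Local Notation bas g := (B_in VV' (tw_basis S g)).

Local Notation iota := (balg_incl S V).
Local Notation Bann := (Bann S V).
Local Notation Bcre := (Bcre S V).
Local Notation Bvac := (Bvac S V).
Local Notation Bcar := (Bcar S V).

Lemma vac_projD (E : lmodType B) (u v : E) :
  vac_proj (u + v) = vac_proj u + vac_proj v.
Proof. by apply: vac_val_inj; rewrite /= scalerDr. Qed.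

Lemma vac_projZ (E : lmodType B) x (u : E) :
  vac_proj (iota x *: u) = x *: vac_proj u.
Proof. by apply: vac_val_inj; rewrite /= !scalerA Bvac_incl. Qed.

Lemma vacmod_irreducible (E : lmodType B) :
  irreducible E -> irreducible (vacmod E).
Proof.
apply: (@vacuum_irreducible R B d Bann Bcre Bcar B0 E (vacmod E) iota Bvac
  (@vac_val _ _ _ _ _ E) (@vac_proj _ _ _ _ _ E)).
- exact: balg_incl_scal.
- exact: vac_projD.
- exact: vac_projZ.
- exact: vac_projK.
- by [].
- by move=> i x; apply: vac_prop.
- exact: vac_b Bcar.
- move=> P Pn Pa Pb PD PM; apply: Balg_doubled_ind PD PM => // [|z|g].
  + rewrite -balg_incl_eps; apply: Pn; rewrite balg_incl_eps.
    exact: normalizes_eps.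
  + rewrite -balg_incl_in; apply: Pn; rewrite balg_incl_in.
    exact: normalizes_cst.
  rewrite -balg_incl_in; apply: Pn; rewrite balg_incl_in.
  exact: normalizes_bas.
move=> h u; apply: (@vac_expand _ _ _ _ _ E (fun _ => True) (fun v => v = 0)) => //.
- by move=> x y -> ->; rewrite addr0.
by move=> i x ->; rewrite scaler0.
Qed.
End VacIrreducible.

(** * Fock modules *)

Section ParityDouble.
Variables (R : realType) (B : superAlgType R) (E : lmodType B).

Definition pdouble : Type := (E * E)%type.
HB.instance Definition _ := GRing.Zmodule.on pdouble.

Definition pscale (x : B) (u : pdouble) : pdouble := (x *: u.1, parity x *: u.2).

Let scaleA b c u : pscale b (pscale c u) = pscale (b * c) u.
Proof. by rewrite /pscale /= !scalerA rmorphM. Qed.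
Let scale1 : left_id 1 pscale.
Proof. by case=> u v; rewrite /pscale /= rmorph1 !scale1r. Qed.
Let scaleDr : right_distributive pscale +%R.
Proof. by move=> b u v; rewrite /pscale /= !scalerDr. Qed.
Let scaleDl u : {morph pscale^~ u : b c / b + c}.
Proof. by move=> b c; rewrite /pscale /= rmorphD !scalerDl. Qed.
HB.instance Definition _ :=
  GRing.Zmodule_isLmodule.Build B pdouble scaleA scale1 scaleDr scaleDl.

Section Block.
Variables f g h k : lend E.
Definition block_fun (u : pdouble) : pdouble :=
  (f u.1 + g u.2, h u.1 + k u.2).
Fact block_D u v : block_fun (u + v) = block_fun u + block_fun v.
Proof.
by rewrite /block_fun /= !lfunD addrACA [h _ + _ + _]addrACA.
Qed.
Fact block_Z (r : R) u :
  block_fun ((scal r : B) *: u) = (scal r : B) *: block_fun u.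
Proof.
rewrite /block_fun /= parity_scal !lfunZ -!scalerDr.
by rewrite [RHS]/(pscale _ _) /pscale /= parity_scal.
Qed.
Definition block : lend pdouble := Lend block_D block_Z.
End Block.

Lemma blockM f g h k f' g' h' k' : block f g h k * block f' g' h' k' =
  block (f * f' + g * h') (f * g' + g * k') (h * f' + k * h') (h * g' + k * k').
Proof.
apply: lendP => -[u v] /=; rewrite /block_fun /= !lfunD.
by congr pair; rewrite addrACA.
Qed.

Lemma block1 : block 1 0 0 1 = 1.
Proof.
by apply: lendP => -[u v]; rewrite /= /block_fun /= addr0 add0r.
Qed.

Lemma block0 : block 0 0 0 0 = 0.
Proof. by apply: lendP => -[u v]; rewrite /= /block_fun /= addr0. Qed.

Lemma blockN f g h k : - block f g h k = block (- f) (- g) (- h) (- k).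
Proof.
by apply: lendP => -[u v]; rewrite /= /block_fun /= -!opprD.
Qed.

Lemma blockD f g h k f' g' h' k' : block f g h k + block f' g' h' k' =
  block (f + f') (g + g') (h + h') (k + k').
Proof.
apply: lendP => -[u v]; rewrite /= /block_fun /=.
by congr pair; rewrite addrACA.
Qed.

Lemma lact_block x : lact pdouble x = block (lact E x) 0 0 (lact E (parity x)).
Proof. by apply: lendP => -[u v]; rewrite /= /block_fun /= addr0 add0r. Qed.

End ParityDouble.

Local Notation simpl_ := (mul0r, mulr0, addr0, add0r, mulr1, mul1r, mulrN, mulNr,
  opprK, oppr0, blockN, blockD, blockM).

Lemma fock_exists (R : realType) (B : superAlgType R) (E0 : lmodType B) d :
  exists (E : lmodType B) (a b : 'I_d -> lend E) (j : {linear E0 -> E}),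
  [/\ car a b,
      forall c x i, homog c x -> lact E x * a i = (-1) ^+ c * (a i * lact E x),
      forall c x i, homog c x -> lact E x * b i = (-1) ^+ c * (b i * lact E x),
      injective j & forall u, (forall i, a i u = 0) <-> exists v, u = j v].
Proof.
elim: d => [|d [E [a [b [j [ab xa xb jinj jP]]]]]].
  exists E0, (fun _ => 0), (fun _ => 0), idfun; split=> //; try by move=> ? ? [].
    by split=> [[]|[]|[]|[]|[]].
  by move=> u; split=> // _; exists u.
(* The Jordan-Wigner recipe: the new mode is a pair of off-diagonal matrix units, and the old modes
   change sign on the second copy in order to anticommute with it. *)
pose a' i := if unlift ord0 i is Some k then block (a k) 0 0 (- a k) else block 0 1 0 0.
pose b' i := if unlift ord0 i is Some k then block (b k) 0 0 (- b k) else block 0 0 1 0.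
pose j' (v : E0) : pdouble E := (j v, 0).
have j'l : linear j'.
  move=> x u v; rewrite /j' linearP; congr pair.
  by apply/esym; apply: etrans (addr0 _) (scaler0 _ _).
pose jm := GRing.isLinear.Build B E0 (pdouble E) *:%R j' j'l.
pose J : {linear E0 -> pdouble E} := HB.pack j' jm.
exists (pdouble E), a', b', J; split.
- split=> [i k|i|i k|i|i k]; rewrite /a' /b'.
  + case: (unliftP ord0 i) => [i' _|_]; case: (unliftP ord0 k) => [k' _|_];
    rewrite !simpl_ //.
    by rewrite (car_aa ab).
  + case: (unliftP ord0 i) => [i' _|_]; rewrite !simpl_ ?block0 //.
    by rewrite (car_a2 ab) block0.
  + case: (unliftP ord0 i) => [i' _|_]; case: (unliftP ord0 k) => [k' _|_];
    rewrite !simpl_ //.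
    by rewrite (car_bb ab).
  + case: (unliftP ord0 i) => [i' _|_]; rewrite !simpl_ ?block0 //.
    by rewrite (car_b2 ab) block0.
  case: (unliftP ord0 i) => [i' ->|->]; case: (unliftP ord0 k) => [k' ->|->].
  + rewrite !simpl_ (inj_eq (lift_inj)) (car_ab ab).
    by case: eqP => _; rewrite -?block1 ?blockD !simpl_.
  + by rewrite eq_sym (negbTE (neq_lift _ _)) !simpl_.
  + by rewrite (negbTE (neq_lift _ _)) !simpl_.
  by rewrite eqxx -block1 !simpl_ addrN.
- move=> c x i hx; rewrite /a' lact_block.
  case: (unliftP ord0 i) => [k _|_]; case: c hx => hx;
    rewrite ?(parity1 hx) ?(parity0 hx) ?rmorphN ?expr1 ?expr0 ?mulN1r ?mul1r;
    rewrite !simpl_ // (xa _ _ _ hx) ?expr1 ?expr0 ?mulN1r ?mul1r ?opprK //.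
- move=> c x i hx; rewrite /b' lact_block.
  case: (unliftP ord0 i) => [k _|_]; case: c hx => hx;
    rewrite ?(parity1 hx) ?(parity0 hx) ?rmorphN ?expr1 ?expr0 ?mulN1r ?mul1r;
    rewrite !simpl_ // (xb _ _ _ hx) ?expr1 ?expr0 ?mulN1r ?mul1r ?opprK //.
- by move=> u v /= [/jinj].
move=> [u1 u2]; split=> [h|[v [-> ->]] i].
  have u20 : u2 = 0.
    have := h ord0; rewrite /a' unlift_none => -[].
    by rewrite add0r.
  have [v e] : exists v, u1 = j v.
    apply/jP => i; have := h (lift ord0 i); rewrite /a' liftK => -[].
    by rewrite addr0.
  by exists v; rewrite u20 e.
rewrite /a'; case: (unliftP ord0 i) => [k _|_]; rewrite /= /block_fun /=.
  have -> : a k (j v) = 0 by apply: (proj2 (jP (j v))); exists v.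
  by rewrite lfun0 subr0 addr0.
by rewrite addr0.
Qed.

Section Pullback.
Variables (R : realType) (B C : ralgType R) (E : lmodType C).
Variable F : {rmorphism B -> lend E}.

(** The morphism is an argument of the type so that the module structure found on it can depend on
    that morphism. *)
Definition pullback of {rmorphism B -> lend E} : Type := E.
HB.instance Definition _ := GRing.Zmodule.on (pullback F).

Let pscale (b : B) (u : pullback F) : pullback F := F b u.
Let scaleA b c u : pscale b (pscale c u) = pscale (b * c) u.
Proof. by rewrite /pscale rmorphM. Qed.
Let scale1 : left_id 1 pscale.
Proof. by move=> u; rewrite /pscale rmorph1. Qed.
Let scaleDr : right_distributive pscale +%R.
Proof. by move=> b u v; rewrite /pscale lfunD. Qed.
Let scaleDl u : {morph pscale^~ u : b c / b + c}.
Proof. by move=> b c; rewrite /pscale rmorphD. Qed.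
HB.instance Definition _ :=
  GRing.Zmodule_isLmodule.Build B (pullback F) scaleA scale1 scaleDr scaleDl.

Lemma pullbackE b (u : pullback F) : b *: u = F b u. Proof. by []. Qed.
End Pullback.

Section IrreducibleTransfer.
Variables (R : realType) (B B0 : ralgType R) (E0 : lmodType B0) (M : lmodType B).
Variables (iota : B0 -> B) (p : B) (j : E0 -> M).
Hypotheses (jinj : injective j) (j0 : j 0 = 0).
Hypothesis jD : forall u v, j (u + v) = j u + j v.
Hypothesis jZ : forall x v, iota x *: j v = j (x *: v).
Hypothesis pE : forall u, exists v, p *: u = j v.
Hypothesis pgen : forall P Q : M -> Prop,
  (forall u v, Q u -> Q v -> Q (u + v)) -> (forall x u, Q u -> Q (x *: u)) ->
  (forall x u, P u -> P (x *: u)) -> (forall u, P u -> Q (p *: u)) ->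
  forall u, P u -> Q u.

(** A submodule of [M] meets the vacuum in a submodule of [E0]. If it meets it in zero, [p] kills it
    and [pgen] shows that it is zero; if it contains the vacuum, [pgen] shows that it is
    everything. *)
Lemma irreducible_transfer : irreducible E0 -> irreducible M.
Proof.
move=> [[v0 v00] irr]; split.
  by exists (j v0); apply: contraNneq v00 => e; apply/eqP/jinj; rewrite e j0.
move=> Q [Q0 QD QZ].
have [|h|h] := irr (fun v => Q (j v)).
- split=> [|x y hx hy|x v hv]; first by rewrite j0.
    by rewrite jD; apply: QD.
  by rewrite -jZ; apply: QZ.
- left=> u; apply: (@pgen Q (fun u => u = 0)).
  + by move=> x y -> ->; rewrite addr0.
  + by move=> x y ->; rewrite scaler0.
  + by move=> x y; apply: QZ.
  move=> x hx; have [v e] := pE x.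
  by have := QZ p _ hx; rewrite e => /h ->.
right=> u; apply: (@pgen (fun _ => True) Q) => //.
by move=> x _; have [v ->] := pE x.
Qed.
End IrreducibleTransfer.

Lemma linear_bij_isomorphic (R : realType) (B : ralgType R) (E F : lmodType B)
    (f : E -> F) :
  linear f -> injective f -> (forall x, exists v, x = f v) -> mod_isomorphic E F.
Proof.
move=> fl finj fsurj.
pose fm := GRing.isLinear.Build B E F *:%R f fl.
pose fL : {linear E -> F} := HB.pack f fm.
exists fL; exists (fun x => sval (cid (fsurj x))) => [v|x].
  by case: cid => w /= /finj.
by case: cid => w /= ->.
Qed.

Section FockModule.
Variables (R : realType) (G : finGroupType) (S : symmetry R G).
Variables (d : nat) (V : orth_rep R G d).
Local Notation VV' := (sum_rep V (twist_rep S V)).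
Local Notation W0 := (zero_rep R G).
Local Notation B := (Balg S VV').
Local Notation B0 := (Balg S W0).
Local Notation C1 := (clifford R 0 1).
Local Notation eps := (B_eps S VV').
Local Notation cst z := (B_in VV' (tw_cst S z)).
Local Notation bas g := (B_in VV' (tw_basis S g)).

Local Notation iota := (balg_incl S V).
Local Notation Bann := (Bann S V).
Local Notation Bcre := (Bcre S V).
Local Notation Bvac := (Bvac S V).
Local Notation Bcar := (Bcar S V).


Local Notation A := (twisted_alg S).

Lemma vacmod_surjective (E0 : lmodType B0) : irreducible E0 ->
  exists2 E : lmodType B, irreducible E & mod_isomorphic E0 (vacmod E).
Proof.
move=> irr0.
have [E [a [b [j [ab xa xb jinj jP]]]]] := @fock_exists R B0 E0 d.
pose tau : {rmorphism A -> lend E} :=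
  lact E \o @tensr R C1 (ext_alg S W0) \o ext_in W0.
have taus r : tau (scal r) = scal r.
  by rewrite /tau /= ext_in_scal tensr_scal lact_scal.
have tauE x : tau x = lact E (B_in W0 x) by [].
have hin c x : homog c x -> homog c (B_in W0 x).
  by move=> hx; apply/tensr_homog/ext_in_homog.
have heps : homog true (B_eps S W0) by apply/tensl_homog/clifford_gen_homog.
have [||||f [fs finE [fc fb] fl fr]] := @fock_lift R G S d V (lend E) tau a b taus ab.
- by move=> z i; rewrite tauE (xa false) ?mul1r //; apply/hin/homog_cst.
- by move=> z i; rewrite tauE (xb false) ?mul1r //; apply/hin/homog_cst.
- by move=> g i; rewrite tauE (xa (hdeg S g)) //; apply/hin/homog_basis.
- by move=> g i; rewrite tauE (xb (hdeg S g)) //; apply/hin/homog_basis.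
have ti2 : tau (tw_cst S 'i%C) * tau (tw_cst S 'i%C) = -1.
  by rewrite -!rmorphM i_mul_i !rmorphN !rmorph1.
have [fa fbE] := fock_lift_ann fs ti2 (fc _) fl fr.
pose eps' := lact E (B_eps S W0).
have epsa i : eps' * a i = - (a i * eps') by rewrite (xa true) // mulN1r.
have epsb i : eps' * b i = - (b i * eps') by rewrite (xb true) // mulN1r.
have eps_tau c x : homog c x -> eps' * tau x = (-1) ^+ c * (tau x * eps').
  move=> hx; rewrite tauE -!rmorphM (B_eps_comm (ext_in_homog _ hx)).
  by rewrite [LHS]rmorphM rmorph_sign.
have eps_cst z : eps' * tau (tw_cst S z) = tau (tw_cst S z) * eps'.
  by rewrite (eps_tau false) ?mul1r //; apply: homog_cst.
have eps_X M : eps' * implementer a b M = implementer a b M * eps'.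
  by apply: (@implementer_comm _ _ _ _ _ _ _ true) => i; rewrite mulN1r.
have [||||F [Fs Fe Fr]] := @balg_lift R G S _ VV' (lend E) eps' f.
- by rewrite -rmorphM B_eps2 rmorph1.
- exact: fs.
- move=> c x hx; rewrite finE mulr_sumr mulr_suml mulr_sumr; apply: eq_bigr => g _.
  have [->|/hx <-] := eqVneq (x g) 0; first by rewrite !rmorph0 !(mul0r, mulr0).
  rewrite mulrA eps_cst -!mulrA [eps' * (_ * _)]mulrA eps_X -mulrA.
  by rewrite (eps_tau _ _ (@homog_basis R G S g)) 2!signrCA.
- move=> i; case: (split_ordP i) => k ->.
    by rewrite fl mulrDr epsa epsb -opprD -mulrDl.
  rewrite fr mulrN mulrA eps_cst -mulrA mulrBr epsa epsb -opprB opprK.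
  by rewrite addrC -mulrBl mulrN mulNr mulrA.
have Fa i : F (Bann i) = a i by rewrite Fr -fa.
have Fb i : F (Bcre i) = b i by rewrite Fr -fbE.
have Fvac : F Bvac = vacuum a b (enum 'I_d).
  rewrite vacuum_rmorph; congr vacuum; apply: funext => i /=; [exact: Fa|exact: Fb].
pose M : lmodType B := pullback F.
have vacE (u : M) : is_vac u <-> exists v, u = j v.
  split=> [h|[v e] i].
    by apply/(proj1 (jP u)) => i; rewrite -Fa; apply: h.
  by rewrite pullbackE Fa (proj2 (jP u)) //; exists v.
have tauX g N : tau (tw_basis S g) * implementer a b N =
    implementer a b N * tau (tw_basis S g).
  apply: (@implementer_comm _ _ _ _ _ _ _ (hdeg S g)) => i; rewrite tauE.
    exact/xa/hin/homog_basis.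
  exact/xb/hin/homog_basis.
have Xvac N (u : M) : is_vac u -> implementer a b N u = u.
  move=> /is_vacP <-; rewrite pullbackE Fvac -lendME.
  by rewrite (implementer_vac ab).
(* g acts on the Fock module as x_g tau(g), and x_g fixes vacuum vectors; so the original module
   structure reappears on the vacuum. *)
have Fin x (u : M) : is_vac u -> F (iota x) u = lact E x u.
  elim/Balg_ind: x u => [|z|g|[]//|x y hx hy|x y hx hy] u hu.
  - by rewrite balg_incl_eps Fe.
  - by rewrite balg_incl_in [F _]Fr fc.
  - by rewrite balg_incl_in [F _]Fr fb -tauX lendME Xvac.
  - by rewrite !rmorphD !lendDE hx ?hy.
  rewrite !rmorphM !lendME hy // hx // -hy //.
  exact: (is_vacZ y hu).
have jZ x v : iota x *: (j v : M) = j (x *: v).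
  rewrite pullbackE Fin; first exact/esym/(linearZZ j x v).
  by apply/vacE; exists v.
have hj v : is_vac (j v : M) by apply/vacE; exists v.
exists M.
  apply: (@irreducible_transfer R B B0 E0 M iota Bvac j).
  - exact: jinj.
  - exact: (linear0 j).
  - exact: (linearD j).
  - exact: jZ.
  - by move=> u; apply/vacE/is_vac_Bvac.
  - move=> P Q QD QZ PZ; apply: (@vac_expand _ _ _ _ _ M P Q QD) => i.
      exact: QZ.
    exact: PZ.
  exact: irr0.
apply: (@linear_bij_isomorphic R B0 E0 (vacmod M) (fun v => VacMod (hj v))).
- move=> x u v; apply: vac_val_inj; apply: etrans (linearD j _ _) _.
  exact/congr2/erefl/esym/(jZ x u).
- by move=> u v /(congr1 (@vac_val _ _ _ _ _ M)) /jinj.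
move=> x; have /vacE[v e] := vac_prop x.
by exists v; apply: vac_val_inj.
Qed.
End FockModule.

(** * Comparison of classifying spaces *)

Section ClassBijection.
Variable T : Type.
Implicit Types (c : nat -> T) (t : T).
Local Open Scope nat_scope.

Definition occ c t n : nat := \sum_(k < n) `[< c k = t >].

Lemma occS c t n : occ c t n.+1 = occ c t n + `[< c n = t >].
Proof. by rewrite /occ big_ord_recr. Qed.

Lemma occ_le c t m n : m <= n -> occ c t m <= occ c t n.
Proof.
move=> /subnKC <-; elim: (n - m) => [|k IH]; first by rewrite addn0.
by rewrite addnS occS (leq_trans IH) // leq_addr.
Qed.

Lemma occ_inj c t m n : c m = t -> c n = t -> occ c t m = occ c t n -> m = n.
Proof.
have lt k l : c k = t -> k < l -> occ c t k < occ c t l.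
  move=> /asboolP ck /(occ_le c t); rewrite occS ck addn1; exact.
move=> cm cn e; case: (ltngtP m n) => // /lt.
  by move=> /(_ cm); rewrite e ltnn.
by move=> /(_ cn); rewrite e ltnn.
Qed.

Lemma occ_exists c t : (forall N, exists2 n, N <= n & c n = t) ->
  forall r, exists n, c n = t /\ occ c t n = r.
Proof.
move=> inf r.
have unb : exists n, r < occ c t n.+1.
  elim: r => [|r [n hn]].
    by have [n _ /asboolP cn] := inf 0; exists n; rewrite occS cn addn1.
  have [m nm /asboolP cm] := inf n.+1; exists m.
  by rewrite occS cm addn1 ltnS (leq_trans hn) // occ_le.
(* At the least such n the count is still at most r before n and exceeds r after it. As it grows by
   at most one, n lies in the class and exactly r members precede it. *)
case: (ex_minnP unb) => n; rewrite occS => hn min; exists n.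
have le : occ c t n <= r.
  case: n hn min => [|n] hn min; first by rewrite /occ big_ord0.
  by rewrite leqNgt; apply/negP => /min; rewrite ltnn.
case: asboolP hn => [-> hn|_ hn].
  by split=> //; apply/eqP; rewrite eqn_leq le; rewrite addn1 ltnS in hn.
by rewrite addn0 ltnNge le in hn.
Qed.

(* The r-th index of each class of c is matched with its r-th index in c'. *)
Lemma class_bijection c c' :
  (forall n N, exists2 m, N <= m & c' m = c n) ->
  (forall m N, exists2 n, N <= n & c n = c' m) ->
  exists s s' : nat -> nat, [/\ cancel s s', cancel s' s &
    forall n, c' (s n) = c n].
Proof.
move=> h h'.
have [s hs] := choice (fun n => occ_exists (h n) (occ c (c n) n)).
have [s' hs'] := choice (fun n => occ_exists (h' n) (occ c' (c' n) n)).
exists s, s'; split=> n.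
- have [e1 o1] := hs n; have [e2 o2] := hs' (s n).
  by apply: (@occ_inj c (c n)); rewrite ?e2 // -{1}e1 o2 e1 o1.
- have [e1 o1] := hs' n; have [e2 o2] := hs (s' n).
  by apply: (@occ_inj c' (c' n)); rewrite ?e2 // -{1}e1 o2 e1 o1.
by have [] := hs n.
Qed.
End ClassBijection.

(** * Supports in direct sums, and continuity tested on the stages *)

Section DsumTheory.
Variables (R : realType) (B : ralgType R) (W : nat -> lmodType B).
Local Notation U := (dsum W).

Lemma coordD (u v : U) n : Defs.coord (u + v) n = Defs.coord u n + Defs.coord v n.
Proof. by []. Qed.
Lemma coordN (u : U) n : Defs.coord (- u) n = - Defs.coord u n.
Proof. by []. Qed.

Fact trunc_fin n (u : U) : exists N, forall j, (N <= j)%N ->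
  (if (j <= n)%N then Defs.coord u j else 0) = 0.
Proof. by exists n.+1 => j; rewrite ltnNge => /negbTE ->. Qed.
Definition trunc n (u : U) : U := Dsum (trunc_fin n u).

Section DressSupport.
Variables (d : nat) (a be : 'I_d -> B) (P : nat -> Prop).
Local Notation la := (lact U : B -> lend U).
Definition supp_out (u : U) : Prop := forall j, P j -> Defs.coord u j = 0.

Lemma supp_outZ b u : supp_out u -> supp_out (b *: u).
Proof. by move=> hu j Pj; rewrite coordZ hu ?scaler0. Qed.

Lemma dress_supp (Z : lend U) l : (forall u, supp_out u -> supp_out (Z u)) ->
  forall u, supp_out u ->
    supp_out (dress (la \o a) (fun i => - la (be i)) l Z u).
Proof.
move=> hZ; elim: l => //= i l IH u hu k Pk.
rewrite coordD IH // add0r coordN coordZ IH ?scaler0 ?oppr0 //.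
exact: supp_outZ.
Qed.

Lemma dress_eq_supp (Z Z' : lend U) g l :
  (forall u, supp_out u -> Z u = Z' u) ->
  forall u, supp_out u -> dress (la \o a) g l Z u = dress (la \o a) g l Z' u.
Proof.
move=> hZ; elim: l => //= i l IH u hu.
by rewrite IH // IH //; apply: supp_outZ.
Qed.
End DressSupport.
End DsumTheory.

(* [pointwise_cvgP] requires a topology on the domain; [I] is a bare type. *)
Section PointwiseTopology.
Local Open Scope classical_set_scope.
Variables (I : Type) (V : topologicalType).

Lemma ptws_eval_continuous (i : I) : continuous (fun f : {ptws I -> V} => f i).
Proof.
move=> f; have /cvg_sup/(_ i) h : f --> f by apply: cvg_id.
by move=> A /(@initial_continuous (I -> V) V (fun f => f i) f) /h.
Qed.

Lemma ptws_continuous (X : topologicalType) (F : X -> {ptws I -> V}) :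
  (forall i, continuous (fun x => F x i)) -> continuous F.
Proof.
move=> h x; apply/cvg_sup => i.
exact: (@continuous_comp_initial (I -> V) X V (fun f => f i) F (h i) x).
Qed.
End PointwiseTopology.

Section KspaceTheory.
Variables (R : realType) (G : finGroupType) (S : symmetry R G).
Variables (q : nat) (W : orth_rep R G q) (Om : universe (Balg S W)).
Local Notation B := (Balg S W).
Local Notation U := (dsum (summand Om)).
Local Notation K := (@Kspace R G S q W Om).

Lemma trunc_in n (u : U) : in_Un n (trunc n u).
Proof. by move=> j nj; rewrite /= leqNgt nj. Qed.
Lemma trunc_above n (u : U) : above_Un n (u - trunc n u).
Proof. by move=> j jn; rewrite coordD coordN /= jn subrr. Qed.

Lemma at_stage_split n (M : K) u : at_stage n M ->
  M u = M (trunc n u) + B_eps S W *: (u - trunc n u).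
Proof.
move=> [_ h]; rewrite -[in LHS](subrK (trunc n u) u) addrC KopD.
by rewrite (h _ (@trunc_above n u)).
Qed.

Lemma at_stage_coord n (M : K) u j : at_stage n M -> (n < j)%N ->
  Defs.coord (M u) j = B_eps S W *: Defs.coord u j.
Proof.
move=> hM nj; rewrite (at_stage_split _ hM) coordD.
rewrite (proj1 hM _ (@trunc_in n u)) // add0r coordZ coordD coordN /=.
by rewrite leqNgt nj subr0.
Qed.

Local Open Scope classical_set_scope.

(** The topology of a stage only tests vectors of U_n. For general [u], the part outside U_n is
    multiplied by [B_eps] whatever [M] is, so it adds a constant. *)
Lemma coef_continuous n (u : U) (l : functional Om) :
  continuous (fun M : initial_topology (@matrix_coef R G S q W Om n) =>
    l (sval M u)).
Proof.
pose p : Un_type Om n * functional Om := (exist _ (trunc n u) (@trunc_in n u), l).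
have -> : (fun M : initial_topology (@matrix_coef R G S q W Om n) =>
    l (sval M u)) = (fun M : initial_topology (@matrix_coef R G S q W Om n) =>
    matrix_coef M p + l (B_eps S W *: (u - trunc n u))).
  apply: funext => M; rewrite /matrix_coef /= -functionalD.
  by rewrite -at_stage_split //; apply: asboolW (svalP M).
move=> M; apply: (@cvgD _ _ _ (nbhs M)); last exact: cvg_cst.
exact: cvg_comp (initial_continuous (f := @matrix_coef R G S q W Om n) (x := M))
  (ptws_eval_continuous (i := p) (x := matrix_coef M)).
Qed.

Lemma Kmap_continuous q' (W' : orth_rep R G q')
    (Om' : universe (Balg S W')) (F : K -> @Kspace R G S q' W' Om') :
  (forall n, exists m, forall M : K, at_stage n M -> at_stage m (F M)) ->
  (forall n u (l : functional Om'),
    continuous (fun M : initial_topology (@matrix_coef R G S q W Om n) =>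
      l (F (sval M) u))) ->
  continuous F.
Proof.
move=> hs hc; apply/continuousP => A oA; rewrite Kspace_openE => n.
have [m hm] := hs n.
have hF (M : Kstage Om n) : `[< at_stage m (F (sval M)) >].
  exact/asboolP/hm/(asboolW (svalP M)).
pose Fn (M : initial_topology (@matrix_coef R G S q W Om n)) :
    initial_topology (@matrix_coef R G S q' W' Om' m) := exist _ (F (sval M)) (hF M).
have cFn : continuous Fn.
  apply/continuous_comp_initial/ptws_continuous => p.
  exact: hc.
have := proj1 (continuousP Fn) cFn _ (oA m).
by [].
Qed.

End KspaceTheory.

(** * Matching the summands of the two universes *)

Lemma mod_isomorphic_sym (R : realType) (B : ralgType R) (E F : lmodType B) :
  mod_isomorphic E F -> mod_isomorphic F E.
Proof.
move=> [f [k fk kf]].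
have kl : linear k.
  by move=> b u v; apply: (can_inj fk); rewrite linearP !kf.
pose km := GRing.isLinear.Build B F E *:%R k kl.
pose K : {linear F -> E} := HB.pack k km.
by exists K; exists f.
Qed.

Lemma mod_isomorphic_trans (R : realType) (B : ralgType R) (E F H : lmodType B) :
  mod_isomorphic E F -> mod_isomorphic F H -> mod_isomorphic E H.
Proof. by move=> [f bf] [k bk]; exists (k \o f); apply: bij_comp. Qed.

(** An injective reindexing tends to infinity, so it preserves finite supports and the existence of
    a stage. *)
Lemma cancel_bound (s s' : nat -> nat) : cancel s s' ->
  forall N, exists M, forall n, (M <= n)%N -> (N <= s n)%N.
Proof.
move=> ss' N; exists (\max_(k < N) s' k).+1 => n hn.
rewrite leqNgt; apply/negP => sN.
have := @leq_bigmax _ (fun k : 'I_N => s' k) (Ordinal sN).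
by rewrite /= ss' leqNgt hn.
Qed.

Lemma iso_matching (R : realType) (B : ralgType R) (C D : nat -> lmodType B) :
  (forall n N, exists2 m, (N <= m)%N & mod_isomorphic (C n) (D m)) ->
  (forall m N, exists2 n, (N <= n)%N & mod_isomorphic (D m) (C n)) ->
  exists s s' : nat -> nat, [/\ cancel s s', cancel s' s &
    forall n, mod_isomorphic (C n) (D (s n))].
Proof.
(* An isomorphism class is encoded as a predicate on modules; extensionality turns isomorphism into
   equality of classes, the form that [class_bijection] needs. *)
move=> CD DC; pose cl (E : lmodType B) (F : lmodType B) : Prop := mod_isomorphic E F.
have clP (E F : lmodType B) : mod_isomorphic E F -> cl E = cl F.
  move=> ef; apply: funext => H; apply: propext; split.
    exact/mod_isomorphic_trans/mod_isomorphic_sym.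
  exact: mod_isomorphic_trans.
have [||s [s' [ss' s's h]]] := @class_bijection _ (cl \o C) (cl \o D).
- by move=> n N; have [m Nm /mod_isomorphic_sym/clP] := CD n N; exists m.
- by move=> m N; have [n Nn /mod_isomorphic_sym/clP] := DC m N; exists n.
exists s, s'; split=> // n; have : cl (D (s n)) (D (s n)) by exists idfun; exists idfun.
by have /= -> := h n.
Qed.

Section Matching.
Variables (R : realType) (B B0 : ralgType R) (iota : {rmorphism B0 -> B}) (pr : B).
Variables (E : nat -> lmodType B) (C D : nat -> lmodType B0).
Variables (val : forall n, C n -> E n) (proj : forall n, E n -> C n).
Hypothesis valD : forall n u v, val (u + v) = val u + val v :> E n.
Hypothesis valZ : forall n x u, val (x *: u) = iota x *: val u :> E n.
Hypothesis projD : forall n u v, proj (u + v) = proj u + proj v :> C n.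
Hypothesis projZ : forall n x (u : E n), proj (iota x *: u) = x *: proj u.
Hypothesis valK : forall n (u : C n), proj (val u) = u.
Hypothesis projK : forall n (u : E n), val (proj u) = pr *: u.
Variables (s s' : nat -> nat).
Hypothesis ss' : cancel s s'.
Hypothesis s's : cancel s' s.
Hypothesis iso : forall n, mod_isomorphic (C n) (D (s n)).
Arguments val : clear implicits.
Arguments proj : clear implicits.

Lemma dsum_matching : exists (t : dsum D -> dsum E) (t' : dsum E -> dsum D),
  [/\ (forall u v, t (u + v) = t u + t v) /\
      (forall x v, t (x *: v) = iota x *: t v),
      (forall u v, t' (u + v) = t' u + t' v) /\
      (forall x u, t' (iota x *: u) = x *: t' u),
      cancel t t' /\ (forall u, t (t' u) = pr *: u) &
      (forall v n, Defs.coord v (s n) = 0 -> Defs.coord (t v) n = 0) /\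
      (forall u m, Defs.coord u (s' m) = 0 -> Defs.coord (t' u) m = 0)].
Proof.
pose spec n m (f : C n -> D m) (k : D m -> C n) := [/\
  forall u v, f (u + v) = f u + f v,
  forall x u, f (x *: u) = x *: f u,
  forall u v, k (u + v) = k u + k v,
  forall x u, k (x *: u) = x *: k u &
  s n = m -> cancel f k /\ cancel k f].
(* The maps are chosen for all pairs of indices, with value zero unless [s n = m]. Since [s (s' m)]
   equals [m] only propositionally, this avoids transport between the corresponding modules. *)
have ex n m : exists fg, @spec n m fg.1 fg.2.
  have [e|ne] := eqVneq (s n) m.
    subst m; have [f [k fk kf]] := iso n.
    exists (f : _ -> _, k); split=> /=.
    - exact: (linearD f).
    - exact: (linearZZ f).
    - by move=> u v; apply: (can_inj fk); rewrite (linearD f) !kf.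
    - by move=> x u; apply: (can_inj fk); rewrite (linearZZ f) !kf.
    by [].
  exists (fun _ => 0, fun _ => 0); split=> /=; do ?[by move=> *; rewrite ?addr0 ?scaler0].
  by move=> e; rewrite e eqxx in ne.
pose f n m := (sval (cid (ex n m))).1; pose k n m := (sval (cid (ex n m))).2.
have fk_spec n m : @spec n m (f n m) (k n m).
  by rewrite /f /k; case: cid => -[f1 k1].
have f0 n m : f n m 0 = 0.
  by have [_ fZ _ _ _] := fk_spec n m; have := fZ 0 0; rewrite !scale0r.
have k0 n m : k n m 0 = 0.
  by have [_ _ _ kZ _] := fk_spec n m; have := kZ 0 0; rewrite !scale0r.
have v0 n : val n 0 = 0.
  by have := @valZ n 0 0; rewrite rmorph0 !scale0r.
have p0 n : proj n 0 = 0.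
  by have := @projZ n 0 0; rewrite rmorph0 !scale0r.
have tfin (v : dsum D) : exists N, forall n, (N <= n)%N ->
    val n (k n (s n) (Defs.coord v (s n))) = 0.
  have [N hN] := coord_fin v; have [M hM] := cancel_bound ss' N.
  by exists M => n /hM/hN ->; rewrite k0 v0.
have t'fin (u : dsum E) : exists N, forall m, (N <= m)%N ->
    f (s' m) m (proj (s' m) (Defs.coord u (s' m))) = 0.
  have [N hN] := coord_fin u; have [M hM] := cancel_bound s's N.
  by exists M => m /hM/hN ->; rewrite p0 f0.
exists (fun v => Dsum (tfin v)), (fun u => Dsum (t'fin u)); split=> //.
- split=> [u v|x v]; apply: dsumP => n /=; have [_ _ kD kZ _] := fk_spec n (s n).
    by rewrite kD valD.
  by rewrite kZ valZ.
- split=> [u v|x v]; apply: dsumP => n /=; have [fD fZ _ _ _] := fk_spec (s' n) n.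
    by rewrite projD fD.
  by rewrite projZ fZ.
- split=> u; apply: dsumP => n /=.
    have [_ _ _ _ /(_ (s's n))[_ kf]] := fk_spec (s' n) n.
    suff h m : m = n -> f (s' n) n (proj (s' n) (val (s' n) (k (s' n) m (Defs.coord u m)))) = Defs.coord u n.
      exact/h/s's.
    by move=> ->; rewrite valK kf.
  have [_ _ _ _ /(_ erefl)[fk _]] := fk_spec n (s n).
  suff h m : m = n -> val n (k n (s n) (f m (s n) (proj m (Defs.coord u m)))) =
      pr *: Defs.coord u n by exact/h/ss'.
  by move=> ->; rewrite fk projK.
split=> [v n|u m] /= ->; first by rewrite k0 v0.
by rewrite p0 f0.
Qed.

End Matching.

Section Comparison.
Variables (R : realType) (G : finGroupType) (S : symmetry R G).
Variables (d : nat) (V : orth_rep R G d).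
Local Notation VV' := (sum_rep V (twist_rep S V)).
Local Notation W0 := (zero_rep R G).
Local Notation B := (Balg S VV').
Local Notation B0 := (Balg S W0).
Local Notation C1 := (clifford R 0 1).
Local Notation eps := (B_eps S VV').
Local Notation cst z := (B_in VV' (tw_cst S z)).
Local Notation bas g := (B_in VV' (tw_basis S g)).

Local Notation iota := (balg_incl S V).
Local Notation Bann := (Bann S V).
Local Notation Bcre := (Bcre S V).
Local Notation Bvac := (Bvac S V).
Local Notation Bcar := (Bcar S V).


Variables (Om : universe B) (Om0 : universe B0).
Local Notation U := (dsum (summand Om)).
Local Notation U0 := (dsum (summand Om0)).
Local Notation coord := Defs.coord.

Lemma summand_matching : exists s s' : nat -> nat,
  [/\ cancel s s', cancel s' s &
    forall n, mod_isomorphic (vacmod (summand Om n)) (summand Om0 (s n))].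
Proof.
apply: iso_matching => [n N|m N].
  exact: (summand_inf Om0 (vacmod_irreducible (summand_irr Om n)) N).
have [E irr iso] := vacmod_surjective V (summand_irr Om0 m).
have [n Nn iso'] := summand_inf Om irr N.
by exists n => //; apply: (mod_isomorphic_trans iso (vacmod_iso iso')).
Qed.

End Comparison.

Lemma homeomorphism_G_homotopy_equivalent (R : realType) (G : finGroupType)
    (X Y : topologicalType) (aX : G -> X -> X) (aY : G -> Y -> Y)
    (f : X -> Y) (k : Y -> X) :
  continuous f -> continuous k -> cancel f k -> cancel k f ->
  equivariant aX aY f -> G_homotopy_equivalent R aX aY.
Proof.
move=> cf ck fk kf ef.
have const (Z : topologicalType) (aZ : G -> Z -> Z) (j : Z -> Z) :
    j =1 id -> G_homotopic R aZ aZ j id.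
  move=> j1; exists fst; split; [|by move=> x; rewrite j1|by []|by []].
  by apply: continuous_subspaceT => x; apply: cvg_fst.
exists f, k; split; [by split| |exact: const|exact: const].
split=> // g y; apply: (can_inj fk).
by rewrite ef !kf.
Qed.

(** * Restriction of operators to the vacuum, and the inverse extension *)

Section KspaceComparison.
Variables (R : realType) (G : finGroupType) (S : symmetry R G).
Variables (d : nat) (V : orth_rep R G d).
Local Notation VV' := (sum_rep V (twist_rep S V)).
Local Notation W0 := (zero_rep R G).
Local Notation B := (Balg S VV').
Local Notation B0 := (Balg S W0).
Local Notation C1 := (clifford R 0 1).
Local Notation eps := (B_eps S VV').
Local Notation cst z := (B_in VV' (tw_cst S z)).
Local Notation bas g := (B_in VV' (tw_basis S g)).

Local Notation iota := (balg_incl S V).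
Local Notation Bann := (Bann S V).
Local Notation Bcre := (Bcre S V).
Local Notation Bvac := (Bvac S V).
Local Notation Bcar := (Bcar S V).


Variables (Om : universe B) (Om0 : universe B0).
Local Notation U := (dsum (summand Om)).
Local Notation U0 := (dsum (summand Om0)).
Local Notation K := (@Kspace R G S _ VV' Om).
Local Notation K0 := (@Kspace R G S _ W0 Om0).
Local Notation la := (lact U : B -> lend U).
Local Notation all_i := (enum 'I_d).

Definition Klend (M : K) : lend U := Lend (KopD M) (Kop_scal M).

(** Complex linearity lets [M] pass the constant i, so [M] anticommutes with i f_j as well as with
    e_j. *)
Lemma Klend_ann M i : Klend M * la (Bann i) = - (la (Bann i) * Klend M).
Proof.
have e : Bann i = scal 2^-1 * (B_gen S VV' (lshift d i) +
    cst 'i%C * B_gen S VV' (rshift d i)).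
  by rewrite /Defs.B_in -rmorphM -rmorphD -(tensr_scal C1 (ext_alg S VV')) -rmorphM.
apply: lendP => u; rewrite lendNE !lendME /= e.
rewrite -!scalerA Kop_scal !scalerDl KopD -!scalerA KopC !Kop_anti.
by rewrite scalerN -opprD scalerN.
Qed.

Lemma Klend_cre M i : Klend M * la (Bcre i) = - (la (Bcre i) * Klend M).
Proof.
have e : Bcre i = scal 2^-1 * (B_gen S VV' (lshift d i) -
    cst 'i%C * B_gen S VV' (rshift d i)).
  by rewrite /Defs.B_in -rmorphM -rmorphB -(tensr_scal C1 (ext_alg S VV')) -rmorphM.
have KN u : M (- u) = - M u := lfunN (Klend M) u.
apply: lendP => u; rewrite lendNE !lendME /= e.
rewrite -!scalerA Kop_scal !scalerBl KopD -!scalerA KN KopC.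
by rewrite !Kop_anti scalerN -opprD scalerN.
Qed.

Lemma Klend_vac M : Klend M * la Bvac = la Bvac * Klend M.
Proof.
rewrite vacuum_rmorph; apply: (@vacuum_comm _ _ _ _ _ _ true) => i _;
  rewrite expr1 mulN1r.
  exact: Klend_ann.
exact: Klend_cre.
Qed.

Lemma Kop_vac (M : K) u : M (Bvac *: u) = Bvac *: M u.
Proof. exact: (lact_comm (Klend_vac M)). Qed.

Variables (s s' : nat -> nat) (t : U0 -> U) (t' : U -> U0).
Hypothesis ss' : cancel s s'.
Hypothesis s's : cancel s' s.
Hypothesis tD : forall u v, t (u + v) = t u + t v.
Hypothesis tZ : forall x v, t (x *: v) = iota x *: t v.
Hypothesis t'D : forall u v, t' (u + v) = t' u + t' v.
Hypothesis t'Z : forall x u, t' (iota x *: u) = x *: t' u.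
Hypothesis tK : cancel t t'.
Hypothesis t'K : forall u, t (t' u) = Bvac *: u.
Hypothesis t_loc : forall v n, Defs.coord v (s n) = 0 -> Defs.coord (t v) n = 0.
Hypothesis t'_loc : forall u m, Defs.coord u (s' m) = 0 -> Defs.coord (t' u) m = 0.

Lemma t_vac v : Bvac *: t v = t v.
Proof. by rewrite -t'K tK. Qed.

Section Forward.
Variable M : K.
Definition fwd_op (v : U0) : U0 := t' (M (t v)).
Fact fwdD u v : fwd_op (u + v) = fwd_op u + fwd_op v.
Proof. by rewrite /fwd_op tD KopD t'D. Qed.
Fact fwdC z v : fwd_op (B_in W0 (tw_cst S z) *: v) = B_in W0 (tw_cst S z) *: fwd_op v.
Proof. by rewrite /fwd_op tZ balg_incl_in KopC -t'Z balg_incl_in. Qed.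
Fact fwdK v : fwd_op (fwd_op v) = v.
Proof.
rewrite /fwd_op t'K.
by rewrite Kop_vac (KopK M) t_vac tK.
Qed.
Fact fwd_anti i v : fwd_op (B_gen S W0 i *: v) = - (B_gen S W0 i *: fwd_op v).
Proof. by case: i. Qed.

(** The reindexing need not be monotone, so U_n need not correspond to any U_m; it is enough that
    all indices above m come from indices above n. *)
Lemma fwd_at_stage n m : (forall k, (m < k)%N -> (n < s' k)%N) ->
  at_stage n M ->
  (forall v : U0, in_Un m v -> in_Un m (fwd_op v)) /\
  (forall v : U0, above_Un m v -> fwd_op v = B_eps S W0 *: v).
Proof.
move=> nm hM; split=> v hv.
  move=> k mk; apply: t'_loc; rewrite (at_stage_coord _ hM (nm _ mk)).
  by rewrite t_loc ?scaler0 // s's; apply: hv.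
rewrite /fwd_op (proj2 hM).
  by rewrite -(balg_incl_eps S V) t'Z tK.
move=> j jn; apply: t_loc; apply: hv.
by rewrite leqNgt; apply/negP => /nm; rewrite ss' ltnNge jn.
Qed.

Fact fwd_stage : exists m, at_stage m fwd_op.
Proof.
have [n hM] := Kop_stage M; have [m hm] := cancel_bound s's n.+1.
by exists m; apply: (fwd_at_stage _ hM) => k /ltnW; apply: hm.
Qed.

Definition fwd : K0 := KSpace fwdD fwdC fwdK fwd_anti fwd_stage.
End Forward.

Section Backward.
Variable N : K0.
Let core u : U := t (N (t' u)).
Fact core_D u v : core (u + v) = core u + core v.
Proof. by rewrite /core t'D KopD tD. Qed.
Fact core_Z (r : R) u : core ((scal r : B) *: u) = (scal r : B) *: core u.
Proof.
by rewrite /core -(balg_incl_scal S V) t'Z Kop_scal tZ.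
Qed.
Definition bwd_core : lend U := Lend core_D core_Z.

Lemma bwd_core_vac : bwd_core * la Bvac = bwd_core.
Proof.
apply: lendP => u; rewrite lendME /= /core.
by rewrite -[in LHS]t'K tK.
Qed.
Lemma vac_bwd_core : la Bvac * bwd_core = bwd_core.
Proof. by apply: lendP => u; rewrite lendME /= t_vac. Qed.

Definition bwd_lend : lend U :=
  dress (la \o Bann) (fun i => - la (Bcre i)) all_i bwd_core.

Let lcar : car (la \o Bann) (la \o Bcre) := car_rmorph la Bcar.

Let core_cre i : bwd_core * la (Bcre i) = 0.
Proof. by rewrite -bwd_core_vac -mulrA -rmorphM (vac_b Bcar) rmorph0 mulr0. Qed.
Let ann_core i : la (Bann i) * bwd_core = 0.
Proof. by rewrite -vac_bwd_core mulrA -rmorphM (a_vac Bcar) rmorph0 mul0r. Qed.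

(** The pair (-a, -b) satisfies the relations of (a, b), as signs cancel in products, and the core
    respects the vacuum on both sides; so the dressed sum intertwines the two pairs. *)
Lemma bwd_cre i : bwd_lend * la (Bcre i) = - (la (Bcre i) * bwd_lend).
Proof.
rewrite -mulNr.
apply: (@dress_b _ _ _ (la \o Bcre) lcar (fun i => - la (Bcre i))).
- by move=> k l; rewrite !mulrNN (car_bb lcar).
- by move=> k; rewrite mulrNN (car_b2 lcar).
- exact: core_cre.
- exact: enum_uniq.
by rewrite mem_enum.
Qed.

Lemma bwd_ann i : bwd_lend * la (Bann i) = - (la (Bann i) * bwd_lend).
Proof.
rewrite -mulNr.
apply: (@dress_a _ _ _ (la \o Bcre) lcar (fun i => - la (Bcre i))
  (fun i => - la (Bann i))).
- by move=> k l; rewrite !mulrNN (car_ab lcar).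
- by move=> k; rewrite mulNr ann_core oppr0.
- exact: enum_uniq.
by rewrite mem_enum.
Qed.

Lemma bwd_cst z : bwd_lend * la (cst z) = la (cst z) * bwd_lend.
Proof.
rewrite dress_mulr; last by move=> i /=; rewrite -[LHS]rmorphM -Bcst_ann rmorphM.
rewrite (@dress_mull _ _ _ _ (fun i => - la (Bcre i))).
  congr dress; apply: lendP => u; rewrite !lendME /= /core.
  by rewrite -(balg_incl_in V) t'Z KopC tZ.
by move=> i _; rewrite mulrN mulNr -rmorphM Bcst_cre rmorphM.
Qed.

Lemma bwd_vac : bwd_lend * la Bvac = bwd_core.
Proof.
rewrite dress_killr ?bwd_core_vac // => i /=.
by rewrite -rmorphM (a_vac Bcar) rmorph0.
Qed.

(** Moving the left factor through the sum turns every -b_i into b_i, and the core becomes N^2 = 1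
    on the vacuum, that is p. What remains is the expansion of 1. *)
Lemma bwdK : bwd_lend * bwd_lend = 1.
Proof.
rewrite {2}/bwd_lend (@dress_mull _ _ _ _ (la \o Bcre)); last first.
  by move=> i _; rewrite mulrN bwd_cre opprK.
have -> : bwd_lend * bwd_core = la Bvac.
  rewrite -vac_bwd_core mulrA bwd_vac.
  apply: lendP => u; rewrite lendME /= /core.
  by rewrite tK KopK t'K.
by rewrite vacuum_rmorph (dress_vac lcar).
Qed.

Fact bwdC z u : bwd_lend (cst z *: u) = cst z *: bwd_lend u.
Proof. by have /(congr1 (fun f : lend U => f u)) := bwd_cst z. Qed.
Fact bwdKu u : bwd_lend (bwd_lend u) = u.
Proof. by have /(congr1 (fun f : lend U => f u)) := bwdK. Qed.
Fact bwd_anti i u : bwd_lend (B_gen S VV' i *: u) = - (B_gen S VV' i *: bwd_lend u).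
Proof.
suff /(congr1 (fun f : lend U => f u)) : bwd_lend * la (B_gen S VV' i) =
    - (la (B_gen S VV' i) * bwd_lend) by [].
have [j [->|->]] := Bgen_decomp S V i.
  by rewrite rmorphD mulrDr bwd_ann bwd_cre -opprD -mulrDl.
rewrite mulN1r rmorphM rmorphB mulrA bwd_cst -mulrA mulrBr bwd_ann bwd_cre.
by rewrite opprK addrC -opprB -mulrBl mulrN mulrA.
Qed.

(** Above the stage the core is eps p. As eps anticommutes with the creators, it comes out of the
    sum, changing -b_i into b_i, and leaves the expansion of 1. *)
Lemma bwd_at_stage n m : (forall k, (m < k)%N -> (n < s k)%N) ->
  at_stage n N -> at_stage m bwd_lend.
Proof.
move=> nm hN; split=> u hu.
  apply: dress_supp => [{}u {}hu k mk|]; last exact: hu.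
  apply: t_loc.
  rewrite (at_stage_coord _ hN (nm _ mk)) t'_loc ?scaler0 //.
  by rewrite ss'; apply: hu.
have hcore v : above_Un m v -> bwd_core v = (la eps * la Bvac) v.
  move=> hv; rewrite /= /core (proj2 hN) ?tZ ?t'K ?balg_incl_eps //.
  move=> j jn; apply: t'_loc; apply: hv.
  by rewrite leqNgt; apply/negP => /nm; rewrite s's ltnNge jn.
rewrite [LHS](@dress_eq_supp R B (summand Om) d Bann (fun j => (j <= m)%N) _ _
  (fun i => - la (Bcre i)) all_i hcore u hu).
rewrite -(@dress_mull _ _ _ (la \o Bcre)); last first.
  by move=> i _; rewrite -[LHS]rmorphM Beps_cre rmorphN rmorphM mulNr.
by rewrite vacuum_rmorph (dress_vac lcar) mulr1.
Qed.

Fact bwd_stage : exists m, at_stage m bwd_lend.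
Proof.
have [n hN] := Kop_stage N; have [m hm] := cancel_bound ss' n.+1.
by exists m; apply: (bwd_at_stage _ hN) => k /ltnW; apply: hm.
Qed.

Definition bwd : K := KSpace (lfunD bwd_lend) bwdC bwdKu bwd_anti bwd_stage.
End Backward.
Lemma fwdbwd (N : K0) : fwd (bwd N) = N.
Proof.
apply: Kspace_eq => v; rewrite /= /fwd_op.
have e : bwd_lend N (Bvac *: t v) = t (N (t' (t v))).
  by have /(congr1 (fun f : lend U => f (t v))) := bwd_vac N.
by rewrite -(t_vac v) /= e !tK.
Qed.

(** Multiply the expansion of 1 by [M] and push [M] through: each creator gives a sign, and [M]
    reaches p, where it is its own restriction. *)
Lemma bwdfwd (M : K) : bwd (fwd M) = M.
Proof.
suff e : bwd_lend (fwd M) = Klend M.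
  by apply: Kspace_eq => u; have /(congr1 (fun f : lend U => f u)) := e.
have -> : bwd_lend (fwd M) = dress (la \o Bann) (fun i => - la (Bcre i)) all_i
    (Klend M * la Bvac).
  congr dress; apply: lendP => u.
  by rewrite /= /fwd_op !t'K -Kop_vac scalerA (vacK Bcar).
rewrite -(@dress_mull _ _ _ (la \o Bcre)); last first.
  by move=> i _; rewrite Klend_cre mulNr.
by rewrite vacuum_rmorph (dress_vac (car_rmorph la Bcar)) mulr1.
Qed.

Lemma fwd_equivariant g M : fwd (Kact g M) = Kact g (fwd M).
Proof.
apply: Kspace_eq => v; rewrite /= /fwd_op /= /Kact_op /= /fwd_op.
rewrite -(balg_incl_scal S V) -!(balg_incl_in V) !t'Z.
by rewrite tZ.
Qed.

Local Open Scope classical_set_scope.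

Fact pull_functionalD (l : functional Om0) u v : l (t' (u + v)) = l (t' u) + l (t' v).
Proof. by rewrite t'D functionalD. Qed.
Fact pull_functionalZ (l : functional Om0) (r : R) u :
  l (t' ((scal r : B) *: u)) = r * l (t' u).
Proof. by rewrite -(balg_incl_scal S V) t'Z functionalZ. Qed.
Definition pull_functional l := Functional (pull_functionalD l) (pull_functionalZ l).

Fact push_functionalD (l : functional Om) u v : l (t (u + v)) = l (t u) + l (t v).
Proof. by rewrite tD functionalD. Qed.
Fact push_functionalZ (l : functional Om) (r : R) v :
  l (t ((scal r : B0) *: v)) = r * l (t v).
Proof. by rewrite tZ balg_incl_scal functionalZ. Qed.
Definition push_functional l := Functional (push_functionalD l) (push_functionalZ l).

Fact lend_functionalD (f : lend U) (l : functional Om) u v :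
  l (f (u + v)) = l (f u) + l (f v).
Proof. by rewrite lfunD functionalD. Qed.
Fact lend_functionalZ (f : lend U) (l : functional Om) (r : R) u :
  l (f ((scal r : B) *: u)) = r * l (f u).
Proof. by rewrite lfunZ functionalZ. Qed.
Definition lend_functional f l :=
  Functional (lend_functionalD f l) (lend_functionalZ f l).

Lemma fwd_continuous : continuous fwd.
Proof.
apply: Kmap_continuous => [n|n u l].
  have [m hm] := cancel_bound s's n.+1.
  by exists m => M hM; apply: (fwd_at_stage _ hM) => k /ltnW; apply: hm.
have := @coef_continuous _ _ _ _ _ Om n (t u) (pull_functional l).
exact.
Qed.

Lemma bwd_continuous : continuous bwd.
Proof.
apply: Kmap_continuous => [n|n u l].
  have [m hm] := cancel_bound ss' n.+1.
  by exists m => N hN; apply: (bwd_at_stage _ hN) => k /ltnW; apply: hm.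
rewrite /bwd /= /bwd_lend.
(* Each further index adds a coefficient of the shorter sum, with u replaced by a_i u and l composed
   with -b_i; hence both are generalized. In the end a coefficient is a finite sum of coefficients
   of N. *)
elim: all_i u l => [|i r IH] u l /=.
  have := @coef_continuous _ _ _ _ _ Om0 n (t' u) (push_functional l).
  exact.
have -> : (fun N : initial_topology (@matrix_coef R G S 0 W0 Om0 n) =>
    l (dress (la \o Bann) (fun i => - la (Bcre i)) r (bwd_core (sval N)) u -
       Bcre i *: dress (la \o Bann) (fun i => - la (Bcre i)) r
         (bwd_core (sval N)) (Bann i *: u))) =
  (fun N : initial_topology (@matrix_coef R G S 0 W0 Om0 n) =>
    l (dress (la \o Bann) (fun i => - la (Bcre i)) r (bwd_core (sval N)) u) +
    lend_functional (- la (Bcre i)) l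
      (dress (la \o Bann) (fun i => - la (Bcre i)) r
         (bwd_core (sval N)) (Bann i *: u))).
  by apply: funext => N; apply: (functionalD l).
by move=> N; apply: (@cvgD _ _ _ (nbhs N)); apply: IH.
Qed.

Lemma Kspace_G_homotopy_equivalent :
  G_homotopy_equivalent R (@Kact R G S _ VV' Om) (@Kact R G S _ W0 Om0).
Proof.
exact: (homeomorphism_G_homotopy_equivalent R fwd_continuous bwd_continuous
  bwdfwd fwdbwd fwd_equivariant).
Qed.

End KspaceComparison.

Theorem mainTheorem2 (R : realType) (G : finGroupType) (S : symmetry R G)
    (d : nat) (V : orth_rep R G d) :
  let VV' := sum_rep V (twist_rep S V) in
  super_isomorphic (ext_alg S VV')
    (super_tensor (super_tensor (clifford R d 0) (clifford R 0 d))
                  (twisted_alg S))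
  /\
  forall (Om : universe (Balg S VV')) (Om0 : universe (Balg S (zero_rep R G))),
    G_homotopy_equivalent R (@Kact R G S _ VV' Om)
                            (@Kact R G S _ (zero_rep R G) Om0).
Proof.
move=> VV'; split=> [|Om Om0]; first exact: ext_alg_doubled.
have [s [s' [ss' s's iso]]] := summand_matching Om Om0.
have [t [t' [[tD tZ] [t'D t'Z] [tK t'K] [tl t'l]]]] := @dsum_matching R
  _ _ (balg_incl S V) (Bvac S V) (summand Om) (fun n => vacmod (summand Om n))
  (summand Om0) (fun n => @vac_val _ _ _ _ _ (summand Om n))
  (fun n => @vac_proj _ _ _ _ _ (summand Om n))
  (fun n => @vac_valD _ _ _ _ _ _) (fun n => @vac_valZ _ _ _ _ _ _)
  (fun n => @vac_projD _ _ _ _ _ _) (fun n => @vac_projZ _ _ _ _ _ _)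
  (fun n => @vac_projK _ _ _ _ _ _) (fun n u => erefl) s s' ss' s's iso.
exact: (Kspace_G_homotopy_equivalent ss' s's tD tZ t'D t'Z tK t'K tl t'l).
Qed.
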